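(* Let $K$ be a field of characteristic zero, let $\mathcal{O}=K[x^2]x$ be the monoid of odd polynomials under composition, let $a\in\mathcal{O}$ with $\deg(a)>1$, and let $a=p_1\circ\cdots\circ p_r=q_1\circ\cdots\circ q_s$ be two decompositions of the element $a$ into irreducible factors of the monoid $\mathcal{O}$. Then: 1. $r=s$ and $\deg(p_1)=\deg(q_{\sigma(1)}),\ldots,\deg(p_r)=\deg(q_{\sigma(r)})$ for a permutation $\sigma\in S_r$. 2. If the decompositions are distinct, then one can be obtained from the other by finitely many transformations on adjacent irreducible factors of the following two types: (a) $p_1\circ\cdots\circ p_i\circ p_{i+1}\circ\cdots\circ p_r=p_1\circ\cdots\circ(p_i\circ u)\circ(u^{-1}\circ p_{i+1})\circ\cdots\circ p_r$, where $u\in\mathcal{O}^*$; (b) $p_1\circ\cdots\circ p_i\circ p_{i+1}\circ\cdots\circ p_r=p_1\circ\cdots\circ p_i^*\circ p_{i+1}^*\circ\cdots\circ p_r$, where $p_i\circ p_{i+1}=p_i^*\circ p_{i+1}^*$, the degrees $\deg(p_i)$ and $\deg(p_{i+1})$ are co-prime, $\deg(p_i)=\deg(p_{i+1}^* )$ and $\deg(p_{i+1})=\deg(p_i^* )$. 3. There are only the following options for the pairs $P:=(p_i,p_{i+1})$ and $P^*:=(p_i^*,p_{i+1}^* )$: (a) $P=(T_n,T_m)$ and $P^*=(T_m,T_n)$, where $n$ and $m$ are odd distinct primes; (b) $P=(x^t[\alpha(x^2)]^s,\ x^s)$ and $P^*=(x^s,\ x^t\alpha(x^{2s}))$; (c)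 $P=(x^s,\ x^t\alpha(x^{2s}))$ and $P^*=(x^t[\alpha(x^2)]^s,\ x^s)$; where $s$ is an odd prime number, $t$ is an odd number, and $\alpha\in K[x]\setminus K$ with $\alpha(0)\neq 0$.
   Context: Composition of polynomials: $(a\circ b)(x):=a(b(x))$. The monoid $(\mathcal{O},\circ)$ has identity element $x$ and group of units $\mathcal{O}^*=\{\lambda x\mid\lambda\in K,\ \lambda\neq 0\}$; $u^{-1}$ denotes the inverse of a unit $u$ with respect to $\circ$. An irreducible element of $\mathcal{O}$ is an element of degree $>1$ which is not a composition of two non-units of $\mathcal{O}$. $T_n$ is the trigonometric polynomial, defined by $T_n(\cos t)=\cos(nt)$. $S_r$ is the symmetric group. The pairs $P$ and $P^*$ in part 3 are those occurring in the transformations of type (b) in part 2; the letter $s$ in part 3 is unrelated to the number $s$ of factors $q_j$.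
   Formalization: Part 3 fails as printed; here the pairs are taken up to units of O, T_n and T_m in (a) may be replaced by their conjugates d^{-1}T_n(dx), d^{-1}T_m(dx) with d^2 in K, d nonzero, and the case alpha=1, P=(x^n,x^m), P*=(x^m,x^n) with n, m distinct odd primes, is added. *)

(* Defs.v *)
From Stdlib Require Import Relation_Operators.
From mathcomp Require Import all_boot all_order all_algebra.
From mathcomp Require Import ring.

Set Implicit Arguments.
Unset Strict Implicit.
Unset Printing Implicit Defensive.

Import GRing.Theory.
Local Open Scope ring_scope.

Section OddPolynomials.

Variable K : fieldType.
Implicit Types (p q a u v alpha : {poly K}) (ps qs : seq {poly K}).

Definition deg p : nat := (size p).-1.

(* The monoid O = K[x^2]x; it contains the zero polynomial. *)
Definition inO p : Prop := exists g : {poly K}, p = (g \Po 'X^2) * 'X.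

(* The units of (O, o), see inO_unitP; the inverse of l *: 'X is l^-1 *: 'X. *)
Definition unitO u : Prop := exists2 l : K, l != 0 & u = l *: 'X.

Definition irreducibleO p : Prop :=
  [/\ inO p, (1 < deg p)%N &
      forall b c, inO b -> inO c -> p = b \Po c -> unitO b \/ unitO c].

(* p_1 o ... o p_r; in MathComp, p \Po q is the polynomial p(q(x)). *)
Definition compseq ps : {poly K} := foldr (fun p q => p \Po q) 'X ps.

Definition irr_decomposition a ps : Prop :=
  (forall p, p \in ps -> irreducibleO p) /\ compseq ps = a.

Definition stepA ps qs : Prop :=
  exists l r p q (c : K),
    [/\ c != 0, ps = l ++ p :: q :: r &
        qs = l ++ (p \Po (c *: 'X)) :: ((c^-1 *: 'X) \Po q) :: r].

Definition coprime_swap (P P' : {poly K} * {poly K}) : Prop :=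
  [/\ [/\ irreducibleO P.1, irreducibleO P.2,
          irreducibleO P'.1 & irreducibleO P'.2],
      P.1 \Po P.2 = P'.1 \Po P'.2,
      coprime (deg P.1) (deg P.2),
      deg P.1 = deg P'.2 & deg P.2 = deg P'.1].

Definition stepB ps qs : Prop :=
  exists l r P P',
    [/\ coprime_swap P P', ps = l ++ P.1 :: P.2 :: r &
        qs = l ++ P'.1 :: P'.2 :: r].

Definition linked : seq {poly K} -> seq {poly K} -> Prop :=
  clos_refl_trans _ (fun ps qs => stepA ps qs \/ stepB ps qs).

(* Chebyshev polynomials of the first kind.  With x = (z + z^-1) / 2 and
   z = e^(it), chebyshevE below reads T_n (cos t) = cos (n t). *)
Fixpoint chebyshev (n : nat) : {poly K} :=
  match n with
  | 0 => 1
  | n'.+1 => match n' with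
             | 0 => 'X
             | m.+1 => 2%:R *: ('X * chebyshev n') - chebyshev m
             end
  end.

(* For n odd, T_n = g_n(x^2) x and this is g_n(c x^2) x, i.e. the conjugate
   (d^-1 x) o T_n o (d x) of T_n for any square root d of c.  It has
   coefficients in K even when d lies in a quadratic extension of K. *)
Definition chebyshev_twist (c : K) (n : nat) : {poly K} :=
  (odd_poly (chebyshev n) \Po (c *: 'X^2)) * 'X.

(* (P, P') is (A, A') up to units: a common left unit u1 and a common right
   unit u2 on the compositions, and units w, w' inserted between the factors
   as in stepA. *)
Definition equiv_units (P P' A A' : {poly K} * {poly K}) : Prop :=
  exists u1 u2 w w' : K,
    [/\ u1 != 0, u2 != 0, w != 0 & w' != 0] /\
    [/\ P.1 = (u1 *: 'X) \Po (A.1 \Po (w *: 'X)),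
        P.2 = (w^-1 *: 'X) \Po (A.2 \Po (u2 *: 'X)),
        P'.1 = (u1 *: 'X) \Po (A'.1 \Po (w' *: 'X)) &
        P'.2 = (w'^-1 *: 'X) \Po (A'.2 \Po (u2 *: 'X))].

Definition chebyshev_option (P P' : {poly K} * {poly K}) : Prop :=
  exists n m (c : K),
    [/\ prime n /\ odd n, prime m /\ odd m, n <> m, c != 0 &
        equiv_units P P' (chebyshev_twist c n, chebyshev_twist c m)
                         (chebyshev_twist c m, chebyshev_twist c n)].

Definition power_option (P P' : {poly K} * {poly K}) : Prop :=
  exists s t alpha,
    [/\ prime s /\ odd s, odd t, (1 < size alpha)%N, alpha.[0] != 0 &
        equiv_units P P' ('X^t * (alpha \Po 'X^2) ^+ s, 'X^s)
                         ('X^s, 'X^t * (alpha \Po 'X^(2 * s)))].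

(* The degenerate case alpha = 1 of power_option. *)
Definition monomial_option (P P' : {poly K} * {poly K}) : Prop :=
  exists n m,
    [/\ prime n /\ odd n, prime m /\ odd m, n <> m &
        equiv_units P P' ('X^n, 'X^m) ('X^m, 'X^n)].

Lemma inO_unitP u :
  unitO u <->
  inO u /\ exists v, [/\ inO v, u \Po v = 'X & v \Po u = 'X].
Proof.
have inOZ (c : K) : inO (c *: 'X).
  by exists c%:P; rewrite comp_polyC mul_polyC.
have compZ (c d : K) : (c *: 'X) \Po (d *: 'X) = (c * d) *: 'X :> {poly K}.
  by rewrite comp_polyZ comp_polyX scalerA.
split=> [[l l0 ->]|[[g ->] [v [_ uv _]]]].
  split=> //; exists (l^-1 *: 'X).
  by rewrite !compZ mulfV // mulVf // scale1r; split.
have := congr1 deg uv; rewrite /deg size_comp_poly size_polyX /=.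
have [->|g0] := eqVneq g 0; first by rewrite comp_poly0 mul0r size_poly0.
have gX0 : g \Po 'X^2 != 0 by rewrite comp_poly_eq0 ?size_polyXn.
rewrite size_mulX //= => /eqP; rewrite muln_eq1 => /andP[sz _].
have : (size (g \Po 'X^2)).-1 = 0%N by rewrite (eqP sz).
rewrite size_comp_poly size_polyXn /= => /eqP; rewrite muln_eq0 orbF => /eqP g1.
have /size1_polyC def_g : (size g <= 1)%N by case: (size g) g1 => [|[]].
move: g0; rewrite def_g comp_polyC mul_polyC polyC_eq0 => g00.
by exists g`_0.
Qed.

Lemma chebyshevSS n :
  chebyshev n.+2 = 2%:R *: ('X * chebyshev n.+1) - chebyshev n.
Proof. by []. Qed.

Lemma chebyshevE n (z : K) : z != 0 -> 2%:R != 0 :> K ->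
  (chebyshev n).[(z + z^-1) / 2%:R] = (z ^+ n + z ^- n) / 2%:R.
Proof.
move=> z0 two0.
suff [] : (chebyshev n).[(z + z^-1) / 2%:R] = (z ^+ n + z ^- n) / 2%:R /\
    (chebyshev n.+1).[(z + z^-1) / 2%:R] = (z ^+ n.+1 + z ^- n.+1) / 2%:R by [].
elim: n => [|n [IH1 IH2]].
  by split; rewrite /= ?hornerX ?expr1 // hornerC expr0 invr1 -mulr2n divff.
split=> //; rewrite chebyshevSS hornerD hornerN hornerZ hornerM hornerX IH2 IH1.
rewrite !exprS; have zn0 : z ^+ n != 0 by rewrite expf_neq0.
by field; rewrite z0 zn0 two0.
Qed.

Lemma chebyshev_even_odd n :
  (~~ odd n -> odd_poly (chebyshev n) = 0) /\
  (odd n -> even_poly (chebyshev n) = 0).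
Proof.
suff [] : ((~~ odd n -> odd_poly (chebyshev n) = 0) /\
           (odd n -> even_poly (chebyshev n) = 0)) /\
          ((~~ odd n.+1 -> odd_poly (chebyshev n.+1) = 0) /\
           (odd n.+1 -> even_poly (chebyshev n.+1) = 0)) by [].
elim: n => [|n [[IH1 IH2] [IH3 IH4]]].
  split; split=> //= _; first exact: odd_polyC.
  by rewrite -['X]mul1r even_polyMX odd_polyC mul0r.
split=> //; rewrite chebyshevSS ['X * _]mulrC; split.
  rewrite [odd _]/= negbK => n0.
  rewrite -scaleN1r odd_polyD !odd_polyZ odd_polyMX IH4 ?IH1 //.
  by rewrite !scaler0 addr0.
rewrite [odd _]/= negbK => n1.
rewrite -scaleN1r even_polyD !even_polyZ even_polyMX IH3 ?IH2 //= ?n1 //.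
by rewrite mul0r !scaler0 addr0.
Qed.

Lemma chebyshev_oddE n :
  odd n -> chebyshev n = (odd_poly (chebyshev n) \Po 'X^2) * 'X.
Proof.
move=> n1; rewrite -{1}[chebyshev n]poly_even_odd.
by rewrite (chebyshev_even_odd n).2 // comp_poly0 add0r.
Qed.

Lemma chebyshev_twist1 n : odd n -> chebyshev_twist 1 n = chebyshev n.
Proof. by move=> n1; rewrite /chebyshev_twist scale1r -chebyshev_oddE. Qed.

Lemma chebyshev_twist_sqr (d : K) n : d != 0 -> odd n ->
  chebyshev_twist (d ^+ 2) n =
  (d^-1 *: 'X) \Po (chebyshev n \Po (d *: 'X)).
Proof.
move=> d0 n1; rewrite comp_polyZ comp_polyX (chebyshev_oddE n1).
rewrite comp_polyM comp_polyX -comp_polyA comp_Xn_poly exprZn.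
by rewrite -scalerAr scalerA mulVf // scale1r.
Qed.

End OddPolynomials.

(* Main.v *)
From Stdlib Require Import Classical Relation_Operators.
Require Import Defs.
From mathcomp Require Import all_boot all_order all_fingroup all_algebra all_field.
From mathcomp Require Import ring zify.

(** The heart of the matter is the lattice of right factors of a polynomial f.
    In characteristic zero, two decompositions f = g1 o h1 = g2 o h2 have a
    common right factor h of degree gcd(deg h1, deg h2) with h1, h2 in K[h]
    [gcd_right_factor], and f lies in K[w] for some w of degree lcm(deg h1,
    deg h2) in the intersection of K[h1] and K[h2] [lcm_left_factor]. In
    particular a right factor is determined by its degree up to a linear
    polynomial on its left; comparing c(x) with c(-x), this makes the factors
    of an odd polynomial odd once the inner one is normalised to have no
    constant term [odd_right_factor]. So irreducibility in the monoid of odd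
    polynomials is indecomposability in K[x], and the first two parts follow
    by induction on the degree [ritt_first]: if the innermost factors p and q
    of two decompositions of a are not associated, their degrees are coprime,
    and a goes through a w = V o p = V' o q of degree deg p * deg q, where V
    and V' are again irreducible; the two given decompositions are linked, by
    induction, to decompositions ending in V o p and V' o q, which one swap
    connects.

    The common w comes from approximate roots: up to normalisation, both K[h1]
    and K[h2] contain the unique monic polynomial of the right degree whose
    power approximates f best. The common right factor and the last part come
    from the polynomials h(X) - h(Y). Their highest-degree form is, up to a
    constant, X^n - Y^n, which is squarefree, so coprimality can be read off
    on leading forms. One consequence is that in a swap a o b = c o d with
    coprime deg b and deg d, the map d is injective on the fibre of b over any
    non-critical point x of a [fibre_inj]; hence b has at least as many
    critical points over x as c has over a(x) [simple_point_ramification].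
    Count this over a field in which the relevant fibres are rational. Write
    s(l) for the number of simple points of a over l. The sum of s(c(y)) over
    the critical points y of c is at most deg c - 1, their number. On the
    other hand a is odd, so it ramifies over l and -l in the same way, and
    Riemann-Hurwitz forces s(l) to be at least 1 plus the number of critical
    points of a over 0, for every nonzero l. Comparing, and exchanging the
    roles of a and c, leaves two cases [odd_swap_dichotomy].

    Either c or a has 0 as its only root, hence is a scalar multiple of a
    power. If c = g x^n, then n is prime, multiplicities of roots show that b
    is a multiple of x^n as well, and the equation a(b x^n) = g d^n gives the
    shape of a and d by comparison of coefficients [power_shape].

    Or neither a nor c has a critical point over 0, and all their critical
    points lie over two opposite values l and -l, half of them over each. Such
    a polynomial p of degree n satisfies the Pell equation n^2 (p^2 - l^2) =
    (x^2 - xi^2) p'^2; the same holds for b, with xi in place of l.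
    Differentiation turns this into a linear differential equation whose
    solutions of degree n are proportional, so p is a twisted Chebyshev
    polynomial [pell_twist_eq]. The squares l^2 and xi^2 are determined by
    coefficients of p and so lie in K although l and xi need not, which is why
    the twists occur [pell_descent]. *)

Set Implicit Arguments.
Unset Strict Implicit.
Unset Printing Implicit Defensive.

Import GRing.Theory.
Local Open Scope ring_scope.

(** * Top forms of bivariate polynomials *)

Section TopForm.
Variable K : fieldType.
Implicit Types (p q r : {poly {poly K}}) (a b c d f g h : {poly K}).

(** The polynomial p(xZ, Z), where p(X, Y) has outer variable X and inner
    variable Y, and Z is the new outer variable: the coefficient of Z^k is the
    form of degree k in p, dehomogenised at Y = 1. *)
Definition homog p : {poly {poly K}} :=
  (map_poly (map_poly polyC) p).['X *: 'X].

Definition topform p : {poly K} := lead_coef (homog p).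

(** The degree in X of p is attained in its highest-degree form. This is what
    makes leading forms control divisibility over K(Y), where only the degree
    in X counts. *)
Definition topfull p := size (topform p) = size p.

Lemma homogM p q : homog (p * q) = homog p * homog q.
Proof. by rewrite /homog rmorphM hornerM. Qed.

Lemma homogB p q : homog (p - q) = homog p - homog q.
Proof. by rewrite /homog rmorphB hornerD hornerN. Qed.

Lemma homogC c : homog c%:P = map_poly polyC c.
Proof. by rewrite /homog map_polyC hornerC. Qed.

Lemma coef_homog p k i : (homog p)`_k`_i = if (i <= k)%N then p`_i`_(k - i) else 0.
Proof.
rewrite /homog (@horner_coef_wide _ (maxn (size p) k.+1)); last first.
  by rewrite (leq_trans (size_poly _ _)) // leq_maxl.
rewrite coef_sum coef_sum.
have E (j : 'I_(maxn (size p) k.+1)) :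
    ((((map_poly (map_poly polyC) p)`_j * ('X *: 'X) ^+ j)`_k)`_i : K) =
    if (j == i :> nat) && (i <= k)%N then p`_i`_(k - i) else 0.
  rewrite coef_map /= exprZn -scalerAr coefZ coefMXn coefXnM.
  have [kj|jk] := ltnP k j.
    rewrite coef0 if_same; case: eqP => //= ji; rewrite -ji leqNgt kj //.
  rewrite coef_map /= coefC subn_eq0.
  have [ji|ij] := eqVneq (j : nat) i.
    by rewrite ji ltnn leqnn /= -ji jk.
  have [//|ji] := ltnP i j.
  by rewrite leqNgt ltn_neqAle ij ji.
rewrite (eq_bigr _ (fun j _ => E j)) {E}.
case: leqP => ik; last by rewrite big1 // => j _; rewrite andbF.
have il : (i < maxn (size p) k.+1)%N by rewrite leq_max ltnS ik orbT.
rewrite (bigD1 (Ordinal il)) //= eqxx big1 ?addr0 // => j.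
by rewrite -val_eqE /= => /negPf ->.
Qed.

Lemma homog_eq0 p : (homog p == 0) = (p == 0).
Proof.
apply/eqP/eqP=> [p0|->]; last by rewrite -[0]polyC0 homogC rmorph0.
apply/polyP=> i; apply/polyP=> j; rewrite !coef0.
have := congr1 (fun r => r`_(i + j)`_i) p0.
by rewrite coef_homog leq_addr addKn !coef0.
Qed.

Lemma topform_eq0 p : (topform p == 0) = (p == 0).
Proof. by rewrite lead_coef_eq0 homog_eq0. Qed.

Lemma topformM p q : topform (p * q) = topform p * topform q.
Proof. by rewrite /topform homogM lead_coefM. Qed.

Lemma topformZ c p : c != 0 -> topform (c *: p) = lead_coef c *: topform p.
Proof.
move=> c0; rewrite -[c *: p]mul_polyC topformM -mul_polyC; congr (_ * _).
by rewrite /topform homogC lead_coef_map_inj //; apply: polyC_inj.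
Qed.

Lemma size_topform p : (size (topform p) <= size p)%N.
Proof.
apply/leq_sizeP => j pj; rewrite /topform lead_coefE coef_homog.
by case: ifP => // _; rewrite (nth_default 0 pj) coef0.
Qed.

(** The X-degrees of the leading forms of p and q are at most those of p and
    q, and both add up to the same total; so both inequalities are equalities. *)
Lemma topfullM p q : p != 0 -> q != 0 -> topfull (p * q) -> topfull p /\ topfull q.
Proof.
move=> p0 q0; rewrite /topfull topformM !size_mul ?topform_eq0 // => E.
have := size_topform p; have := size_topform q.
have := size_poly_gt0 p; have := size_poly_gt0 q; rewrite p0 q0.
move: E; move: (size (topform p)) (size (topform q)) (size p) (size q) => x y z t E *.
by lia.
Qed.

Lemma topfullZ c p : c != 0 -> topfull p -> topfull (c *: p).
Proof.
by move=> c0 fp; rewrite /topfull topformZ // size_scale ?lead_coef_eq0 // fp size_scale.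
Qed.

Lemma topfull_dvdp p q : topfull q -> q != 0 -> p %| q -> topfull p.
Proof.
move=> fq q0 /Pdiv.Idomain.dvdpP[[c u] /= c0 E].
have cq0 : c *: q != 0 by rewrite scale_poly_eq0 negb_or c0.
have [u0 p0] : u != 0 /\ p != 0.
  by apply/andP; rewrite -negb_or -mulf_eq0 -E.
by have [] := @topfullM u p u0 p0; rewrite -?E //; apply: topfullZ.
Qed.

(** Divisibility of polynomials over K[Y] is pseudo-divisibility, that is,
    divisibility over the field K(Y); the polynomial in Y by which it is off
    contributes only a constant to the leading form. *)
Lemma topform_dvdp p q : p %| q -> topform p %| topform q.
Proof.
have [->|q0] := eqVneq q 0.
  by rewrite (_ : topform 0 = 0) ?dvdp0 //; apply/eqP; rewrite topform_eq0.
case/Pdiv.Idomain.dvdpP => -[c u] /= c0 E.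
have := congr1 topform E; rewrite topformZ // topformM => E'.
by rewrite -(@dvdpZr _ (lead_coef c)) ?lead_coef_eq0 // E' dvdp_mull.
Qed.

(** A common factor of p and q inherits from p that its X-degree shows in its
    leading form, and this form divides two coprime polynomials; so it has
    X-degree 0 and is invertible over K(Y). *)
Lemma coprimep_topform p q : p != 0 -> topfull p -> coprimep (topform p) (topform q) ->
  coprimep p q.
Proof.
move=> p0 fp /coprimepP cop; rewrite /coprimep.
have fG := topfull_dvdp fp p0 (dvdp_gcdl p q).
rewrite -fG size_poly_eq1.
by apply: cop; apply: topform_dvdp; rewrite ?dvdp_gcdl ?dvdp_gcdr.
Qed.

Definition diffXY h : {poly {poly K}} := map_poly polyC h - h%:P.

Lemma coef_homog_diffXY h k : (homog (diffXY h))`_k = h`_k *: ('X^k - 1).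
Proof.
apply/polyP=> i; rewrite homogB coefB homogC coef_map /= coefB coef_homog coefC coefZ coefB coefXn coef1.
rewrite coef_map /= coefC subn_eq0; have [ik|ki] := leqP i k; last first.
  by rewrite (gtn_eqF ki); case: i ki => // i _ /=; rewrite !subr0 mulr0.
rewrite [(i == k)]eqn_leq ik /=; case: (leqP k i) => ki.
  have -> : i = k by apply/eqP; rewrite eqn_leq ik ki.
  by case: (k == 0)%N; rewrite /= ?mulr0 ?subrr ?mulr0 // !subr0 mulr1.
by case: (i == 0)%N; rewrite /= !(sub0r, oppr0, mulrN1, mulr0).
Qed.

Lemma topform_diffXY h : (1 < size h)%N -> topform (diffXY h) = lead_coef h *: ('X^((size h).-1) - 1).
Proof.
move=> h1; have sz : size (homog (diffXY h)) = size h.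
  apply/eqP; rewrite eqn_leq; apply/andP; split.
    by apply/leq_sizeP=> j hj; rewrite coef_homog_diffXY nth_default // scale0r.
  case E: (size h) h1 => [|[|n]] // _; rewrite ltnNge; apply/negP => /leq_sizeP.
  move/(_ n.+1 (leqnn _))/eqP; rewrite coef_homog_diffXY scale_poly_eq0.
  have -> : h`_n.+1 = lead_coef h by rewrite lead_coefE E.
  by rewrite lead_coef_eq0 -!size_poly_leq0 E /= size_XnsubC.
by rewrite /topform lead_coefE sz coef_homog_diffXY.
Qed.

Lemma size_diffXY h : (1 < size h)%N -> size (diffXY h) = size h.
Proof.
move=> h1; rewrite /diffXY size_polyDl size_map_polyC // size_polyN.
by rewrite (leq_ltn_trans (size_polyC_leq1 _)).
Qed.

Lemma diffXY_neq0 h : (1 < size h)%N -> diffXY h != 0.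
Proof. by move=> h1; rewrite -size_poly_gt0 size_diffXY // ltnW. Qed.

Lemma topfull_diffXY h : (1 < size h)%N -> topfull (diffXY h).
Proof.
move=> h1; have h0 : h != 0 by rewrite -size_poly_gt0 ltnW.
rewrite /topfull topform_diffXY // size_scale ?lead_coef_eq0 // size_diffXY //.
by case: (size h) h1 => [|[|n]] // _; rewrite size_XnsubC.
Qed.

Lemma lead_coef_diffXY h : (1 < size h)%N -> lead_coef (diffXY h) = (lead_coef h)%:P.
Proof.
move=> h1; rewrite /diffXY lead_coefDl; last first.
  by rewrite size_polyN size_map_polyC (leq_ltn_trans (size_polyC_leq1 _)).
by rewrite lead_coef_map_inj //; apply: polyC_inj.
Qed.

Lemma diffXYD g h : diffXY (g + h) = diffXY g + diffXY h.
Proof. by rewrite /diffXY !rmorphD /=; ring. Qed.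

Lemma diffXYC (c : K) : diffXY c%:P = 0.
Proof. by rewrite /diffXY map_polyC subrr. Qed.

(** As X - Y divides h(X) - h(Y), so b(X) - b(Y) divides a(b(X)) - a(b(Y)).
    The quotient is the divided difference of a at (b(X), b(Y)), whose value
    on the diagonal is a derivative of a; the second part evaluates it at
    points X = t1, Y = t2 in the same fibre of b. *)
Lemma diffXY_comp a b : exists Q, diffXY (a \Po b) = Q * diffXY b /\
  forall t1 t2, b.[t1] = b.[t2] -> Q.[t1%:P].[t2] = a^`().[b.[t1]].
Proof.
elim/poly_ind: a => [|a c [Q [DQ evQ]]].
  by exists 0; rewrite comp_poly0 -polyC0 diffXYC mul0r; split=> // *; rewrite polyC0 deriv0 !horner0.
exists (Q * map_poly polyC b + (a \Po b)%:P); split.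
  rewrite comp_poly_MXaddC diffXYD diffXYC addr0 mulrDl mulrAC -DQ /diffXY !rmorphM /=; ring.
move=> t1 t2 E; rewrite hornerD hornerM hornerC horner_map /= hornerD hornerM.
rewrite hornerC (evQ t1 t2 E) horner_comp -E.
by rewrite derivD derivC addr0 derivM derivX mulr1 hornerD hornerM hornerX addrC.
Qed.
End TopForm.

(** * Compositions, difference polynomials and fibres *)

Section Cyclotomic.
Variable F : fieldType.
Implicit Types g : {poly F}.

(** The Euclidean algorithm on exponents, through Bezout for n and m. *)
Lemma dvdp_Xn_sub1_gcd g n m :
  g %| 'X^n - 1 -> g %| 'X^m - 1 -> g %| 'X^(gcdn n m) - 1.
Proof.
case: n => [|n]; first by rewrite gcd0n.
move=> gn gm; case: (@egcdnP n.+1 m isT) => u v E _.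
have dvdX k l : g %| 'X^k - 1 -> g %| 'X^(l * k) - 1.
  by move=> gk; rewrite mulnC exprM subrX1 dvdp_mulr.
have := dvdX _ u gn; rewrite E exprD.
rewrite (_ : _ - 1 = 'X^(gcdn n.+1 m) * ('X^(v * m) - 1) + ('X^(gcdn n.+1 m) - 1)); last by ring.
by rewrite dvdp_addr // dvdp_mull // dvdX.
Qed.

Lemma dvdn_Xn_sub1 n k : (0 < n)%N -> ('X^n - 1 : {poly F}) %| 'X^k - 1 -> (n %| k)%N.
Proof.
move=> n0 /(dvdp_Xn_sub1_gcd (dvdpp _)).
have [|r0] := posnP (gcdn n k).
  by move/eqP; rewrite eqn0Ngt gcdn_gt0 n0.
move/dvdp_leq => /(_ (monic_neq0 _)); rewrite monicXnsubC // => /(_ isT).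
rewrite !size_XnsubC // ltnS => le; rewrite (_ : n = gcdn n k) ?dvdn_gcdr //.
by apply/eqP; rewrite eqn_leq le dvdn_leq // dvdn_gcdl.
Qed.

Lemma dvdp_Xn_sub1 n k : (n %| k)%N -> ('X^n - 1 : {poly F}) %| 'X^k - 1.
Proof. by case/dvdnP=> q ->; rewrite mulnC exprM [X in _ %| X]subrX1 dvdp_mulr. Qed.

End Cyclotomic.

Section Decomp.
Variable K : fieldType.
Hypothesis charK0 : [pchar K] =i pred0.
Implicit Types (p q r : {poly {poly K}}) (a b c d f g h : {poly K}).

Lemma natrK_eq0 n : (n%:R == 0 :> K) = (n == 0)%N.
Proof. by move/GRing.pcharf0P: charK0. Qed.

Lemma oppK_eq (l : K) : (- l == l) = (l == 0).
Proof.
by rewrite eq_sym -subr_eq0 opprK -mulr2n -mulr_natl mulf_eq0 natrK_eq0.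
Qed.

Lemma polyC_unit (c : K) : c != 0 -> c%:P \is a @GRing.unit {poly K}.
Proof. by move=> c0; rewrite poly_unitE size_polyC c0 coefC unitfE. Qed.

Lemma lead_coef_diffXY_unit h : (1 < size h)%N -> lead_coef (diffXY h) \is a GRing.unit.
Proof.
move=> h1; rewrite lead_coef_diffXY // polyC_unit // lead_coef_eq0.
by rewrite -size_poly_gt0 ltnW.
Qed.

Lemma lead_neq0 (R : nzRingType) (h : {poly R}) : (1 < size h)%N -> lead_coef h != 0.
Proof. by move=> h1; rewrite lead_coef_eq0 -size_poly_gt0 ltnW. Qed.

Lemma deg_gt0 h : (0 < deg h)%N = (1 < size h)%N.
Proof. by rewrite /deg; case: (size h) => [|[]]. Qed.

Lemma deg_comp g h : deg (g \Po h) = (deg g * deg h)%N.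
Proof. exact: size_comp_poly. Qed.

Lemma size_deg h : (0 < deg h)%N -> size h = (deg h).+1.
Proof. by rewrite /deg; case: (size h). Qed.

Lemma deg_subC h (l : K) : (0 < deg h)%N -> deg (h - l%:P) = deg h.
Proof.
move=> h1; move: (h1); rewrite deg_gt0 /deg -polyCN => h2.
by rewrite size_polyDl // (leq_ltn_trans (size_polyC_leq1 _)).
Qed.

Lemma lead_coef_compE g h : (0 < deg h)%N ->
  lead_coef (g \Po h) = lead_coef g * lead_coef h ^+ deg g.
Proof. by move=> h1; rewrite lead_coef_comp -?deg_gt0. Qed.

Lemma compfI h : (0 < deg h)%N -> injective (fun g => g \Po h).
Proof.
move=> h1 g1 g2 /eqP; rewrite -subr_eq0 -raddfB /= comp_poly_eq0 -?deg_gt0 //.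
by rewrite subr_eq0 => /eqP.
Qed.

(** One step of division by w in the sense of composition, the engine of the
    descents on the degree below. *)
Lemma cancel_lead_comp f w : (0 < deg f)%N -> (0 < deg w)%N -> (deg w %| deg f)%N ->
  exists v, (size (f - (v \Po w))%R < size f)%N.
Proof.
move=> f1 w1 /dvdnP[k dk]; pose c := lead_coef f / lead_coef w ^+ k.
have lw0 : lead_coef w ^+ k != 0 by rewrite expf_neq0 // lead_neq0 // -deg_gt0.
have c0 : c != 0 by rewrite mulf_neq0 ?invr_eq0 // lead_neq0 // -deg_gt0.
exists (c *: 'X^k); set v := c *: _.
have szv : size v = k.+1 by rewrite size_scale ?size_polyXn.
have dq : deg (v \Po w) = deg f by rewrite deg_comp {1}/deg szv dk.
have lq : lead_coef (v \Po w) = lead_coef f.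
  by rewrite lead_coef_compE // /deg szv lead_coefZ lead_coefXn mulr1 /= divfK.
have szq : size (v \Po w) = size f by rewrite !size_deg ?dq.
rewrite [X in (_ < X)%N]size_deg // ltnS; apply/leq_sizeP => j.
rewrite leq_eqVlt coefB => /orP[/eqP<-|lj].
  by rewrite {2}/deg -[in X in _ - X]szq -!lead_coefE lq subrr.
by rewrite !nth_default ?subrr // ?szq size_deg.
Qed.

(** Leading forms turn the hypothesis into X^(deg h) - 1 dividing X^(deg f) -
    1, hence deg h divides deg f; subtracting a composite v o h with the same
    leading term preserves the hypothesis and lowers the degree. *)
Lemma comp_of_dvdp_diffXY h f : (0 < deg h)%N -> diffXY h %| diffXY f -> exists g, f = g \Po h.
Proof.
move=> h1; have h2 : (1 < size h)%N by rewrite -deg_gt0.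
have [n] := ubnP (size f); elim: n => // n IH in f * => szp dv.
have [f1|f1] := leqP (size f) 1.
  by exists f; rewrite [in LHS](size1_polyC f1) [in RHS](size1_polyC f1) comp_polyC.
have : (deg h %| deg f)%N.
  have := topform_dvdp dv; rewrite !topform_diffXY // dvdpZl ?lead_neq0 // dvdpZr ?lead_neq0 //.
  exact: dvdn_Xn_sub1.
case/cancel_lead_comp; rewrite ?deg_gt0 // => v ltv.
have [] := IH (f - (v \Po h)); first exact: leq_trans ltv _.
  rewrite -raddfN /= diffXYD dvdp_add //.
  by have [Q [-> _]] := diffXY_comp (- v) h; rewrite dvdp_mull.
by move=> g E; exists (g + v); rewrite comp_polyD -E subrK.
Qed.

Lemma Xn_sub1_separable n : (0 < n)%N -> separable_poly ('X^n - 1 : {poly K}).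
Proof. by move=> n0; apply: separable_Xn_sub_1; rewrite natrK_eq0 -lt0n. Qed.

Lemma diffXY_X : diffXY 'X = 'X - ('X : {poly K})%:P.
Proof. by rewrite /diffXY map_polyX. Qed.

Lemma diffXY_quotient b : exists B, diffXY b = B * ('X - ('X : {poly K})%:P).
Proof.
have [Q [E _]] := diffXY_comp b 'X; exists Q.
by rewrite -diffXY_X -E comp_polyXr.
Qed.

(** Divide b(X) - b(Y) and d(X) - d(Y) by X - Y. As X - 1 is the gcd of X^(deg
    b) - 1 and X^(deg d) - 1, the quotients are coprime, so the second one
    divides the divided difference of a at (b(X), b(Y)). At two distinct
    points of a fibre of b with the same image under d this quotient vanishes,
    while the divided difference equals a'(b(t1)). *)
Lemma fibre_inj a b c d : a \Po b = c \Po d -> (0 < deg b)%N -> (0 < deg d)%N ->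
  coprime (deg b) (deg d) ->
  forall t1 t2, b.[t1] = b.[t2] -> d.[t1] = d.[t2] -> a^`().[b.[t1]] != 0 -> t1 = t2.
Proof.
move=> E b1 d1 cop t1 t2 Eb Ed /eqP na.
have [Q [EQ evQ]] := diffXY_comp a b; have [Q2 [EQ2 _]] := diffXY_comp c d.
have [B EB] := diffXY_quotient b; have [B' EB'] := diffXY_quotient d.
have XY0 : 'X - ('X : {poly K})%:P != 0 by rewrite polyXsubC_eq0.
have Db0 : diffXY b != 0 by rewrite diffXY_neq0 // -deg_gt0.
have Dd0 : diffXY d != 0 by rewrite diffXY_neq0 // -deg_gt0.
have B0 : B != 0 by apply: contraNneq Db0 => B0; rewrite EB B0 mul0r.
have B'0 : B' != 0 by apply: contraNneq Dd0 => B0'; rewrite EB' B0' mul0r.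
have cB : coprimep B' B.
  apply: coprimep_topform => //.
    by have [] := @topfullM _ B' ('X - ('X)%:P) B'0 XY0; rewrite -?EB' //; apply: topfull_diffXY; rewrite -deg_gt0.
  apply/coprimepP => g gB' gB.
  have tXY : topform ('X - ('X : {poly K})%:P) = 'X - 1.
    by rewrite -diffXY_X topform_diffXY ?size_polyX // lead_coefX scale1r.
  have X10 : ('X - 1 : {poly K}) != 0 by rewrite -polyC1 polyXsubC_eq0.
  have dv h H : (0 < deg h)%N -> diffXY h = H * ('X - ('X : {poly K})%:P) -> g %| topform H ->
      g * ('X - 1) %| 'X^(deg h) - 1.
    move=> h1 EH gH; have := congr1 (@topform K) EH; rewrite topform_diffXY -?deg_gt0 // topformM tXY => E'.
    by rewrite -(@dvdpZr _ (lead_coef h)) ?lead_neq0 -?deg_gt0 // E' dvdp_mul2r.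
  have := dvdp_Xn_sub1_gcd (dv _ _ b1 EB gB) (dv _ _ d1 EB' gB').
  (* The gcd of the two exponents is 1, so X - 1 already exhausts the common
     factor. *)
  rewrite (eqP cop) expr1 -[X in _ %| X]mul1r dvdp_mul2r //.
  by rewrite dvdp1 size_poly_eq1.
have ulB' : lead_coef B' \is a GRing.unit.
  have := lead_coef_diffXY_unit (_ : 1 < size d)%N; rewrite -deg_gt0 => /(_ d1).
  by rewrite EB' lead_coef_Mmonic // monicXsubC.
have : B' %| Q.
  rewrite -(Gauss_dvdpl Q cB); apply/(Pdiv.IdomainUnit.dvdpP ulB'); exists Q2.
  by apply: (mulIf XY0); rewrite -!mulrA -EB -EB' -EQ -EQ2 E.
case/(Pdiv.IdomainUnit.dvdpP ulB') => u Eu.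
apply: contraPeq (evQ t1 t2 Eb) => t12; rewrite Eu !hornerM.
have : (diffXY d).[t1%:P].[t2] = 0.
  by rewrite /diffXY hornerD hornerN hornerC horner_map /= hornerD hornerN hornerC Ed subrr.
rewrite EB' hornerM hornerXsubC hornerM hornerD hornerN hornerC hornerX => /eqP.
rewrite mulf_eq0 [_ - _ == 0]subr_eq0 (negPf t12) orbF => /eqP ->.
by rewrite mulr0 => /esym.
Qed.

End Decomp.

(** * Gauss's lemma over K[Y] *)

Section Gauss.
Variable K : fieldType.
Implicit Types (a b c d f g h : {poly K}).

Lemma irreducible_divisor c : (1 < size c)%N -> exists2 d, irreducible_poly d & d %| c.
Proof.
have [n] := ubnP (size c); elim: n => // n IH in c * => szc c1.
have [cirr|] := classic (forall q : {poly K}, size q != 1%N -> q %| c -> q %= c).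
  by exists c.
move=> nirr; apply: NNPP => none; apply: nirr => q q1 qc.
have c0 : c != 0 by rewrite -size_poly_gt0 ltnW.
have q0 : q != 0 by apply: contraNneq c0 => q0; rewrite q0 dvd0p in qc.
have q2 : (1 < size q)%N by rewrite ltn_neqAle eq_sym q1 size_poly_gt0.
apply/negPn/negP=> nqc; apply: none.
have ltq : (size q < size c)%N.
  by rewrite ltn_neqAle dvdp_leq // andbT; apply: contra nqc => /eqP; rewrite -dvdp_size_eqp // => ->.
have [d dirr dq] := IH q (leq_trans ltq szc) q2.
by exists d => //; apply: dvdp_trans qc.
Qed.

Lemma irreducible_dvdM d b c : irreducible_poly d -> d %| b * c -> (d %| b) || (d %| c).
Proof.
case=> d1 dirr; have [//|ndb /=] := boolP (d %| b); rewrite Gauss_dvdpr //.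
rewrite /coprimep; apply: contraNT ndb => /(dirr (gcdp d b)) /(_ (dvdp_gcdl _ _)).
by rewrite eqp_sym => /eqp_dvdl ->; rewrite dvdp_gcdr.
Qed.

Lemma coef_divp_eq d (p : {poly {poly K}}) : p = map_poly (fun q => q %% d) p + d *: map_poly (fun q => q %/ d) p.
Proof.
apply/polyP=> i; rewrite coefD coefZ !coef_map_id0 ?div0p ?mod0p //.
by rewrite addrC mulrC -divp_eq.
Qed.

(** Irreducible constants of K[Y] stay prime in K[Y][X]: reduce all
    coefficients modulo d and look at the product of the leading ones. *)
Lemma irreducible_dvd_coefM d (p q r : {poly {poly K}}) : irreducible_poly d -> p * q = d *: r ->
  (exists p', p = d *: p') \/ (exists q', q = d *: q').
Proof.
move=> dirr E; have d0 : d != 0 by case: dirr; rewrite -size_poly_gt0 => /ltnW.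
have modE x : map_poly (fun q : {poly K} => q %% d) x = 0 -> exists x', x = d *: x'.
  by move=> x0; exists (map_poly (fun q => q %/ d) x); rewrite {1}(coef_divp_eq d x) x0 add0r.
have lead x : d %| lead_coef (map_poly (fun q : {poly K} => q %% d) x) -> exists x', x = d *: x'.
  move=> dx; apply: modE; apply/eqP; rewrite -lead_coef_eq0.
  move: dx; rewrite lead_coefE coef_map_id0 ?mod0p // => dx; apply/negPn/negP => n0.
  by have := dvdp_leq n0 dx; rewrite leqNgt ltn_modp d0.
have /orP[]: (d %| lead_coef (map_poly (fun q => q %% d) p)) ||
    (d %| lead_coef (map_poly (fun q => q %% d) q)); [|by move/lead; left|by move/lead; right].
apply: irreducible_dvdM => //; rewrite -lead_coefM.
set p1 := map_poly _ p; set q1 := map_poly _ q.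
have [p2 Ep] : exists p2, p = p1 + d *: p2 by exists (map_poly (fun q => q %/ d) p); apply: coef_divp_eq.
have [q2 Eq] : exists q2, q = q1 + d *: q2 by exists (map_poly (fun q => q %/ d) q); apply: coef_divp_eq.
have -> : p1 * q1 = d *: (r - (p2 * q1 + p1 * q2 + d *: (p2 * q2))).
  by rewrite scalerBr -E Ep Eq -!mul_polyC; ring.
by rewrite lead_coefZ dvdp_mulr.
Qed.

(** Gauss's lemma: cancel the irreducible factors of c one at a time against q
    or r. Its use is that a gcd taken over K(Y) of two polynomials monic in X
    can be taken monic in K[Y][X]. *)
Lemma monic_factor c (p q r : {poly {poly K}}) : p \is monic -> c != 0 -> c *: p = q * r ->
  exists2 q', q' \is monic & q = lead_coef q *: q'.
Proof.
move=> mp; have [n] := ubnP (size c); elim: n => // n IH in c q r * => szc c0 E.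
have [c1|c1] := leqP (size c) 1.
  have := congr1 (@lead_coef _) E; rewrite lead_coefM lead_coefZ (monicP mp) mulr1 => lc.
  have ulq : lead_coef q \is a GRing.unit.
    have : c \is a GRing.unit.
      by rewrite (size1_polyC c1) polyC_unit //; apply: contraNneq c0 => c00; rewrite (size1_polyC c1) c00.
    by rewrite lc unitrM => /andP[].
  exists ((lead_coef q)^-1 *: q); last by rewrite scalerA divrr // scale1r.
  by rewrite monicE lead_coefZ mulVr.
have [d dirr /dvdpP[e Ec]] := irreducible_divisor c1.
have d0 : d != 0 by case: dirr; rewrite -size_poly_gt0 => /ltnW.
have e0 : e != 0 by apply: contraNneq c0 => e0; rewrite Ec e0 mul0r.
have sze : (size e < n)%N.
  move: szc; rewrite Ec size_mul // ltnS; case: dirr => d1 _.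
  by move: d1; move: (size e) (size d) => x y; lia.
have E' : q * r = d *: (e *: p) by rewrite scalerA [d * e]mulrC -Ec.
case: (irreducible_dvd_coefM dirr E') => -[x Ex].
  have : e *: p = x * r.
    by apply: (mulfI (_ : d%:P != 0)); rewrite ?polyC_eq0 // !mul_polyC -E' Ex scalerAl.
  case/(IH _ _ _ sze e0) => q' mq' Eq'; exists q' => //.
  by rewrite {1}Ex Eq' Ex lead_coefZ scalerA.
have : e *: p = q * x.
  by apply: (mulfI (_ : d%:P != 0)); rewrite ?polyC_eq0 // !mul_polyC -E' Ex scalerAr.
by case/(IH _ _ _ sze e0) => q' mq' Eq'; exists q'.
Qed.

End Gauss.

(** * Difference polynomials as monic common factors *)

Section Luroth.
Variable K : fieldType.
Hypothesis charK0 : [pchar K] =i pred0.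
Implicit Types (a b c d f g h : {poly K}).

(** For a monic p the condition on leading forms says that the total degree of
    p is its degree in X, which bounds each coefficient. *)
Lemma total_degree_monic (p : {poly {poly K}}) i : p \is monic -> topfull p ->
  (size (p`_i)%R + i <= size p)%N \/ p`_i = 0.
Proof.
move=> mp fp; have p0 := monic_neq0 mp.
have [pi0|pi0] := eqVneq p`_i 0; [by right|left].
have szp : (0 < size p)%N by rewrite size_poly_gt0.
have szh : (0 < size (homog p))%N by rewrite size_poly_gt0 homog_eq0.
have Eh : (size (homog p)).-1 = (size p).-1.
  have : lead_coef (topform p) != 0 by rewrite lead_coef_eq0 topform_eq0.
  rewrite lead_coefE fp /topform lead_coefE coef_homog; case: leqP => le; last by rewrite eqxx.
  rewrite -lead_coefE (monicP mp) coefC.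
  by rewrite subn_eq0; case: leqP => [ge _|_]; [apply/eqP; rewrite eqn_leq ge le|rewrite eqxx].
have nz : (homog p)`_(i + (size (p`_i)%R).-1)`_i != 0.
  by rewrite coef_homog leq_addr addKn -lead_coefE lead_coef_eq0.
have [ge|lt] := leqP (size (homog p)) (i + (size (p`_i)%R).-1).
  by move: nz; rewrite (nth_default 0 ge) coef0 eqxx.
move: lt Eh szp szh; have : (0 < size (p`_i)%R)%N by rewrite size_poly_gt0.
by move: (size (homog p)) (size p) (size p`_i) => x y z; lia.
Qed.

(** Write s_T(Z) for s with outer variable Z and coefficients evaluated at T,
    and view everything as polynomials in Z over K[Y][X]. Modulo s_X the
    polynomials h_i(Z) - h_i(X) vanish, so h_i(Z) - h_i(Y) reduces to h_i(X) -
    h_i(Y), which is a multiple of s(X, Y). By the Bezout relation so is e(Y)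
    s_Y modulo s_X, that is, e(Y) (s_Y - s_X), whose degree in Z is too small
    for any further reduction. Hence s(X, Y) divides c(X) - c(Y) for every
    coefficient c of s. The total degree of s shows that the coefficients
    other than the constant one are constants, and s(X, X) = 0 determines the
    remaining one. *)
Lemma diffXY_of_common_factor (s u v : {poly {poly K}}) (e : {poly K}) h1 h2 :
  s \is monic -> topfull s -> (1 < size s)%N -> s %| diffXY h1 -> s %| diffXY h2 ->
  e != 0 -> e *: s = u * diffXY h1 + v * diffXY h2 ->
  exists h, s = diffXY h.
Proof.
move=> ms fs s1 s_h1 s_h2 e0 E.
have dvP := Pdiv.IdomainMonic.dvdpP ms.
pose A := {poly {poly K}}.
(* The embeddings of the coefficients c(T) as c(Y) and as c(X). *)
pose f1 : {rmorphism {poly K} -> A} := polyC.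
pose f2 : {rmorphism {poly K} -> A} := map_poly polyC.
have mD h : map_poly f1 (diffXY h) = map_poly f2 (diffXY h) + (diffXY h)%:P.
  have mB (f : {rmorphism {poly K} -> A}) :
      map_poly f (diffXY h) = map_poly (f \o polyC) h - (f h)%:P.
    by rewrite /diffXY rmorphB /= map_polyC /= -map_poly_comp.
  rewrite !mB (@eq_map_poly _ _ (f2 \o polyC) (f1 \o polyC)); last by move=> x /=; rewrite map_polyC.
  by rewrite /diffXY rmorphB /=; ring.
have := congr1 (map_poly f1) E.
rewrite map_polyZ rmorphD !rmorphM /= !mD.
have [q1 Eq1] := dvP _ s_h1; have [q2 Eq2] := dvP _ s_h2.
rewrite {1 2}Eq1 {1 2}Eq2 !rmorphM /=.
set M1 := map_poly f1 s; set M := map_poly f2 s => EM.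
have mM : M \is monic by rewrite monic_map.
have mM1 : M1 \is monic by rewrite monic_map.
have szM : size M = size s by rewrite size_map_poly_id0 // (monicP ms) rmorph1 oner_eq0.
have szM1 : size M1 = size s by rewrite size_map_poly_id0 // (monicP ms) rmorph1 oner_eq0.
pose B := map_poly f1 u * q1%:P + map_poly f1 v * q2%:P.
(* The Bezout relation with coefficients in Y, modulo M and s. *)
have [C EC] : exists C, f1 e *: (M1 - M) = M * C + s%:P * B.
  exists (map_poly f1 u * map_poly f2 q1 + map_poly f1 v * map_poly f2 q2 - (f1 e)%:P).
  by rewrite scalerBr EM -[f1 e *: M]mul_polyC /B; ring.
have BE := Pdiv.RingMonic.rdivp_eq mM B.
set r := Pdiv.CommonRing.rmodp B M in BE.
have szr : (size r < size M)%N by rewrite Pdiv.CommonRing.ltn_rmodp monic_neq0.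
(* M and M1 are monic of the same degree, so their difference has smaller
   degree. *)
have szL : (size (f1 e *: (M1 - M) - s%:P * r)%R < size M)%N.
  apply: leq_ltn_trans (size_polyD _ _) _; rewrite gtn_max size_polyN; apply/andP; split.
    apply: leq_ltn_trans (size_scale_leq _ _) _.
    rewrite -(prednK (_ : 0 < size M)%N); last by rewrite szM ltnW.
    rewrite ltnS; apply/leq_sizeP => j; rewrite leq_eqVlt coefB => /orP[/eqP<-|lj].
      by rewrite {1}szM -{1}szM1 -!lead_coefE (monicP mM) (monicP mM1) subrr.
    by rewrite !nth_default ?subrr //; move: lj; rewrite ?szM ?szM1 prednK // ltnW.
  by rewrite mul_polyC; apply: leq_ltn_trans (size_scale_leq _ _) szr.
have EL : f1 e *: (M1 - M) - s%:P * r = M * (C + s%:P * Pdiv.CommonRing.rdivp B M).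
  by rewrite EC {1}BE; ring.
have EL0 : f1 e *: (M1 - M) = s%:P * r.
  apply/eqP; rewrite -subr_eq0; move: szL; rewrite EL.
  have [->|C0] := eqVneq (C + s%:P * Pdiv.CommonRing.rdivp B M) 0; first by rewrite mulr0.
  rewrite size_monicM //; move: C0; rewrite -size_poly_gt0.
  by move: (size M) (size _) => x y; lia.
have sD i : s %| diffXY s`_i.
  have := congr1 (fun q : {poly A} => q`_i) EL0.
  rewrite coefZ coefB !coef_map /= mul_polyC coefZ => Ei.
  rewrite -(@dvdpZr _ (- e)) ?oppr_eq0 //; apply/dvP; exists r`_i.
  by rewrite mulrC -Ei /diffXY -mul_polyC polyCN; ring.
have gC i : (0 < i)%N -> (size (s`_i)%R <= 1)%N.
  move=> i0; rewrite leqNgt; apply/negP => gi1.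
  have := dvdp_leq (diffXY_neq0 gi1) (sD i); rewrite size_diffXY //.
  case: (total_degree_monic i ms fs) => [|gi0]; last by rewrite gi0 size_poly0 in gi1.
  by move: gi1; move: (size s`_i) (size s) => x y; lia.
have sX : s.['X] = 0.
  have DX h : (diffXY h).['X] = 0.
    by rewrite /diffXY hornerD hornerN hornerC -/(comp_poly 'X h) comp_polyXr subrr.
  have := congr1 (fun q : {poly {poly K}} => q.['X]) E.
  rewrite hornerZ hornerD !hornerM !DX !mulr0 addr0 => /eqP.
  by rewrite mulf_eq0 (negPf e0) => /eqP.
exists (map_poly (coefp 0) s).
set h := map_poly _ s.
have e0S j : (s - diffXY h)`_j.+1 = 0.
  rewrite coefB /diffXY coefB coefC subr0 coef_map /=.
  rewrite [h`_ _]coef_map_id0 /= ?coef0 //.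
  by apply/eqP; rewrite subr_eq0; apply/eqP/size1_polyC/gC.
have : (s - diffXY h)`_0 = (s - diffXY h).['X].
  rewrite [in RHS](@size1_polyC _ (s - diffXY h)) ?hornerC //.
  by apply/leq_sizeP => -[].
rewrite hornerD hornerN sX /diffXY hornerD hornerN hornerC -/(comp_poly 'X h) comp_polyXr subrr subrr => e00.
apply/eqP; rewrite -subr_eq0; apply/eqP/polyP => -[|j]; first by rewrite e00 coef0.
by rewrite e0S coef0.
Qed.

End Luroth.

(** * Common right factors of two decompositions *)

Section GcdDecomp.
Variable K : fieldType.
Hypothesis charK0 : [pchar K] =i pred0.
Implicit Types (a b c d f g h : {poly K}).

(** The upper bound is clear from the leading forms of h1(X) - h1(Y) and h2(X)
    - h2(Y). For the lower one, let u1 and u2 be the cofactors of the gcd G: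
    the least common multiple u1 u2 G divides f(X) - f(Y), whose leading form
    is squarefree. So the leading forms of u1 and u2 are coprime, and that of
    G is a gcd of the two given leading forms. *)
Lemma topform_gcd f g1 h1 g2 h2 : (0 < deg f)%N -> f = g1 \Po h1 -> f = g2 \Po h2 ->
  topform (gcdp (diffXY h1) (diffXY h2)) %= 'X^(gcdn (deg h1) (deg h2)) - 1.
Proof.
move=> f1 Ef1 Ef2.
have hpos h g : f = g \Po h -> (0 < deg h)%N.
  by move=> E; move: f1; rewrite E deg_comp muln_gt0 => /andP[].
have h1p := hpos _ _ Ef1; have h2p := hpos _ _ Ef2.
have D10 : diffXY h1 != 0 by rewrite diffXY_neq0 // -deg_gt0.
have D20 : diffXY h2 != 0 by rewrite diffXY_neq0 // -deg_gt0.
have topDE h : (0 < deg h)%N -> topform (diffXY h) %= 'X^(deg h) - 1.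
  by move=> h0; rewrite topform_diffXY -?deg_gt0 // eqp_scale // lead_neq0 // -deg_gt0.
set G := gcdp (diffXY h1) (diffXY h2).
have G0 : G != 0 by rewrite gcdp_eq0 negb_and D10.
apply/andP; split.
  apply: dvdp_Xn_sub1_gcd; rewrite -(eqp_dvdr _ (topDE _ _)) //; apply: topform_dvdp.
    exact: dvdp_gcdl.
  exact: dvdp_gcdr.
have /Pdiv.Idomain.dvdpP[[l1 u1] /= l10 E1] := dvdp_gcdl (diffXY h1) (diffXY h2).
have /Pdiv.Idomain.dvdpP[[l2 u2] /= l20 E2] := dvdp_gcdr (diffXY h1) (diffXY h2).
rewrite -/G in E1 E2.
have cop : coprimep u2 u1.
  have u10 : u1 != 0.
    have : l1 *: diffXY h1 != 0 by rewrite scale_poly_eq0 negb_or l10.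
    by rewrite E1 mulf_eq0 negb_or => /andP[].
  rewrite /coprimep; apply/eqP; have /eqP := eqp_size (eqpxx G).
  have : gcdp u2 u1 * G %| G.
    rewrite dvdp_gcd -(@dvdpZr _ l1) // -[in X in _ && X](@dvdpZr _ l2) // E1 E2.
    by rewrite !dvdp_mul2r // dvdp_gcdl dvdp_gcdr.
  by rewrite -[X in _ %| X]mul1r dvdp_mul2r // dvdp1 => /eqP.
have [Q1 [EQ1 _]] := diffXY_comp g1 h1; have [Q2 [EQ2 _]] := diffXY_comp g2 h2.
rewrite -Ef1 in EQ1; rewrite -Ef2 in EQ2.
have : u2 %| Q1.
  rewrite -(Gauss_dvdpl Q1 cop) -(@dvdpZr _ l2) //.
  have -> : l2 *: (Q1 * u1) = l1 *: (Q2 * u2).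
    apply: (mulIf G0); rewrite -!scalerAl -!mulrA -E1 -E2 -!scalerAr -EQ1 -EQ2.
    by rewrite !scalerA mulrC.
  by rewrite dvdpZr // dvdp_mull.
move/topform_dvdp => tu2.
have sep : separable_poly (topform (diffXY f)).
  by rewrite (eqp_separable (topDE _ f1)); apply: Xn_sub1_separable.
have tu1 : topform u1 %| topform (diffXY h1).
  by apply: topform_dvdp; rewrite -(@dvdpZr _ l1) // E1 dvdp_mulr.
have : coprimep (topform u2) (topform u1).
  apply: (coprimep_dvdl tu1); apply: separable_coprime sep _.
  by rewrite EQ1 topformM dvdp_mul.
case/Bezout_eq1_coprimepP=> -[v w] /= vw.
have -> : topform G = v * (topform u2 * topform G) + w * (topform u1 * topform G).
  by rewrite !mulrA -mulrDl vw mul1r.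
rewrite -!topformM -E1 -E2 !topformZ //.
have dv h : (0 < deg h)%N -> (gcdn (deg h1) (deg h2) %| deg h)%N ->
    'X^(gcdn (deg h1) (deg h2)) - 1 %| topform (diffXY h).
  by move=> hp dh; rewrite (eqp_dvdr _ (topDE _ hp)) dvdp_Xn_sub1.
apply: dvdp_add; apply: dvdp_mull; rewrite dvdpZr ?lead_coef_eq0 //; apply: dv => //.
  exact: dvdn_gcdr.
exact: dvdn_gcdl.
Qed.

(** The field K(h1, h2) is generated by one polynomial: its h(X) - h(Y) is the
    gcd of h1(X) - h1(Y) and h2(X) - h2(Y), whose degree is read off on
    leading forms. *)
Theorem gcd_right_factor f g1 h1 g2 h2 :
  (0 < deg f)%N -> f = g1 \Po h1 -> f = g2 \Po h2 ->
  exists h u1 u2, [/\ deg h = gcdn (deg h1) (deg h2), h1 = u1 \Po h & h2 = u2 \Po h].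
Proof.
move=> f1 Ef1 Ef2.
have hpos h g : f = g \Po h -> (0 < deg h)%N.
  by move=> E; move: f1; rewrite E deg_comp muln_gt0 => /andP[].
have h1p := hpos _ _ Ef1; have h2p := hpos _ _ Ef2.
have D10 : diffXY h1 != 0 by rewrite diffXY_neq0 // -deg_gt0.
have tG := topform_gcd f1 Ef1 Ef2; set G := gcdp (diffXY h1) (diffXY h2) in tG.
have d0 : (0 < gcdn (deg h1) (deg h2))%N by rewrite gcdn_gt0 h1p.
have fullG : topfull G by apply: topfull_dvdp (topfull_diffXY _) D10 (dvdp_gcdl _ _); rewrite -deg_gt0.
have szG : size G = (gcdn (deg h1) (deg h2)).+1.
  by rewrite -fullG (eqp_size tG) size_XnsubC.
have [s ms EG] : exists2 s, s \is monic & G = lead_coef G *: s.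
  have /Pdiv.Idomain.dvdpP[[l1 u1] /= l10 E1] := dvdp_gcdl (diffXY h1) (diffXY h2).
  have lh0 : lead_coef h1 != 0 by rewrite lead_neq0 // -deg_gt0.
  apply: (@monic_factor _ (l1 * (lead_coef h1)%:P) ((lead_coef h1)^-1%:P *: diffXY h1) _ u1).
  - by rewrite monicE lead_coefZ lead_coef_diffXY -?deg_gt0 // -polyCM mulVf.
  - by rewrite mulf_neq0 // polyC_eq0.
  - by rewrite scalerA -mulrA -polyCM mulfV // polyC1 mulr1 E1 mulrC.
have lG0 : lead_coef G != 0 by rewrite lead_coef_eq0 gcdp_eq0 negb_and D10.
have sG : s %= G by rewrite EG eqp_sym eqp_scale.
have sd1 : s %| diffXY h1 by rewrite (eqp_dvdl _ sG) dvdp_gcdl.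
have sd2 : s %| diffXY h2 by rewrite (eqp_dvdl _ sG) dvdp_gcdr.
have fs : topfull s by apply: topfull_dvdp (topfull_diffXY _) D10 sd1; rewrite -deg_gt0.
have [[u v] /= uv] := Bezoutp (diffXY h1) (diffXY h2).
have uvs : u * diffXY h1 + v * diffXY h2 %= s by rewrite (eqp_trans uv) // eqp_sym.
have [[c1 c2] /= /andP[c10 c20] cE] := eqpP _ _ uvs.
have [| | |//| |h Eh] := @diffXY_of_common_factor _ s (c1 *: u) (c1 *: v) c2 h1 h2 ms fs.
- by rewrite (eqp_size sG) szG.
- exact: sd1.
- exact: sd2.
- by rewrite -cE scalerDr !scalerAl.
have h0 : (0 < deg h)%N.
  rewrite deg_gt0 ltnNge; apply/negP => h0; move: ms.
  by rewrite Eh (size1_polyC h0) diffXYC monicE lead_coef0 eq_sym oner_eq0.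
have dh : deg h = gcdn (deg h1) (deg h2).
  apply: succn_inj; rewrite -size_deg // -size_diffXY -?deg_gt0 //.
  by rewrite -Eh (eqp_size sG).
have [u1 Eu1] : exists u1, h1 = u1 \Po h by apply: comp_of_dvdp_diffXY; rewrite // -Eh.
have [u2 Eu2] : exists u2, h2 = u2 \Po h by apply: comp_of_dvdp_diffXY; rewrite // -Eh.
by exists h, u1, u2.
Qed.

End GcdDecomp.

(** * Approximate roots and common left composites *)

Section ApproximateRoot.
Variable K : fieldType.
Hypothesis charK0 : [pchar K] =i pred0.
Implicit Types (a b c d e f g h u v w : {poly K}).

(** All summands are monic of the same degree n k, so the leading coefficient
    is the number of summands, which is nonzero. *)
Lemma monic_sum_powers v w n k : v \is monic -> w \is monic -> size v = n.+1 -> size w = n.+1 ->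
  let s := \sum_(i < k.+1) v ^+ (k - i) * w ^+ i in
  size s = (n * k).+1 /\ lead_coef s = k.+1%:R.
Proof.
move=> mv mw sv sw s.
have szX (x : {poly K}) j : x \is monic -> size x = n.+1 -> size (x ^+ j) = (n * j).+1.
  move=> mx sx; have := size_exp x j; rewrite sx /= => <-.
  by rewrite prednK // size_poly_gt0 monic_neq0 // monic_exp.
have term (i : 'I_k.+1) : size (v ^+ (k - i) * w ^+ i) = (n * k).+1 /\ (v ^+ (k - i) * w ^+ i) \is monic.
  split; last by rewrite monicMl monic_exp.
  rewrite size_monicM ?monic_exp ?monic_neq0 ?monic_exp // !szX //.
  by rewrite addSn /= addnS -mulnDr subnK // -ltnS.
have cs : s`_(n * k) = k.+1%:R.
  rewrite coef_sum (eq_bigr (fun=> 1)) => [|i _]; first by rewrite sumr_const card_ord.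
  by have [szi /monicP <-] := term i; rewrite lead_coefE szi.
have le : (size s <= (n * k).+1)%N.
  by apply: leq_trans (size_sum _ _ _) _; apply/bigmax_leqP => i _; have [-> _] := term i.
have sz : size s = (n * k).+1.
  apply/eqP; rewrite eqn_leq le ltnNge; apply/negP => /leq_sizeP/(_ _ (leqnn _)).
  by rewrite cs => /eqP; rewrite natrK_eq0.
by rewrite lead_coefE sz.
Qed.

(** The exact degree of a difference of powers: it shows that changing v in
    degree j changes its power in degree j + n k, so that a power determines
    its monic root, coefficient by coefficient, from its top n coefficients. *)
Lemma size_sub_powers v w n k : v \is monic -> w \is monic -> size v = n.+1 -> size w = n.+1 ->
  v != w -> size (v ^+ k.+1 - w ^+ k.+1) = (size (v - w)%R + n * k)%N.
Proof.
move=> mv mw sv sw vw; rewrite subrXX.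
have [sz lc] := monic_sum_powers k mv mw sv sw.
rewrite size_mul ?subr_eq0 //; first by rewrite [X in (_ + X)%N]sz addnS.
by rewrite -size_poly_gt0 sz.
Qed.

Lemma approximate_root_uniq f v w n k :
  v \is monic -> w \is monic -> size v = n.+1 -> size w = n.+1 ->
  (size (f - v ^+ k.+1)%R <= n * k)%N -> (size (f - w ^+ k.+1)%R <= n * k)%N -> v = w.
Proof.
move=> mv mw sv sw fv fw; apply/eqP/negPn/negP => vw.
have := size_sub_powers k mv mw sv sw vw.
have -> : v ^+ k.+1 - w ^+ k.+1 = (f - w ^+ k.+1) - (f - v ^+ k.+1) by ring.
move=> E; have := size_polyD (f - w ^+ k.+1) (- (f - v ^+ k.+1)).
rewrite E size_polyN; have : (0 < size (v - w)%R)%N by rewrite size_poly_gt0 subr_eq0.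
move: fv fw; move: (size _) (size _) (size _) => x y z.
by rewrite leq_max => fv fw z0 /orP[]; lia.
Qed.

(** The coefficients of v are corrected one at a time from the top; the
    coefficient of degree n - j - 1 is found from that of degree n k + (n - j
    - 1) in g, on division by k + 1. *)
Lemma approximate_root g n k : g \is monic -> size g = (n * k.+1).+1 ->
  exists v, [/\ v \is monic, size v = n.+1 & (size (g - v ^+ k.+1)%R <= n * k)%N].
Proof.
move=> mg sg.
suff H j : (j <= n)%N -> exists v, [/\ v \is monic, size v = n.+1 &
    (size (g - v ^+ k.+1)%R <= n * k + (n - j))%N].
  by have [v []] := H n (leqnn _); rewrite subnn addn0 => *; exists v.
elim: j => [_|j IH jn].
  exists 'X^n; split; rewrite ?monicXn ?size_polyXn // subn0 -exprM.
  apply/leq_sizeP => i; rewrite leq_eqVlt coefB coefXn => /orP[/eqP<-|lt].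
    have <- : (size g).-1 = (n * k + n)%N by rewrite sg mulnS addnC.
    by rewrite -lead_coefE (monicP mg) sg /= eqxx subrr.
  rewrite nth_default; last by rewrite sg mulnS addnC.
  by rewrite gtn_eqF ?subr0 // mulnS addnC.
have [v [mv sv le]] := IH (ltnW jn).
pose c := (g - v ^+ k.+1)`_(n * k + (n - j.+1)).
have [c0|c0] := eqVneq c 0.
  exists v; split=> //; apply/leq_sizeP => i; rewrite leq_eqVlt => /orP[/eqP<- //|lt].
  by rewrite nth_default // (leq_trans le) // -subnSK // addnS.
(* To first order w^(k+1) - v^(k+1) is (k + 1) v^k (w - v). *)
pose w := v + (c / k.+1%:R) *: 'X^(n - j.+1).
have k0 : k.+1%:R != 0 :> K by rewrite natrK_eq0.
have cw : c / k.+1%:R != 0 by rewrite mulf_neq0 ?invr_eq0.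
have Ewv : w - v = (c / k.+1%:R) *: 'X^(n - j.+1) by rewrite /w addrC addKr.
have swv : size (w - v) = (n - j.+1).+1 by rewrite Ewv size_scale // size_polyXn.
have lt : (size ((c / k.+1%:R) *: 'X^(n - j.+1) : {poly K}) < size v)%N.
  by rewrite size_scale // size_polyXn sv ltnS subnSK // leq_subr.
have mw : w \is monic by rewrite monicE lead_coefDl // (monicP mv).
have sw : size w = n.+1 by rewrite size_polyDl.
exists w; split=> //.
have wv : w != v by rewrite -subr_eq0 -size_poly_gt0 swv.
have := size_sub_powers k mw mv sw sv wv; rewrite swv => swvk.
have -> : g - w ^+ k.+1 = (g - v ^+ k.+1) - (w ^+ k.+1 - v ^+ k.+1) by ring.
apply/leq_sizeP => i; rewrite leq_eqVlt => /orP[/eqP<-|lti]; rewrite coefB; last first.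
  rewrite !nth_default ?subrr //; first by rewrite swvk addSn addnC.
  by apply: leq_trans le _; rewrite -subnSK // addnS.
rewrite -/c; have -> : (n * k + (n - j.+1))%N = (size (w ^+ k.+1 - v ^+ k.+1)).-1.
  by rewrite swvk addSn addnC.
have [_ ls] := monic_sum_powers k mw mv sw sv.
rewrite -lead_coefE subrXX lead_coefM [X in _ * X]ls Ewv.
by rewrite lead_coefZ lead_coefXn mulr1 divfK // subrr.
Qed.

(** Put m = lcm(deg h1, deg h2) and deg f = m (n + 1). An approximate (n +
    1)-st root of g_i, composed with h_i, is one of f. The approximate root of
    f being unique, both composites agree. *)
Lemma common_comp_root f g1 h1 g2 h2 : f \is monic ->
  g1 \is monic -> h1 \is monic -> g2 \is monic -> h2 \is monic -> (0 < deg f)%N ->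
  f = g1 \Po h1 -> f = g2 \Po h2 ->
  exists u1 u2, [/\ u1 \Po h1 = u2 \Po h2 & deg (u1 \Po h1) = lcmn (deg h1) (deg h2)].
Proof.
move=> mf mg1 mh1 mg2 mh2 f1 E1 E2.
have [n Em] : exists n, deg f = (lcmn (deg h1) (deg h2) * n.+1)%N.
  have : (lcmn (deg h1) (deg h2) %| deg f)%N.
    by rewrite dvdn_lcm {1}E1 E2 !deg_comp !dvdn_mull.
  case/dvdnP => -[|n] En; first by rewrite En in f1.
  by exists n; rewrite mulnC.
set m := lcmn _ _ in Em *.
have root g h : g \is monic -> h \is monic -> f = g \Po h -> (deg h %| m)%N ->
    exists u, [/\ (u \Po h) \is monic, size (u \Po h) = m.+1 & (size (f - (u \Po h) ^+ n.+1)%R <= m * n)%N].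
  move=> mg mh E /dvdnP[q Eq].
  have h0 : (0 < deg h)%N by move: f1; rewrite E deg_comp muln_gt0 => /andP[].
  have m0 : (0 < m)%N by move: f1; rewrite Em muln_gt0 => /andP[].
  have q0 : (0 < q)%N by move: m0; rewrite Eq muln_gt0 => /andP[].
  have dg : deg g = (q * n.+1)%N.
    apply/eqP; rewrite -(eqn_pmul2r h0) -deg_comp -E Em Eq; apply/eqP; ring.
  have sg : size g = (q * n.+1).+1 by rewrite size_deg dg // muln_gt0 q0.
  have [v [mv sv le]] := approximate_root mg sg.
  have dv : deg v = q by rewrite /deg sv.
  exists v; split.
  - by rewrite monicE lead_coef_compE // (monicP mv) (monicP mh) expr1n mulr1.
  - by rewrite size_deg deg_comp dv -?Eq.
  have -> : f - (v \Po h) ^+ n.+1 = (g - v ^+ n.+1) \Po h.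
    by rewrite raddfB /= -E rmorphXn.
  have [->|nz] := eqVneq (g - v ^+ n.+1) 0; first by rewrite comp_poly0 size_poly0.
  apply: leq_trans (size_comp_poly_leq _ _) _; rewrite -/(deg h) Eq.
  move: nz le; rewrite -size_poly_gt0; move: (size _) => x x0 le.
  have : (x.-1 * deg h < q * n * deg h)%N by rewrite ltn_pmul2r //; lia.
  lia.
have [u1 [m1 s1 r1]] := root _ _ mg1 mh1 E1 (dvdn_lcml _ _).
have [u2 [m2 s2 r2]] := root _ _ mg2 mh2 E2 (dvdn_lcmr _ _).
exists u1, u2; split; last by rewrite /deg s1.
exact: approximate_root_uniq m1 m2 s1 s2 r1 r2.
Qed.

Lemma monic_normal f g h : (0 < deg f)%N -> f = g \Po h ->
  exists g', [/\ g' \is monic, (lead_coef h)^-1 *: h \is monic &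
    (lead_coef f)^-1 *: f = g' \Po ((lead_coef h)^-1 *: h)].
Proof.
move=> f1 E.
have h0 : (0 < deg h)%N by move: f1; rewrite E deg_comp muln_gt0 => /andP[].
have lh0 : lead_coef h != 0 by rewrite lead_neq0 // -deg_gt0.
have lf0 : lead_coef f != 0 by rewrite lead_neq0 // -deg_gt0.
exists ((lead_coef f)^-1 *: (g \Po (lead_coef h *: 'X))); split.
- rewrite monicE lead_coefZ lead_coef_compE; last by rewrite /deg size_scale ?size_polyX.
  by rewrite lead_coefZ lead_coefX mulr1 -lead_coef_compE // -E mulVf.
- by rewrite monicE lead_coefZ mulVf.
- by rewrite comp_polyZ -comp_polyA comp_polyZ comp_polyX scalerA mulfV // scale1r -E.
Qed.

Lemma deg_scale (c : K) f : c != 0 -> deg (c *: f) = deg f.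
Proof. by move=> c0; rewrite /deg size_scale. Qed.

Lemma comp_scaleV (c : K) u h : u \Po (c *: h) = (u \Po (c *: 'X)) \Po h.
Proof. by rewrite -comp_polyA comp_polyZ comp_polyX. Qed.

(** With w in hand, f is a polynomial in w: any polynomial in both K[h1] and
    K[h2] has degree divisible by deg w, so its leading term can be cancelled
    by a polynomial in w, which again lies in both. *)
Theorem lcm_left_factor f g1 h1 g2 h2 : (0 < deg f)%N -> f = g1 \Po h1 -> f = g2 \Po h2 ->
  exists w e u1 u2, [/\ w = u1 \Po h1, w = u2 \Po h2, f = e \Po w &
     deg w = lcmn (deg h1) (deg h2)].
Proof.
move=> f1 E1 E2.
have hpos g h : f = g \Po h -> (0 < deg h)%N.
  by move=> E; move: f1; rewrite E deg_comp muln_gt0 => /andP[].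
have h1p := hpos _ _ E1; have h2p := hpos _ _ E2.
have lh1 : (lead_coef h1)^-1 != 0 by rewrite invr_eq0 lead_neq0 // -deg_gt0.
have lh2 : (lead_coef h2)^-1 != 0 by rewrite invr_eq0 lead_neq0 // -deg_gt0.
have lf : (lead_coef f)^-1 != 0 by rewrite invr_eq0 lead_neq0 // -deg_gt0.
have [g1' [mg1 mh1 E1']] := monic_normal f1 E1.
have [g2' [mg2 mh2 E2']] := monic_normal f1 E2.
have mf : (lead_coef f)^-1 *: f \is monic by rewrite monicE lead_coefZ mulVf // -invr_eq0.
have f1' : (0 < deg ((lead_coef f)^-1 *: f))%N by rewrite deg_scale.
have [u1 [u2 [Eu dw]]] := common_comp_root mf mg1 mh1 mg2 mh2 f1' E1' E2'.
rewrite comp_scaleV [RHS]comp_scaleV in Eu; rewrite comp_scaleV !deg_scale // in dw.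
move: (u1 \Po _) (u2 \Po _) Eu dw => {}u1 {}u2 Eu dw.
pose w := u1 \Po h1.
have w0 : (0 < deg w)%N by rewrite dw lcmn_gt0 h1p.
suff [e Ee] : exists e, f = e \Po w by exists w, e, u1, u2.
have {mf f1' E1' E2' mg1 mg2 mh1 mh2 f1 lf hpos} _ := I.
have [n] := ubnP (size f); elim: n => // n IH in f g1 g2 E1 E2 * => szf.
have [f1|f1] := leqP (size f) 1.
  by exists f; rewrite [in LHS](size1_polyC f1) [in RHS](size1_polyC f1) comp_polyC.
have dwf : (deg w %| deg f)%N by rewrite dw dvdn_lcm {1}E1 E2 !deg_comp !dvdn_mull.
have [v ltv] := cancel_lead_comp (etrans (deg_gt0 f) f1) w0 dwf.
have [] := IH (f - (v \Po w)) (g1 - (v \Po u1)) (g2 - (v \Po u2)).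
- by rewrite raddfB /= -E1 -comp_polyA.
- by rewrite raddfB /= -E2 -comp_polyA -Eu.
- exact: leq_trans ltv _.
- by move=> e Ee; exists (e + v); rewrite comp_polyD -Ee subrK.
Qed.

End ApproximateRoot.

(** * Odd polynomials *)

Section OddPoly.
Variable K : fieldType.
Hypothesis charK0 : [pchar K] =i pred0.
Implicit Types (a b c d e f g h p q u v w : {poly K}).

Lemma inOP p : inO p <-> forall i, ~~ odd i -> p`_i = 0.
Proof.
split=> [[g ->] i ni|ev].
  rewrite coefMX coef_comp_poly_Xn //; case: i ni => //= i; rewrite negbK => oi.
  by case: ifP => //; rewrite dvdn2 oi.
exists (odd_poly p); rewrite -{1}[p]poly_even_odd (_ : even_poly p = 0) ?comp_poly0 ?add0r //.
by apply/polyP=> i; rewrite coef_even_poly ev ?odd_double ?coef0.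
Qed.

Lemma coef_comp_scaleX p (k : K) i : (p \Po (k *: 'X))`_i = p`_i * k ^+ i.
Proof.
elim/poly_ind: p i => [|p k0 IH] i; first by rewrite comp_poly0 !coef0 mul0r.
rewrite comp_poly_MXaddC -scalerAr coefD coefZ coefMX coefC coefD coefMX coefC.
by case: i => [|i] /=; rewrite ?mulr0 ?add0r ?expr0 ?mulr1 // !addr0 IH exprS mulrCA.
Qed.

(** Oddness as an equation that passes through compositions. *)
Lemma comp_opp p : p \Po (- 'X) = - p <-> forall i, ~~ odd i -> p`_i = 0.
Proof.
have E i : (p \Po (- 'X))`_i = p`_i * (-1) ^+ i by rewrite -scaleN1r coef_comp_scaleX.
have two : 2%:R != 0 :> K by rewrite natrK_eq0.
split=> [H i ni|ev].
  have := E i; rewrite H coefN -signr_odd (negPf ni) expr0 mulr1 => /eqP.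
  rewrite eq_sym -subr_eq0 opprK -mulr2n -mulr_natl mulf_eq0 (negPf two) /=.
  by move/eqP.
apply/polyP=> i; rewrite E coefN -signr_odd; case: (boolP (odd i)) => [_|/ev ->].
  by rewrite expr1 mulrN1.
by rewrite mul0r oppr0.
Qed.

Lemma inON p : inO p <-> p \Po (- 'X) = - p.
Proof. by rewrite inOP comp_opp. Qed.

Lemma inO_comp p q : inO p -> inO q -> inO (p \Po q).
Proof.
move=> /inON op /inON oq; apply/inON; rewrite -comp_polyA oq.
by rewrite -[in RHS]raddfN /= -op -comp_polyA raddfN /= comp_polyX.
Qed.

Lemma inO_scale (k : K) p : inO p -> inO (k *: p).
Proof. by rewrite !inOP => op i ni; rewrite coefZ op // mulr0. Qed.

Lemma inO_X : inO ('X : {poly K}).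
Proof. by apply/inOP => i; rewrite coefX; case: i => [|[]]. Qed.

Lemma inO_scaleX (k : K) : inO (k *: 'X).
Proof. exact: inO_scale inO_X. Qed.

Lemma inO_coef0 p : inO p -> p`_0 = 0.
Proof. by move/inOP; apply. Qed.

Lemma inO_odd_deg p : inO p -> (0 < deg p)%N -> odd (deg p).
Proof.
move/inOP => op p1; apply: contraTT p1 => /op; rewrite /deg -lead_coefE => /eqP.
by rewrite lead_coef_eq0 => /eqP ->; rewrite size_poly0.
Qed.

Lemma deg_scaleX (k : K) : k != 0 -> deg (k *: 'X : {poly K}) = 1%N.
Proof. by move=> k0; rewrite deg_scale // /deg size_polyX. Qed.

Lemma deg1E p : deg p = 1%N -> p = p`_1 *: 'X + (p`_0)%:P /\ p`_1 != 0.
Proof.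
move=> p1; have sz : size p = 2%N by rewrite size_deg p1.
split; last by have := lead_coefE p; rewrite sz /= => <-; rewrite lead_neq0 ?sz.
apply/polyP=> -[|[|i]]; rewrite coefD coefZ coefX coefC /= ?mulr0 ?mulr1 ?add0r ?addr0 //.
by rewrite nth_default // sz.
Qed.

Lemma unitOP p : unitO p <-> inO p /\ deg p = 1%N.
Proof.
split=> [[k k0 ->]|[op /deg1E[E p1]]]; first by rewrite deg_scaleX //; split=> //; exact: inO_scaleX.
by exists p`_1 => //; rewrite {1}E (inO_coef0 op) addr0.
Qed.

(** The common right factor of degree gcd has here the degree of h1 and h2,
    which are therefore linear polynomials in it. *)
Lemma same_deg_right_factors f g1 h1 g2 h2 : (0 < deg f)%N -> f = g1 \Po h1 -> f = g2 \Po h2 ->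
  deg h1 = deg h2 -> exists2 k : K, k != 0 & exists l : K, h2 = k *: h1 + l%:P.
Proof.
move=> f1 E1 E2 dh; have [h [u1 [u2 [dg e1 e2]]]] := gcd_right_factor charK0 f1 E1 E2.
have h1p : (0 < deg h1)%N by move: f1; rewrite E1 deg_comp muln_gt0 => /andP[].
rewrite -dh gcdnn in dg.
have du u h' : deg h' = deg h1 -> h' = u \Po h -> deg u = 1%N.
  by move=> dh' Eh; apply/eqP; rewrite -(eqn_pmul2r h1p) -{1}dg -deg_comp -Eh dh' mul1n.
have [E1' n1] := deg1E (du _ _ erefl e1); have [E2' n2] := deg1E (du _ _ (esym dh) e2).
exists (u2`_1 / u1`_1); first by rewrite mulf_neq0 ?invr_eq0.
exists (u2`_0 - u2`_1 / u1`_1 * u1`_0).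
have F u h' : h' = u \Po h -> u = u`_1 *: 'X + (u`_0)%:P -> h' = u`_1 *: h + (u`_0)%:P.
  by move=> -> Eu; rewrite {1}Eu comp_polyD comp_polyZ comp_polyX comp_polyC.
rewrite (F _ _ e1 E1') (F _ _ e2 E2') scalerDr scalerA divfK // -addrA; congr (_ + _).
by rewrite -mul_polyC -polyCM -polyCD addrC subrK.
Qed.

(** Since a(-x) = -a(x), also a = (-b) o c(-x). So c(-x) is a right factor of
    the same degree as c, and c(-x) = k c(x) + l; the constant and leading
    coefficients give l = 0 and k = -1. *)
Lemma odd_right_factor a b c : (0 < deg a)%N -> inO a -> a = b \Po c -> c`_0 = 0 ->
  inO b /\ inO c.
Proof.
move=> a1 oa E c0; have oN := (inON a).1 oa.
have E2 : a = (- b) \Po (c \Po (- 'X)).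
  by rewrite raddfN /= comp_polyA -E oN opprK.
have dN : deg (- 'X : {poly K}) = 1%N by rewrite /deg size_polyN size_polyX.
have dc : deg c = deg (c \Po (- 'X)) by rewrite deg_comp dN muln1.
have [k k0 [l Ec]] := same_deg_right_factors a1 E E2 dc.
have c1 : (0 < deg c)%N by move: a1; rewrite E deg_comp muln_gt0 => /andP[].
have oc : odd (deg c) by have := inO_odd_deg oa a1; rewrite E deg_comp oddM => /andP[].
have l0 : l = 0.
  have := congr1 (fun p : {poly K} => p`_0) Ec.
  by rewrite -scaleN1r coef_comp_scaleX coefD coefZ coefC c0 mul0r mulr0 add0r => /esym.
have kN : k = -1.
  have := congr1 (fun p : {poly K} => p`_(deg c)) Ec.
  rewrite -scaleN1r coef_comp_scaleX coefD coefZ coefC l0 if_same addr0 /deg -lead_coefE.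
  rewrite -signr_odd -/(deg c) oc expr1 => Elc.
  by apply: (mulIf (lead_neq0 (etrans (esym (deg_gt0 c)) c1))); rewrite -Elc mulrC.
have oc' : inO c by apply/inON; rewrite Ec l0 kN scaleN1r addr0.
split=> //; apply/inON; apply: (compfI c1).
have cN : (- 'X) \Po c = - c by rewrite raddfN /= comp_polyX.
by rewrite /= -comp_polyA cN raddfN /= -E -oN E -comp_polyA ((inON c).1 oc').
Qed.

(** Irreducibility only tests odd factors, but any decomposition in K[x]
    becomes one into odd factors when the constant term of c is moved into b. *)
Lemma irreducibleO_deg p b c : irreducibleO p -> p = b \Po c -> deg b = 1%N \/ deg c = 1%N.
Proof.
case=> op p1 irr E.
have p0 : (0 < deg p)%N by apply: ltnW.
have dX (k : K) : deg ('X + k%:P) = 1%N by rewrite /deg size_XaddC.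
have E' : p = (b \Po ('X + (c`_0)%:P)) \Po (c - (c`_0)%:P).
  by rewrite -comp_polyA comp_polyD comp_polyX comp_polyC subrK.
have dc : deg (c - (c`_0)%:P) = deg c.
  by apply: deg_subC; move: p0; rewrite E deg_comp muln_gt0 => /andP[].
have db : deg (b \Po ('X + (c`_0)%:P)) = deg b by rewrite deg_comp dX muln1.
have [|ob oc] := odd_right_factor p0 op E'; first by rewrite coefB coefC subrr.
by rewrite -dc -db; case: (irr _ _ ob oc E') => /unitOP[_ ->]; [left|right].
Qed.

Lemma irreducibleOP p : inO p -> (1 < deg p)%N ->
  (forall b c, inO b -> inO c -> p = b \Po c -> deg b = 1%N \/ deg c = 1%N) -> irreducibleO p.
Proof.
move=> op p1 H; split=> // b c ob oc E.
by case: (H b c ob oc E) => d1; [left|right]; apply/unitOP.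
Qed.

Lemma scaleXV (k : K) : k != 0 -> (k *: 'X) \Po (k^-1 *: 'X) = 'X :> {poly K}.
Proof. by move=> k0; rewrite comp_polyZ comp_polyX scalerA mulfV // scale1r. Qed.

Lemma irreducibleO_linear p q (k l : K) : k != 0 -> l != 0 -> irreducibleO p ->
  q = (k *: 'X) \Po (p \Po (l *: 'X)) -> irreducibleO q.
Proof.
move=> k0 l0 irr Eq; have [op p1 _] := irr.
apply: irreducibleOP.
- by rewrite Eq; apply: inO_comp (inO_scaleX _) (inO_comp op (inO_scaleX _)).
- by rewrite Eq !deg_comp !deg_scaleX // mul1n muln1.
move=> b c ob oc E.
have Ep : p = ((k^-1 *: 'X) \Po b) \Po (c \Po (l^-1 *: 'X)).
  rewrite -comp_polyA [b \Po _]comp_polyA -E Eq -[(_ \Po (p \Po _)) \Po _]comp_polyA.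
  rewrite -[(p \Po _) \Po _]comp_polyA scaleXV // comp_polyXr comp_polyA.
  by rewrite -{1}[k]invrK scaleXV ?invr_eq0 // comp_polyX.
case: (irreducibleO_deg irr Ep); rewrite deg_comp deg_scaleX ?invr_eq0 // ?mul1n ?muln1; by [left|right].
Qed.

End OddPoly.

(** * Ritt's first theorem for odd polynomials *)

Section RittFirst.
Variable K : fieldType.
Hypothesis charK0 : [pchar K] =i pred0.
Implicit Types (a b c d e f g h p q u v w : {poly K}) (ps qs l r : seq {poly K}).

Lemma linked_cat l r ps qs : linked ps qs -> linked (l ++ ps ++ r) (l ++ qs ++ r).
Proof.
elim=> [x y [[l' [r' [p [q [k [k0 -> ->]]]]]]|[l' [r' [P [P' [sw -> ->]]]]]] | x | x y z _ IH1 _ IH2].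
- apply: rt_step; left; exists (l ++ l'), (r' ++ r), p, q, k.
  by split; rewrite // -!catA !cat_cons.
- apply: rt_step; right; exists (l ++ l'), (r' ++ r), P, P'.
  by split; rewrite // -!catA !cat_cons.
- exact: rt_refl.
- exact: rt_trans IH1 IH2.
Qed.

Lemma linked_rcons ps qs p : linked ps qs -> linked (rcons ps p) (rcons qs p).
Proof. by move/(linked_cat [::] [:: p]); rewrite !cats1. Qed.

Lemma compseq_cat ps qs : compseq (ps ++ qs) = compseq ps \Po compseq qs.
Proof.
elim: ps => [|p ps IH] /=; first by rewrite comp_polyX.
by rewrite IH comp_polyA.
Qed.

Lemma compseq_rcons ps p : compseq (rcons ps p) = compseq ps \Po p.
Proof. by rewrite -cats1 compseq_cat /= comp_polyXr. Qed.

Lemma deg_compseq_gt0 ps : (forall p, p \in ps -> irreducibleO p) -> (0 < deg (compseq ps))%N.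
Proof.
elim: ps => [|p ps IH] irr /=; first by rewrite /deg size_polyX.
rewrite deg_comp muln_gt0 IH ?andbT; last by move=> q qps; apply: irr; rewrite inE qps orbT.
by have [_ /ltnW] := irr p (mem_head _ _).
Qed.

Lemma compseq_deg1 ps : (forall p, p \in ps -> irreducibleO p) -> deg (compseq ps) = 1%N -> ps = [::].
Proof.
case: ps => // p ps irr /=; rewrite deg_comp => /eqP.
rewrite muln_eq1 => /andP[/eqP p1 _].
by have [_] := irr p (mem_head _ _); rewrite p1.
Qed.

Lemma decomposition_exists e : inO e -> (0 < deg e)%N ->
  exists es (k : K), [/\ k != 0, forall p, p \in es -> irreducibleO p & e = compseq es \Po (k *: 'X)].
Proof.
have [n] := ubnP (deg e); elim: n => // n IH in e * => lee oe e0.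
have [e1|e1] := leqP (deg e) 1.
  have /unitOP[k k0 ->] : inO e /\ deg e = 1%N by split=> //; apply/eqP; rewrite eqn_leq e1.
  by exists [::], k; split=> //=; rewrite comp_polyX.
have [irr|nirr] := classic (irreducibleO e).
  exists [:: e], 1; split; rewrite ?oner_eq0 //=; last by rewrite scale1r !comp_polyXr.
  by move=> p; rewrite inE => /eqP ->.
have [b [c [ob oc E b1 c1]]] : exists b c, [/\ inO b, inO c, e = b \Po c, deg b <> 1%N & deg c <> 1%N].
  apply: NNPP => none; apply: nirr; apply: irreducibleOP => // b c ob oc E.
  by apply: NNPP => nd; apply: none; exists b, c; split=> // d1; apply: nd; [left|right].
have dE := deg_comp b c; rewrite -E in dE.
have [b2 c2] : (1 < deg b)%N /\ (1 < deg c)%N.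
  by move: e0 b1 c1; rewrite dE muln_gt0; case: (deg b) => [|[]] //; case: (deg c) => [|[]].
have ltb : (deg b < n)%N by rewrite -ltnS (leq_trans _ lee) // ltnS dE -[X in (X < _)%N]muln1 ltn_pmul2l // ltnW.
have ltc : (deg c < n)%N by rewrite -ltnS (leq_trans _ lee) // ltnS dE -[X in (X < _)%N]mul1n ltn_pmul2r // ltnW.
have [bs [k [k0 irrb Eb]]] := IH b ltb ob (ltnW b2).
have dc' : deg ((k *: 'X) \Po c) = deg c by rewrite deg_comp deg_scaleX // mul1n.
have [||| cs [k' [k'0 irrc Ec]]] := IH ((k *: 'X) \Po c).
- by rewrite dc'.
- refine (inO_comp charK0 (inO_scaleX k) oc).
- by rewrite dc' ltnW.
exists (bs ++ cs), k'; split=> // [p|]; first by rewrite mem_cat => /orP[/irrb|/irrc].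
by rewrite E Eb -comp_polyA Ec compseq_cat comp_polyA.
Qed.

(** If v = b o c, then c o p and q have a common right factor of degree
    gcd(deg c deg p, deg q) = deg c, so that q factors with the same degrees
    as v. *)
Lemma swap_irreducible p q v v' : irreducibleO q -> (0 < deg p)%N ->
  v \Po p = v' \Po q -> coprime (deg p) (deg q) -> deg v = deg q -> inO v -> irreducibleO v.
Proof.
move=> irr p0 E cop dv ov; have [_ q1 _] := irr.
have q0 := ltnW q1.
apply: irreducibleOP => // [|b c ob oc Ev]; first by rewrite dv.
have w0 : (0 < deg (v' \Po q))%N by rewrite -E deg_comp muln_gt0 dv q0.
have E1 : v' \Po q = b \Po (c \Po p) by rewrite comp_polyA -Ev.
have [h [u1 [u2 [dh _ Eq]]]] := gcd_right_factor charK0 w0 E1 erefl.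
have dbc : deg q = (deg b * deg c)%N by rewrite -dv Ev deg_comp.
have bc0 : (0 < deg b)%N /\ (0 < deg c)%N by apply/andP; rewrite -muln_gt0 -dbc.
have {}dh : deg h = deg c.
  rewrite dh deg_comp gcdnC Gauss_gcdl; last by rewrite coprime_sym.
  by apply/gcdn_idPr; rewrite dbc dvdn_mull.
case: (irreducibleO_deg charK0 irr Eq) => [u21|h1]; last by right; rewrite -dh.
left; apply/eqP; case: bc0 => _ c0; rewrite -(eqn_pmul2r c0) mul1n -dbc.
by rewrite Eq deg_comp u21 mul1n dh.
Qed.

(** Induction on the degree of a, comparing the innermost factors p and q.
    Their common right factor of degree gcd(deg p, deg q) is either associated
    to both, or linear. In the first case a unit moved across makes them
    equal. In the second, a factors through the common composite V o p = V' o
    q of degree deg p * deg q, and the two given decompositions are each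
    linked to one with this right end. *)
Theorem ritt_first a ps qs : irr_decomposition a ps -> irr_decomposition a qs -> linked ps qs.
Proof.
have [n] := ubnP (deg a); elim: n => // n IH in a ps qs * => lta [irrp Ep] [irrq Eq].
have [ps0|[ps' [p Eps]]] : ps = [::] \/ exists ps' p, ps = rcons ps' p.
  by case/lastP: (ps) => [|ps' p]; [left | right; exists ps', p].
  have qs0 : qs = [::] by apply: compseq_deg1 irrq _; rewrite Eq -Ep ps0 /= /deg size_polyX.
  by rewrite ps0 qs0; apply: rt_refl.
have a0 : (0 < deg a)%N by rewrite -Ep deg_compseq_gt0.
have [qs0|[qs' [q Eqs]]] : qs = [::] \/ exists qs' q, qs = rcons qs' q.
  by case/lastP: (qs) => [|qs' q]; [left | right; exists qs', q].
  have ps0 : ps = [::] by apply: compseq_deg1 irrp _; rewrite Ep -Eq qs0 /= /deg size_polyX.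
  by rewrite ps0 qs0; apply: rt_refl.
subst ps qs; rewrite compseq_rcons in Ep; rewrite compseq_rcons in Eq.
have irr_p : irreducibleO p by apply: irrp; rewrite mem_rcons mem_head.
have irr_q : irreducibleO q by apply: irrq; rewrite mem_rcons mem_head.
have irr_ps x : x \in ps' -> irreducibleO x by move=> xps; apply: irrp; rewrite mem_rcons inE xps orbT.
have irr_qs x : x \in qs' -> irreducibleO x by move=> xqs; apply: irrq; rewrite mem_rcons inE xqs orbT.
have [op p1 _] := irr_p; have [oq q1 _] := irr_q.
have ltA x y : (1 < deg y)%N -> x \Po y = a -> (deg x < n)%N.
  move=> y1 E; rewrite -ltnS (leq_trans _ lta) // ltnS -E deg_comp -[X in (X < _)%N]muln1 ltn_pmul2l //.
  by move: a0; rewrite -E deg_comp muln_gt0 => /andP[].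
have [h [u1 [u2 [dh E1 E2]]]] := gcd_right_factor charK0 a0 (esym Ep) (esym Eq).
(* A non-linear h is associated to the irreducible p and q. *)
have [h1|h1] := eqVneq (deg h) 1%N; last first.
  have du1 : deg u1 = 1%N by case: (irreducibleO_deg charK0 irr_p E1) => // /eqP; rewrite (negPf h1).
  have du2 : deg u2 = 1%N by case: (irreducibleO_deg charK0 irr_q E2) => // /eqP; rewrite (negPf h1).
  have dpq : deg p = deg q by rewrite E1 E2 !deg_comp du1 du2.
  have [k k0 [m Eqp]] := same_deg_right_factors charK0 a0 (esym Ep) (esym Eq) dpq.
  have m0 : m = 0.
    have := congr1 (fun p : {poly K} => p`_0) Eqp.
    by rewrite coefD coefZ coefC !inO_coef0 // mulr0 add0r.
  rewrite m0 addr0 in Eqp.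
  have EA : compseq ps' = compseq qs' \Po (k *: 'X).
    apply: (@compfI _ p); first exact: ltnW.
    by rewrite /= Ep -Eq -comp_polyA comp_polyZ comp_polyX -Eqp.
  case/lastP: qs' EA irr_qs Eq {irrq} => [|qs' q'] EA irr_qs Eq.
    have ps0 : ps' = [::] by apply: compseq_deg1 irr_ps _; rewrite EA /= comp_polyX deg_scaleX.
    by move: Ep Eq; rewrite ps0 /= !comp_polyX => -> ->; apply: rt_refl.
  have L : linked ps' (rcons qs' (q' \Po (k *: 'X))).
    apply: (IH (compseq ps')); first exact: ltA Ep.
      by split.
    split; last by rewrite EA !compseq_rcons comp_polyA.
    move=> x; rewrite mem_rcons inE => /orP[/eqP ->|xqs]; last first.
      by apply: irr_qs; rewrite mem_rcons inE xqs orbT.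
    apply: (@irreducibleO_linear _ charK0 q' _ 1 k) => //; first exact: oner_neq0.
      by apply: irr_qs; rewrite mem_rcons mem_head.
    by rewrite scale1r comp_polyX.
  apply: rt_trans (linked_rcons p L) _; apply: rt_step; left.
  exists qs', [::], (q' \Po (k *: 'X)), p, k^-1; split; rewrite ?invr_eq0 //.
    by rewrite -!cats1 -catA.
  by rewrite -comp_polyA scaleXV // comp_polyXr invrK comp_polyZ comp_polyX -Eqp -!cats1 -catA.
have cop : coprime (deg p) (deg q) by rewrite /coprime -dh h1.
have [w [e [v [v' [Ew1 Ew2 Ea dw]]]]] := lcm_left_factor charK0 a0 (esym Ep) (esym Eq).
have {}dw : deg w = (deg p * deg q)%N.
  by have := muln_lcm_gcd (deg p) (deg q); rewrite (eqP cop) muln1 dw.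
(* The constant term of w is moved to the left, so that all factors become
   odd. *)
pose w0 := w`_0.
have oa : inO a.
  rewrite -Ep -compseq_rcons; elim: (rcons ps' p) irrp => [|x xs IHx] irrx /=; first exact: inO_X.
  apply: inO_comp => //; first by have [] := irrx x (mem_head _ _).
  by apply: IHx => y yxs; apply: irrx; rewrite inE yxs orbT.
have {}Ea : a = (e \Po ('X + w0%:P)) \Po (w - w0%:P).
  by rewrite -comp_polyA comp_polyD comp_polyX comp_polyC subrK.
have [|oe ow] := odd_right_factor charK0 a0 oa Ea; first by rewrite coefB coefC subrr.
move: (e \Po _) oe Ea => {}e oe Ea.
have wpos : (0 < deg w)%N by rewrite dw muln_gt0 (ltnW p1) (ltnW q1).
have dw' := deg_subC w0 wpos.
have e0 : (0 < deg e)%N by move: a0; rewrite Ea deg_comp muln_gt0 => /andP[].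
have [es [k [k0 irr_es Ee]]] := decomposition_exists oe e0.
(* The unit k *: X that the decomposition of e leaves over is absorbed here. *)
pose V := k *: (v - w0%:P); pose V' := k *: (v' - w0%:P).
have EV : V \Po p = k *: (w - w0%:P) by rewrite /V comp_polyZ comp_polyB comp_polyC -Ew1.
have EV' : V' \Po q = k *: (w - w0%:P) by rewrite /V' comp_polyZ comp_polyB comp_polyC -Ew2.
have dW : deg (k *: (w - w0%:P)) = (deg p * deg q)%N by rewrite deg_scale // dw'.
have dV : deg V = deg q.
  by apply/eqP; rewrite -(eqn_pmul2r (ltnW p1)) -deg_comp EV dW mulnC.
have dV' : deg V' = deg p by apply/eqP; rewrite -(eqn_pmul2r (ltnW q1)) -deg_comp EV' dW.
have W0 : (0 < deg (k *: (w - w0%:P)))%N by rewrite dW -dw.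
have oW : inO (k *: (w - w0%:P)) by apply: inO_scale.
have [oV _] := odd_right_factor charK0 W0 oW (esym EV) (inO_coef0 op).
have [oV' _] := odd_right_factor charK0 W0 oW (esym EV') (inO_coef0 oq).
have EVV : V \Po p = V' \Po q by rewrite EV EV'.
have irrV := swap_irreducible irr_q (ltnW p1) EVV cop dV oV.
have cop' : coprime (deg q) (deg p) by rewrite coprime_sym.
have irrV' := swap_irreducible irr_p (ltnW q1) (esym EVV) cop' dV' oV'.
have EaV : (compseq es \Po V) \Po p = a.
  by rewrite -comp_polyA EV Ea Ee -[in RHS]comp_polyA; congr (_ \Po _); rewrite [in RHS]comp_polyZ comp_polyX.
have EaV' : (compseq es \Po V') \Po q = a by rewrite -comp_polyA -EVV comp_polyA.
have L xs y V1 : (1 < deg y)%N -> compseq xs \Po y = a -> (compseq es \Po V1) \Po y = a ->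
    (forall z, z \in xs -> irreducibleO z) -> irreducibleO V1 ->
    irr_decomposition (compseq xs) xs /\ irr_decomposition (compseq xs) (rcons es V1).
  move=> y1 Ex EV1 irrx irrV1; split; first by split.
  split; first by move=> z; rewrite mem_rcons inE => /orP[/eqP -> //|/irr_es].
  by rewrite compseq_rcons; apply: (compfI (ltnW y1)); rewrite /= EV1 Ex.
have [D1 D2] := L ps' p V p1 Ep EaV irr_ps irrV.
have [D3 D4] := L qs' q V' q1 Eq EaV' irr_qs irrV'.
apply: rt_trans (linked_rcons p (IH _ _ _ (ltA _ _ p1 Ep) D1 D2)) _.
apply: rt_trans _ (linked_rcons q (IH _ _ _ (ltA _ _ q1 Eq) D4 D3)).
apply: rt_step; right; exists es, [::], (V, p), (V', q).
split; rewrite /= -?cats1 -?catA //.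
by split=> //=; rewrite dV ?dV'.
Qed.

End RittFirst.

(** * Splitting extensions *)

Definition splits (F : fieldType) (p : {poly F}) : Prop :=
  exists rs, p = lead_coef p *: \prod_(z <- rs) ('X - z%:P).

Section Splits.
Variable F : fieldType.
Implicit Types p q : {poly F}.

Lemma size_splits p (rs : seq F) : p != 0 -> p = lead_coef p *: \prod_(z <- rs) ('X - z%:P) ->
  size p = (size rs).+1.
Proof. by move=> p0 E; rewrite {1}E size_scale ?lead_coef_eq0 // size_prod_XsubC. Qed.

Lemma root_splits p (rs : seq F) : p != 0 -> p = lead_coef p *: \prod_(z <- rs) ('X - z%:P) ->
  root p =i rs.
Proof.
by move=> p0 E x; rewrite -topredE /= E rootZ ?lead_coef_eq0 // root_prod_XsubC.
Qed.

Lemma dvdp_splits p q : q != 0 -> p %| q -> splits q -> splits p.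
Proof.
move=> q0 pq [rs E]; move: pq; rewrite E dvdpZr ?lead_coef_eq0 // => /dvdp_prod_XsubC[m /eqpfP Ep].
by exists (mask m rs); rewrite [LHS]Ep (monicP (monic_prod_XsubC _ _ _)) divr1.
Qed.

Lemma splits_root p : splits p -> (1 < size p)%N -> exists t, root p t.
Proof.
move=> [rs E] p1; have p0 : p != 0 by rewrite -size_poly_gt0 ltnW.
have := size_splits p0 E; case: rs E => [|t rs] E sz; first by rewrite sz in p1.
by exists t; have := root_splits p0 E t; rewrite mem_head.
Qed.

(** A root t of p o q yields the root q(t) of p. *)
Lemma splits_comp p q : (0 < deg (p \Po q))%N -> splits (p \Po q) -> splits p.
Proof.
have [n] := ubnP (deg p); elim: n => // n IH in p * => szp d0 spq.
have [p0 q0] : (0 < deg p)%N /\ (0 < deg q)%N by apply/andP; rewrite -muln_gt0 -deg_comp.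
have pq0 : p \Po q != 0 by apply: contraTneq d0 => ->; rewrite /deg size_poly0.
have [t] := splits_root spq (etrans (esym (deg_gt0 _)) d0).
rewrite /root horner_comp => /factor_theorem[p1 Ep].
have p10 : p1 != 0 by apply: contraTneq p0 => p1E; rewrite Ep p1E mul0r /deg size_poly0.
have dp : deg p = (deg p1).+1.
  rewrite /deg Ep size_mul ?polyXsubC_eq0 // size_XsubC addn2 /= prednK //.
  by rewrite size_poly_gt0.
have sp1 : splits (p1 \Po q).
  by apply: dvdp_splits pq0 _ spq; rewrite Ep comp_polyM dvdp_mulr.
have [rs E] : splits p1.
  have [p1q|p1q] := posnP (deg (p1 \Po q)); last by apply: IH => //; rewrite -ltnS -dp.
  exists [::]; rewrite big_nil alg_polyC.
  have : deg p1 = 0%N by move/eqP: p1q; rewrite deg_comp muln_eq0 => /orP[/eqP//|/eqP q00]; rewrite q00 in q0.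
  by rewrite /deg => s1; rewrite lead_coefE s1; apply: size1_polyC; case: (size p1) s1 => [|[]].
exists (q.[t] :: rs); rewrite big_cons {2}Ep lead_coef_Mmonic ?monicXsubC //.
by rewrite scalerAr -E mulrC.
Qed.

End Splits.

Section Extension.

Lemma splits_map (F L : fieldType) (iota : {rmorphism F -> L}) (p : {poly F}) :
  splits p -> splits (map_poly iota p).
Proof.
move=> [rs E]; exists (map iota rs).
by rewrite {1}E map_polyZ lead_coef_map big_map rmorph_prod /=; congr (_ *: _); apply: eq_bigr => z _; rewrite map_polyXsubC.
Qed.

Lemma splitting_extension (F : fieldType) (p : {poly F}) :
  exists (L : fieldType) (iota : {rmorphism F -> L}), splits (map_poly iota p).
Proof.
have [n] := ubnP (size p); elim: n => // n IH in F p * => szp.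
have [p1|p1] := leqP (size p) 1.
  exists F, idfun; exists [::]; rewrite big_nil alg_polyC map_poly_id //.
  by rewrite lead_coefE {1}(size1_polyC p1); case: (size p) p1 => [|[]].
have [d dirr dp] := irreducible_divisor p1.
have [L _ [z rz _]] := irredp_FAdjoin dirr.
pose iota : {rmorphism F -> L} := in_alg L.
have : root (map_poly iota p) z.
  by move: rz; rewrite -!dvdp_XsubCl => /dvdp_trans; apply; rewrite dvdp_map.
case/factor_theorem => q Eq.
have p0 : map_poly iota p != 0 by rewrite map_poly_eq0 -size_poly_gt0 ltnW.
have q0 : q != 0 by apply: contraNneq p0 => q0; rewrite Eq q0 mul0r.
have szq : (size q < n)%N.
  move: szp; rewrite -(size_map_poly iota) Eq size_mul ?polyXsubC_eq0 // size_XsubC addn2.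
  by rewrite ltnS.
have [L' [iota' [rs E]]] := IH L q szq.
exists L', (iota' \o iota); exists (iota' z :: rs).
rewrite map_poly_comp /= Eq rmorphM /= map_polyXsubC lead_coef_Mmonic ?monicXsubC //.
by rewrite big_cons scalerAr -E mulrC.
Qed.

(** All critical points, the points over all critical values and those over 0
    are rational: this is what the ramification counts refer to. *)
Definition critically_split (F : fieldType) (f : {poly F}) :=
  [/\ splits f, splits f^`() & forall t, root f^`() t -> splits (f - f.[t]%:P)].

(** Two steps are needed, since the critical values are available only after
    the critical points have been adjoined. As f' is split by then, the second
    extension has no new critical values. *)
Lemma critically_split_extension (F : fieldType) (f : {poly F}) : (0 < deg f)%N -> f^`() != 0 ->
  exists (L : fieldType) (iota : {rmorphism F -> L}), critically_split (map_poly iota f).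
Proof.
move=> f1 f'0; have f0 : f != 0 by apply: contraTneq f1 => ->; rewrite /deg size_poly0.
have [L1 [i1 s1]] := splitting_extension (f * f^`()).
set f1' := map_poly i1 f.
have ff0 : map_poly i1 (f * f^`()) != 0 by rewrite map_poly_eq0 mulf_neq0.
have sf : splits f1' by apply: dvdp_splits ff0 _ s1; rewrite rmorphM dvdp_mulr.
have sf' : splits f1'^`() by apply: dvdp_splits ff0 _ s1; rewrite rmorphM deriv_map dvdp_mull.
have [ts Ets] := sf'.
have [L2 [i2 s2]] := splitting_extension (\prod_(t <- ts) (f1' - f1'.[t]%:P)).
exists L2, (i2 \o i1); rewrite /critically_split map_poly_comp -/f1'.
split; first exact: splits_map; first by rewrite deriv_map; apply: splits_map.
move=> t; rewrite deriv_map => rt.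
have f1'0 : f1'^`() != 0 by rewrite deriv_map map_poly_eq0.
have [t1 t1s ->] : exists2 t1, t1 \in ts & t = i2 t1.
  move: rt; rewrite Ets map_polyZ rootZ ?fmorph_eq0 ?lead_coef_eq0 //.
  rewrite rmorph_prod /= (eq_bigr (fun z => 'X - (i2 z)%:P)) => [|z _]; last by rewrite map_polyXsubC.
  by rewrite -(big_map i2 xpredT (fun z => 'X - z%:P)) root_prod_XsubC => /mapP[t1]; exists t1.
rewrite horner_map /= -map_polyC -rmorphB /=.
apply: dvdp_splits _ _ s2; last by rewrite dvdp_map (big_rem _ t1s) /= dvdp_mulr.
rewrite map_poly_eq0 prodf_seq_neq0; apply/allP => x _ /=.
have f1'1 : (1 < size f1')%N by rewrite size_map_poly -deg_gt0.
rewrite -size_poly_gt0 -polyCN size_polyDl ?(ltnW f1'1) //.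
by rewrite (leq_ltn_trans (size_polyC_leq1 _)).
Qed.

End Extension.

(** * Fibres and critical points *)

Section Ramification.
Variable K : fieldType.
Hypothesis charK0 : [pchar K] =i pred0.
Implicit Types (a b c d f p q : {poly K}) (rs zs : seq K).

Local Notation roots_of p rs := (p = lead_coef p *: \prod_(z <- rs) ('X - z%:P)).

Lemma deriv_neq0 p : (0 < deg p)%N -> p^`() != 0.
Proof.
move=> p1; apply/negP => /eqP /(congr1 (fun q : {poly K} => q`_(deg p).-1)).
rewrite coef0 coef_deriv prednK // /deg -lead_coefE => /eqP.
by rewrite -mulr_natl mulf_eq0 natrK_eq0 // lead_coef_eq0 -size_poly_eq0 -leqn0 leqNgt; move: p1; rewrite /deg; case: (size p) => [|[]].
Qed.

Lemma lead_coef_deriv p : (0 < deg p)%N -> lead_coef p^`() = lead_coef p *+ deg p /\ size p^`() = deg p.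
Proof.
move=> p1; have sp := size_deg p1.
have E : p^`()`_(deg p).-1 = lead_coef p *+ deg p.
  by rewrite coef_deriv prednK // /deg -lead_coefE.
have nz : p^`()`_(deg p).-1 != 0.
  rewrite E -mulr_natl mulf_neq0 ?natrK_eq0 -?lt0n //.
  by rewrite lead_coef_eq0 -size_poly_eq0 sp.
have sd : size p^`() = deg p.
  apply/eqP; rewrite eqn_leq -ltnS -sp lt_size_deriv; last by rewrite -size_poly_eq0 sp.
  by rewrite -[X in (X <= _)%N](prednK p1) ltnNge; apply: contra nz => /leq_sizeP/(_ _ (leqnn _)) ->.
by rewrite lead_coefE sd E.
Qed.

Lemma mup_scale (k : K) p x : k != 0 -> mup x (k *: p) = mup x p.
Proof. by move=> k0; rewrite -mul_polyC mupMr // rootC. Qed.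

Lemma mup_roots p rs x : p != 0 -> roots_of p rs -> mup x p = count_mem x rs.
Proof. by move=> p0 E; rewrite E mup_scale ?lead_coef_eq0 // mu_prod_XsubC. Qed.

Lemma mup_deriv p x : (0 < deg p)%N -> root p x -> mup x p = (mup x p^`()).+1.
Proof.
move=> p1 px; have p0 : p != 0 by apply: contraTneq p1 => ->; rewrite /deg size_poly0.
have p'0 := deriv_neq0 p1.
have [k [q]] := multiplicity_XsubC p x; rewrite p0 /= => qx E.
case: k E => [|k] E; first by move: px qx; rewrite E mulr1 => ->.
have q0 : q != 0 by apply: contraNneq qx => ->; rewrite root0.
have X0 j : ('X - x%:P) ^+ j != 0 by rewrite expf_neq0 // polyXsubC_eq0.
have E' : p^`() = ('X - x%:P) ^+ k * (q *+ k.+1 + q^`() * ('X - x%:P)).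
  rewrite E derivM deriv_exp derivXsubC mul1r -mulr_natr -[q *+ _]mulr_natr /= !exprS; ring.
have r0 : ~~ root (q *+ k.+1 + q^`() * ('X - x%:P)) x.
  rewrite /root hornerD hornerM hornerXsubC subrr mulr0 addr0 hornerMn -mulr_natl.
  by rewrite mulf_neq0 // natrK_eq0.
by rewrite E' E mupM // mupMl // mupNroot // !mup_XsubCX eqxx ?mul1n ?add0n.
Qed.

(** A root of multiplicity k + 1 of p - l is a root of multiplicity k of p':
    so the roots, counted with multiplicity, are the distinct ones together
    with the critical points over l. *)
Lemma perm_roots_deriv p rs zs (l : K) : (0 < deg p)%N ->
  roots_of (p - l%:P) rs -> roots_of p^`() zs ->
  perm_eq rs (undup rs ++ [seq z <- zs | p.[z] == l]).
Proof.
move=> p1 Er Ez.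
have dl := deg_subC l p1.
have q1 : (0 < deg (p - l%:P))%N by rewrite dl.
have q0 : p - l%:P != 0 by apply: contraTneq q1 => ->; rewrite /deg size_poly0.
have p'0 := deriv_neq0 p1.
have rsE x : (x \in rs) = (p.[x] == l).
  by rewrite -(root_splits q0 Er) -topredE /= /root !hornerE subr_eq0.
rewrite /perm_eq; apply/allP => x _ /=; apply/eqP.
rewrite count_cat (count_uniq_mem x (undup_uniq rs)) mem_undup count_filter.
rewrite [count _ zs](@eq_count _ _ (fun z => (x \in rs) && (z == x))); last first.
  by move=> z /=; case: (z =P x) => [->|_]; rewrite ?andbT ?andbF -?rsE.
rewrite -(mup_roots x q0 Er); case: (boolP (x \in rs)) => xrs; last first.
  rewrite (@eq_count _ _ pred0) // count_pred0 mupNroot //.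
  by have := root_splits q0 Er x; rewrite (negPf xrs) -topredE /= => ->.
rewrite mup_deriv //; last by have := root_splits q0 Er x; rewrite xrs -topredE.
by rewrite derivB derivC subr0 (mup_roots x p'0 Ez) add1n; congr _.+1; apply: eq_count.
Qed.

Lemma finite_roots p : p != 0 -> exists2 xs, uniq xs & forall x, root p x -> x \in xs.
Proof.
have [n] := ubnP (size p); elim: n => // n IH in p * => szp p0.
have [[x0 /factor_theorem[q E]]|none] := classic (exists x0, root p x0); last first.
  by exists [::] => // x px; case: none; exists x.
have q0 : q != 0 by apply: contraNneq p0 => q0; rewrite E q0 mul0r.
have szq : (size q < n)%N.
  by move: szp; rewrite E size_mul ?polyXsubC_eq0 // size_XsubC addn2 ltnS.
have [xs _ H] := IH q szq q0; exists (undup (x0 :: xs)); first exact: undup_uniq.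
move=> x; rewrite mem_undup inE E rootM root_XsubC => /orP[/H ->|->] //.
by rewrite orbT.
Qed.

End Ramification.

Section Fibres.
Variable K : fieldType.
Hypothesis charK0 : [pchar K] =i pred0.
Implicit Types (a b c d f p q : {poly K}) (rs zs : seq K).

Local Notation roots_of p rs := (p = lead_coef p *: \prod_(z <- rs) ('X - z%:P)).

Lemma subC_neq0 p (l : K) : (0 < deg p)%N -> p - l%:P != 0.
Proof. by move=> p1; rewrite -size_poly_gt0 ltnW // -deg_gt0 deg_subC. Qed.

Lemma size_roots p rs : (0 < deg p)%N -> roots_of p rs -> size rs = deg p.
Proof.
move=> p1 E; have p0 : p != 0 by apply: contraTneq p1 => ->; rewrite /deg size_poly0.
by rewrite /deg (size_splits p0 E).
Qed.

Lemma mem_fibre p (l : K) rs x : (0 < deg p)%N -> roots_of (p - l%:P) rs -> (x \in rs) = (p.[x] == l).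
Proof.
move=> p1 E; rewrite -(root_splits (subC_neq0 l p1) E) -topredE /= /root !hornerE.
by rewrite subr_eq0.
Qed.

(** The Riemann-Hurwitz count in one fibre. *)
Lemma fibre_card p (l : K) rs zs : (0 < deg p)%N ->
  roots_of (p - l%:P) rs -> roots_of p^`() zs ->
  deg p = (size (undup rs) + count (fun z => p.[z] == l) zs)%N.
Proof.
move=> p1 Er Ez; have dl := deg_subC l p1.
rewrite -dl -(size_roots _ Er) ?dl // (perm_size (perm_roots_deriv charK0 p1 Er Ez)).
by rewrite size_cat size_filter.
Qed.

Lemma nonsimple_fibre p (l : K) rs zs : (0 < deg p)%N ->
  roots_of (p - l%:P) rs -> roots_of p^`() zs ->
  (count (fun x => p^`().[x] == 0%R) (undup rs) <= count (fun z => p.[z] == l) zs)%N.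
Proof.
move=> p1 Er Ez; rewrite -!size_filter; apply: uniq_leq_size.
  by rewrite filter_uniq // undup_uniq.
move=> x; rewrite !mem_filter mem_undup (mem_fibre _ p1 Er) => /andP[p'x ->] /=.
by rewrite -(root_splits (deriv_neq0 charK0 p1) Ez).
Qed.

(** A fibre of deg p points counted with multiplicity: the critical points
    over l use up at most two each. *)
Lemma simple_fibre p (l : K) rs zs : (0 < deg p)%N ->
  roots_of (p - l%:P) rs -> roots_of p^`() zs ->
  (deg p <= count (fun x => p^`().[x] != 0%R) (undup rs) + (count (fun z => p.[z] == l) zs).*2)%N.
Proof.
move=> p1 Er Ez; have := nonsimple_fibre p1 Er Ez.
have := count_predC (fun x => p^`().[x] == 0) (undup rs).
have := fibre_card p1 Er Ez; rewrite -addnn.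
have -> : count (predC (fun x => p^`().[x] == 0)) (undup rs) = count (fun x => p^`().[x] != 0) (undup rs) by apply: eq_count.
move: (count _ _) (count _ _) (count _ _) (size _) => x y z t; lia.
Qed.

Lemma size_crit p zs : (0 < deg p)%N -> roots_of p^`() zs -> (size zs).+1 = deg p.
Proof.
move=> p1 E; rewrite -(size_splits (deriv_neq0 charK0 p1) E).
exact: (lead_coef_deriv charK0 p1).2.
Qed.

Section Square.
Variables (a b c d : {poly K}).
Hypotheses (abcd : a \Po b = c \Po d) (cop : coprime (deg b) (deg d)).
Hypotheses (a_gt0 : (0 < deg a)%N) (b_gt0 : (0 < deg b)%N).
Hypotheses (c_gt0 : (0 < deg c)%N) (d_gt0 : (0 < deg d)%N).
Hypothesis crit : critically_split (a \Po b).

Let f := a \Po b.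

Lemma f_gt0 : (0 < deg f)%N.
Proof. by rewrite deg_comp muln_gt0 a_gt0. Qed.

(** The critical values of an outer factor of f are critical values of f. *)
Lemma crit_value_splits y : root c^`() y -> splits (f - c.[y]%:P).
Proof.
move=> cy; have [_ sf' sft] := crit; have f'0 := deriv_neq0 charK0 f_gt0.
have Ef' : f^`() = (c^`() \Po d) * d^`() by rewrite /f abcd deriv_comp.
have dvd : d - y%:P %| f^`().
  rewrite Ef' dvdp_mulr //; have /factor_theorem[q ->] := cy.
  by rewrite comp_polyM comp_polyB comp_polyX comp_polyC dvdp_mull.
have [t] : exists t, root (d - y%:P) t.
  by apply: splits_root (dvdp_splits f'0 dvd sf') _; rewrite -deg_gt0 deg_subC.
rewrite -dvdp_XsubCl => td; have : root f^`() t by rewrite -dvdp_XsubCl (dvdp_trans td).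
move/sft; rewrite -/f {2}/f abcd horner_comp.
by move: td; rewrite dvdp_XsubCl /root !hornerE subr_eq0 => /eqP ->.
Qed.

Lemma crit_fibre_splits y : root c^`() y ->
  [/\ splits (a - c.[y]%:P), splits (c - c.[y]%:P) &
    forall x, a.[x] = c.[y] -> splits (b - x%:P)].
Proof.
move=> /crit_value_splits sf.
have Ea : f - c.[y]%:P = (a - c.[y]%:P) \Po b by rewrite comp_polyB comp_polyC.
have Ec : f - c.[y]%:P = (c - c.[y]%:P) \Po d by rewrite comp_polyB comp_polyC -abcd.
have pos : (0 < deg (f - c.[y]%:P))%N by rewrite deg_subC ?f_gt0.
split.
- by apply: (@splits_comp _ _ b); rewrite -Ea.
- by apply: (@splits_comp _ _ d); rewrite -Ec.
- move=> x ax; apply: dvdp_splits (subC_neq0 _ f_gt0) _ sf.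
  have : root (a - c.[y]%:P) x by rewrite /root !hornerE ax subrr.
  case/factor_theorem => q Eq; rewrite Ea Eq.
  by rewrite comp_polyM comp_polyB comp_polyX comp_polyC dvdp_mull.
Qed.

(** The map d sends the fibre of b over x into the fibre of c over c(y), and
    is injective there. Hence the first fibre has at most as many points, and,
    the degrees of b and c being equal, at least as much ramification. *)
Lemma simple_point_ramification zb zc x y : deg b = deg c ->
  roots_of b^`() zb -> roots_of c^`() zc ->
  root c^`() y -> a.[x] = c.[y] -> a^`().[x] != 0 ->
  (count (fun z => c.[z] == c.[y]) zc <= count (fun t => b.[t] == x) zb)%N.
Proof.
move=> dbc Eb Ec cy ax a'x; have [_ [rc Erc] sb] := crit_fibre_splits cy.
have [rb Erb] := sb x ax.
have := fibre_card b_gt0 Erb Eb; have := fibre_card c_gt0 Erc Ec.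
suff : (size (undup rb) <= size (undup rc))%N.
  by rewrite dbc; move: (count _ _) (count _ _) (size _) (size _) => i j k l; lia.
rewrite -(size_map (fun t => d.[t])); apply: uniq_leq_size.
  rewrite map_inj_in_uniq ?undup_uniq // => t1 t2.
  rewrite !mem_undup !(mem_fibre _ b_gt0 Erb) => /eqP bt1 /eqP bt2 dt.
  by apply: (fibre_inj abcd b_gt0 d_gt0 cop) dt _; rewrite bt1 ?bt2.
move=> z /mapP[t]; rewrite !mem_undup (mem_fibre _ b_gt0 Erb) => /eqP bt ->.
by rewrite (mem_fibre _ c_gt0 Erc) -horner_comp -abcd horner_comp bt ax.
Qed.

Lemma sum_count_uniq (T : Type) (S : eqType) (h : T -> S) (ts : seq T) (xs : seq S) : uniq xs ->
  (\sum_(x <- xs) count (fun t => h t == x) ts <= size ts)%N.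
Proof.
move=> ux; under eq_bigr do rewrite -sum1_count big_mkcond.
rewrite exchange_big /= -sum1_size; apply: leq_sum => t _.
by rewrite -big_mkcond sum1_count -(@eq_count _ (pred1 (h t))) ?count_uniq_mem ?leq_b1 // => x /=; rewrite eq_sym.
Qed.

(** Exchange the summations: each point x of xs that is simple for a
    contributes the number of critical points of c over a(x), which is at most
    that of b over x. The critical points of b are as many as those of c. *)
Lemma simple_fibre_sum zb zc xs : deg b = deg c ->
  roots_of b^`() zb -> roots_of c^`() zc -> uniq xs ->
  (\sum_(y <- zc) count (fun x => (a.[x] == c.[y]) && (a^`().[x] != 0%R)) xs <= size zc)%N.
Proof.
move=> dbc Eb Ec ux.
have c'0 := deriv_neq0 charK0 c_gt0; have b'0 := deriv_neq0 charK0 b_gt0.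
have -> : size zc = size zb.
  by apply: succn_inj; rewrite (size_crit c_gt0 Ec) (size_crit b_gt0 Eb).
apply: leq_trans _ (sum_count_uniq (fun t => b.[t]) zb ux).
under eq_bigr do rewrite -sum1_count big_mkcond.
rewrite exchange_big /=; apply: leq_sum => x _.
rewrite -big_mkcond sum1_count.
have [a'x|a'x] := eqVneq (a^`().[x]) 0.
  by rewrite (@eq_count _ _ pred0) ?count_pred0 // => y /=; rewrite andbF.
rewrite (@eq_count _ _ (fun y => a.[x] == c.[y])); last by move=> y /=; rewrite andbT.
have [/hasP[y yc /eqP ax]|nh] := boolP (has (fun y => a.[x] == c.[y]) zc); last first.
  by move: nh; rewrite has_count -leqNgt leqn0 => /eqP ->.
have cy : root c^`() y by have := root_splits c'0 Ec y; rewrite yc.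
rewrite (@eq_count _ _ (fun z => c.[z] == c.[y])); last by move=> z /=; rewrite ax eq_sym.
exact: simple_point_ramification cy ax a'x.
Qed.

End Square.
End Fibres.

(** * Ramification of odd polynomials *)

Section OddFibres.
Variable K : fieldType.
Hypothesis charK0 : [pchar K] =i pred0.
Implicit Types (a b c d f p q : {poly K}) (rs zs : seq K).

Local Notation roots_of p rs := (p = lead_coef p *: \prod_(z <- rs) ('X - z%:P)).

Lemma deriv_comp_opp p : inO p -> p^`() \Po (- 'X) = p^`().
Proof.
move/(inON charK0)/(congr1 (fun q => q^`())); rewrite deriv_comp derivN derivX mulrN1 derivN.
by move/oppr_inj.
Qed.

Lemma prod_comp_opp zs :
  (\prod_(z <- zs) ('X - z%:P)) \Po (- 'X) =
  (-1) ^+ size zs *: \prod_(z <- map -%R zs) ('X - z%:P) :> {poly K}.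
Proof.
elim: zs => [|z zs IH]; first by rewrite !big_nil comp_polyC scale1r.
rewrite map_cons !big_cons comp_polyM IH comp_polyB comp_polyX comp_polyC polyCN exprS.
by rewrite mulN1r scaleNr -scalerAr -scalerN -mulNr; congr (_ *: (_ * _)); ring.
Qed.

(** The derivative of an odd polynomial is even. *)
Lemma crit_roots_opp p zs : inO p -> (0 < deg p)%N -> roots_of p^`() zs -> perm_eq zs (map -%R zs).
Proof.
move=> op p1 Ez; have p'0 := deriv_neq0 charK0 p1.
have := deriv_comp_opp op; rewrite {1}Ez comp_polyZ prod_comp_opp scalerA => E.
apply: prod_XsubC_eq; apply/(scalerI (_ : lead_coef p^`() != 0)); first by rewrite lead_coef_eq0.
rewrite -Ez -E; congr (_ *: _).
have := congr1 lead_coef E; rewrite lead_coefZ (monicP (monic_prod_XsubC _ _ _)) mulr1.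
by move=> ->.
Qed.

Lemma odd_hornerN p x : inO p -> p.[- x] = - p.[x].
Proof.
move/(inON charK0)/(congr1 (fun q => q.[x])); rewrite horner_comp !hornerN hornerX.
by [].
Qed.

Lemma crit_count_opp p zs (l : K) : inO p -> (0 < deg p)%N -> roots_of p^`() zs ->
  count (fun z => p.[z] == - l) zs = count (fun z => p.[z] == l) zs.
Proof.
move=> op p1 /(crit_roots_opp op p1)/seq.permP ->; rewrite count_map; apply: eq_count => z /=.
by rewrite odd_hornerN // eqr_opp.
Qed.

(** The critical points over l and over -l are equally many, and those over 0
    are distinct from both. *)
Lemma crit_count_bound p zs (l : K) : inO p -> (0 < deg p)%N -> roots_of p^`() zs -> l != 0 ->
  ((count (fun z => p.[z] == l) zs).*2 + count (fun z => p.[z] == 0%R) zs <= size zs)%N.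
Proof.
move=> op p1 Ez l0; rewrite -addnn -{1}(crit_count_opp l op p1 Ez).
have lN : (- l == l) = false by rewrite (oppK_eq charK0) (negPf l0).
elim: zs {Ez} => // z zs IH /=.
have : ((p.[z] == - l) + (p.[z] == l) + (p.[z] == 0%R) <= 1)%N.
  have [->|_] := eqVneq p.[z] (- l); first by rewrite lN oppr_eq0 (negPf l0).
  by have [->|_] := eqVneq p.[z] l; [rewrite (negPf l0)|case: eqP].
move: IH; move: (count _ _) (count _ _) (count _ _) => i j k.
by move: (_ == _) (_ == _) (_ == _) => [] [] [] /=; lia.
Qed.

Section Square.
Variables (a b c d : {poly K}) (za zb zc : seq K).
Hypotheses (abcd : a \Po b = c \Po d) (cop : coprime (deg b) (deg d)) (dbc : deg b = deg c).
Hypotheses (a_gt0 : (1 < deg a)%N) (c_gt0 : (1 < deg c)%N) (d_gt0 : (0 < deg d)%N).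
Hypothesis crit : critically_split (a \Po b).
Hypotheses (oa : inO a).
Hypotheses (Ea : roots_of a^`() za) (Eb : roots_of b^`() zb) (Ec : roots_of c^`() zc).

Let A l := count (fun z => a.[z] == l) za.
Let A0 := A 0.
Let C0 := count (fun z => c.[z] == 0) zc.

(** What the counts below need of the simple points of a, without the finite
    set in which s(l) counts those over l. A fibre with s(l) <= 1 has at most
    one simple point, which is the form in which s(l) = 1 is used. *)
Lemma odd_simple_fibre_sum : exists s : K -> nat,
  [/\ (\sum_(y <- zc) s c.[y] <= size zc)%N,
   forall y, y \in zc -> (deg a <= s c.[y] + (A c.[y]).*2)%N &
   forall y, y \in zc -> (s c.[y] <= 1)%N -> forall x1 x2, a.[x1] = c.[y] -> a.[x2] = c.[y] ->
     a^`().[x1] != 0 -> a^`().[x2] != 0 -> x1 = x2].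
Proof.
have a1 := ltnW a_gt0; have c1 := ltnW c_gt0.
have b1 : (0 < deg b)%N by rewrite dbc.
have c'0 := deriv_neq0 charK0 c1.
have P0 : \prod_(y <- zc) (a - c.[y]%:P) != 0.
  by rewrite prodf_seq_neq0; apply/allP => y _ /=; apply: subC_neq0.
have [xs uxs xsP] := finite_roots P0.
have xsE y x : y \in zc -> a.[x] = c.[y] -> x \in xs.
  move=> yc ax; apply: xsP; rewrite -dvdp_XsubCl (big_rem _ yc) /=.
  by rewrite dvdp_mulr // dvdp_XsubCl /root !hornerE ax subrr.
exists (fun l => count (fun x => (a.[x] == l) && (a^`().[x] != 0)) xs); split.
- exact: simple_fibre_sum abcd cop a1 b1 c1 d_gt0 crit _ _ _ dbc Eb Ec uxs.
- move=> y yc; have cy : root c^`() y by have := root_splits c'0 Ec y; rewrite yc.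
  have [[ra Era] _ _] := crit_fibre_splits charK0 abcd a1 b1 d_gt0 crit cy.
  have := simple_fibre charK0 a1 Era Ea; move=> /leq_trans; apply.
  rewrite leq_add2r -!size_filter; apply: uniq_leq_size.
    by rewrite filter_uniq // undup_uniq.
  move=> x; rewrite !mem_filter mem_undup (mem_fibre _ a1 Era) => /andP[-> /eqP ax].
  by rewrite ax eqxx (xsE y).
- move=> y yc; rewrite -size_filter => s1 x1 x2 e1 e2 n1 n2.
  have m1 : x1 \in [seq x <- xs | (a.[x] == c.[y]) && (a^`().[x] != 0)].
    by rewrite mem_filter e1 eqxx n1 (xsE y).
  have m2 : x2 \in [seq x <- xs | (a.[x] == c.[y]) && (a^`().[x] != 0)].
    by rewrite mem_filter e2 eqxx n2 (xsE y).
  by case: (filter _ _) s1 m1 m2 => [|x [|]] //; rewrite !inE => _ /eqP -> /eqP ->.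
Qed.

(** By oddness s(l) exceeds A0 for each nonzero critical value l of c. If N is
    the number of critical points y of c with c(y) nonzero, this gives (A0 +
    1) N for the sum of the s(c(y)), at most their total number N + C0. *)
Lemma ramification_over_zero :
  (A0 * count (fun y => c.[y] != 0%R) zc <= C0)%N.
Proof.
have a1 := ltnW a_gt0.
have [s [sum_s deg_s _]] := odd_simple_fibre_sum.
have sza := size_crit charK0 a1 Ea.
have lb : (\sum_(y <- zc) (if c.[y] == 0%R then s 0%R else A0.+1) <= size zc)%N.
  apply: leq_trans _ sum_s; rewrite big_seq [X in (_ <= X)%N]big_seq; apply: leq_sum => y yc.
  case: eqP => [-> //|/eqP cy0].
  have bd : ((A c.[y]).*2 + A0 <= size za)%N := crit_count_bound oa a1 Ea cy0.
  move: bd (deg_s y yc); rewrite -sza.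
  by move: (A _) A0 (s _) (size _) => i j k l; lia.
have E : (\sum_(y <- zc) (if c.[y] == 0%R then s 0%R else (A0).+1) =
    s 0%R * C0 + (A0).+1 * count (fun y => c.[y] != 0%R) zc)%N.
  rewrite (bigID (fun y => c.[y] == 0)) /=; congr (_ + _)%N.
    rewrite (eq_bigr (fun=> s 0)) => [|y ->] //.
    by rewrite big_const_seq iter_addn_0.
  rewrite (eq_bigr (fun=> A0.+1)) => [|y /negPf ->] //.
  by rewrite big_const_seq iter_addn_0.
have Es : size zc = (C0 + count (fun y => c.[y] != 0%R) zc)%N.
  by rewrite /C0 -(count_predC (fun y => c.[y] == 0)).
move: lb; rewrite E Es mulSn; set N := count (fun y => c.[y] != 0) zc.
by move: (A0 * N)%N (s 0%R * C0)%N (N) (C0) => i j n k; lia.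
Qed.

(** Now 0 is not a critical value of c, so every s(c(y)) is at least 1, while
    their sum is at most their number: all of them are equal to 1. *)
Lemma unramified_over_zero y : A0 = 0%N -> C0 = 0%N -> y \in zc ->
  (A c.[y]).*2.+1 = deg a /\ forall x1 x2, a.[x1] = c.[y] -> a.[x2] = c.[y] ->
     a^`().[x1] != 0 -> a^`().[x2] != 0 -> x1 = x2.
Proof.
move=> A00 C00 yc; have a1 := ltnW a_gt0.
have [s [sum_s deg_s inj_s]] := odd_simple_fibre_sum.
have sza := size_crit charK0 a1 Ea.
have bnd z : z \in zc -> ((A c.[z]).*2 <= size za)%N.
  move=> zin; have cz0 : c.[z] != 0.
    apply/negP => cz; have : has (fun z => c.[z] == 0) zc by apply/hasP; exists z.
    by rewrite has_count -/C0 C00.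
  have bd : ((A c.[z]).*2 + A0 <= size za)%N := crit_count_bound oa a1 Ea cz0.
  by move: bd; rewrite A00 addn0.
have s1 z : z \in zc -> (1 <= s c.[z])%N.
  by move=> zin; have := bnd z zin; have := deg_s z zin; rewrite -sza; move: (A _) (s _) (size _) => i j k; lia.
have sy : (s c.[y] <= 1)%N.
  move: sum_s; rewrite (big_rem _ yc) /= (perm_size (perm_to_rem yc)) /=.
  suff : (size (rem y zc) <= \sum_(z <- rem y zc) s c.[z])%N.
    by move: (s _) (size _) (\sum_(_ <- _) _)%N => i j k; lia.
  rewrite -sum1_size big_seq [X in (_ <= X)%N]big_seq; apply: leq_sum => z /mem_rem; exact: s1.
split; last exact: inj_s.
have := bnd y yc; have := deg_s y yc; rewrite -sza.
by move: (A _) (s _) (size _) sy => i j k; lia.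
Qed.

End Square.
End OddFibres.

(** * The Pell equation of doubly ramified polynomials *)

(** The Chebyshev polynomial T_n satisfies it with L = X = 1: there it is
    cos^2 + sin^2 = 1, read through the derivative n sin(n t) / sin t of T_n
    at cos t. *)
Definition pell (F : fieldType) (L X : F) (p : {poly F}) : Prop :=
  (deg p)%:R ^+ 2 *: (p ^+ 2 - L%:P) = ('X^2 - X%:P) * p^`() ^+ 2.

Section Pell.
Variable K : fieldType.
Hypothesis charK0 : [pchar K] =i pred0.
Implicit Types (a b c d f p q : {poly K}) (rs zs : seq K).

Local Notation roots_of p rs := (p = lead_coef p *: \prod_(z <- rs) ('X - z%:P)).

(** The critical points over l are half of all, so the others, being at least
    the opposites of these, are exactly these opposites. *)
Lemma crit_double p (l : K) zs : inO p -> (0 < deg p)%N -> roots_of p^`() zs -> l != 0 ->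
  (count (fun z => p.[z] == l) zs).*2.+1 = deg p ->
  perm_eq zs ([seq z <- zs | p.[z] == l] ++ map -%R [seq z <- zs | p.[z] == l]).
Proof.
move=> op p1 Ez l0 half; set Z := filter _ zs.
have szs := size_crit charK0 p1 Ez.
have EZ' : perm_eq [seq z <- zs | p.[z] == - l] (map -%R Z).
  have := perm_filter (fun z => p.[z] == - l) (crit_roots_opp charK0 op p1 Ez).
  rewrite filter_map; congr perm_eq; congr map; apply: eq_filter => z /=.
  by rewrite odd_hornerN // eqr_opp.
have nl : - l == l = false by rewrite (oppK_eq charK0) (negPf l0).
rewrite -(perm_filterC (fun z => p.[z] == l) zs) perm_cat2l.
apply: perm_trans _ EZ'; rewrite -(all_filterP (_ : all (fun z => p.[z] == - l) (filter (predC _) zs))).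
  rewrite -filter_predI /= (@eq_filter _ _ (fun z => p.[z] == - l)) // => z /=.
  by case: eqP => //= ->; rewrite nl.
rewrite all_count size_filter count_filter.
rewrite (@eq_count _ _ (fun z => p.[z] == - l)); last by move=> z /=; case: eqP => //= ->; rewrite nl.
rewrite (crit_count_opp charK0 l op p1 Ez) -(eqn_add2l (count (fun z => p.[z] == l) zs)).
by rewrite count_predC addnn -eqSS szs half.
Qed.

(** Over l there are one simple point x and only double ones: p - l = k (X -
    x) Q^2, and by oddness p + l = k (X + x) Q(-X)^2. The critical points are
    the roots of Q and their opposites, so p' is, up to sign, k deg(p) Q
    Q(-X). Multiply. *)
Lemma pell_of_double p (l : K) zs rs : inO p -> (0 < deg p)%N -> l != 0 ->
  roots_of p^`() zs -> roots_of (p - l%:P) rs ->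
  (count (fun z => p.[z] == l) zs).*2.+1 = deg p ->
  (forall x1 x2, p.[x1] = l -> p.[x2] = l -> p^`().[x1] != 0 -> p^`().[x2] != 0 -> x1 = x2) ->
  exists2 x, p.[x] = l /\ p^`().[x] != 0 & pell (l ^+ 2) (x ^+ 2) p.
Proof.
move=> op p1 l0 Ez Er half inj; set Z := [seq z <- zs | p.[z] == l].
have p0 : p != 0 by apply: contraTneq p1 => ->; rewrite /deg size_poly0.
have szZ : size Z = count (fun z => p.[z] == l) zs by rewrite size_filter.
pose S := [seq x <- undup rs | p^`().[x] != 0].
have Sx x : x \in S -> p.[x] = l /\ p^`().[x] != 0.
  by rewrite mem_filter mem_undup (mem_fibre _ p1 Er) => /andP[-> /eqP].
have [x ES] : exists x, S = [:: x].
  have := simple_fibre charK0 p1 Er Ez; rewrite -size_filter -/S -half -[X in (X < _)%N]add0n ltn_add2r.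
  have : uniq S by rewrite filter_uniq // undup_uniq.
  case: (S) Sx => [|x [|y s]] Sx //; first by exists x.
  have [px p'x] := Sx x (mem_head _ _); have [py p'y] : p.[y] = l /\ p^`().[y] != 0.
    by apply: Sx; rewrite !inE eqxx orbT.
  by rewrite (inj x y) //= inE eqxx.
pose NS := [seq x <- undup rs | predC (fun x => p^`().[x] != 0) x].
have uNS : uniq NS by rewrite filter_uniq // undup_uniq.
have subNS : {subset NS <= Z}.
  move=> y; rewrite !mem_filter mem_undup (mem_fibre _ p1 Er) /= negbK => /andP[p'y ->] /=.
  by rewrite -(root_splits (deriv_neq0 charK0 p1) Ez).
have permS : perm_eq (S ++ NS) (undup rs) by rewrite perm_filterC.
have sNS : size NS = size Z.
  have := perm_size permS; rewrite size_cat ES /= => s1.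
  by have := fibre_card charK0 p1 Er Ez; rewrite -s1 -half szZ -addnn; move: (size NS) (count _ _) => i j; lia.
have permNS : perm_eq NS Z.
  apply: uniq_perm => //; first by apply: leq_size_uniq uNS subNS _; rewrite sNS.
  by apply: (uniq_min_size uNS subNS _).2; rewrite sNS.
have permrs : perm_eq rs (x :: Z ++ Z).
  have := perm_roots_deriv charK0 p1 Er Ez; move/perm_trans; apply.
  rewrite -/Z -cat_cons perm_cat2r perm_sym; apply: perm_trans _ permS.
  by rewrite ES /= perm_cons perm_sym.
pose Q : {poly K} := \prod_(z <- Z) ('X - z%:P).
pose R := Q \Po (- 'X).
pose k := lead_coef p.
have lk : lead_coef (p - l%:P) = k.
  rewrite /k lead_coefDl // size_polyN (leq_ltn_trans (size_polyC_leq1 _)) //.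
  by rewrite -deg_gt0.
have Em : p - l%:P = k *: (('X - x%:P) * Q ^+ 2).
  by rewrite {1}Er lk (perm_big _ permrs) /= big_cons big_cat /= expr2.
have Ep : p + l%:P = k *: (('X + x%:P) * R ^+ 2).
  have := congr1 (fun q => q \Po (- 'X)) Em.
  rewrite /= comp_polyB comp_polyC ((inON charK0 p).1 op) comp_polyZ comp_polyM comp_polyB comp_polyC comp_polyX.
  rewrite rmorphXn /= -/R -opprD => /eqP; rewrite eqr_oppLR => /eqP ->.
  by rewrite -scalerN -mulNr opprD !opprK.
(* The sign is (-1)^(deg Q); only its square enters. *)
have [e e2 ER] : exists2 e : K, e ^+ 2 = 1 & \prod_(z <- map -%R Z) ('X - z%:P) = e *: R.
  exists ((-1) ^+ size Z); first by rewrite -exprM mulnC exprM sqrrN !expr1n.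
  by rewrite /R prod_comp_opp scalerA -expr2 -exprM mulnC exprM sqrrN !expr1n scale1r.
have Ep' : p^`() = (k *+ deg p) *: (Q * (e *: R)).
  by rewrite Ez (lead_coef_deriv charK0 p1).1 (perm_big _ (crit_double op p1 Ez l0 half)) /= big_cat /= -/Z ER.
exists x; first by apply: Sx; rewrite ES inE.
rewrite /pell Ep'; have -> : p ^+ 2 - (l ^+ 2)%:P = (p - l%:P) * (p + l%:P) by rewrite polyC_exp; ring.
rewrite Em Ep; have -> : 'X^2 - (x ^+ 2)%:P = ('X - x%:P) * ('X + x%:P) by rewrite polyC_exp; ring.
rewrite -[k *+ _]mulr_natl -!mul_polyC; have {}e2 : e%:P ^+ 2 = 1 :> {poly K} by rewrite -polyC_exp e2.
rewrite [RHS](_ : _ = e%:P ^+ 2 * ((deg p)%:R ^+ 2)%:P * (k%:P ^+ 2 * (('X - x%:P) * ('X + x%:P) * Q ^+ 2 * R ^+ 2))).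
  by rewrite e2 mul1r; ring.
by rewrite !polyC_exp !polyCM; ring.
Qed.

Lemma monomial_of_roots p (rs : seq K) : (0 < deg p)%N -> roots_of p rs ->
  (forall z, p.[z] = 0 -> z = 0) -> p = lead_coef p *: 'X^(deg p).
Proof.
move=> p1 Er z0; have p0 : p != 0 by apply: contraTneq p1 => ->; rewrite /deg size_poly0.
rewrite {1}Er; congr (_ *: _).
rewrite (eq_big_seq (fun=> 'X)) => [|z zrs]; last first.
  by rewrite (z0 z) ?subr0 //; apply/eqP; have := root_splits p0 Er z; rewrite zrs.
by rewrite big_const_seq count_predT (size_roots p1 Er); elim: (deg p) => //= n ->; rewrite exprS.
Qed.

(** The fibre over 0 contains the three points 0, z and -z, so at most deg p -
    3 of the deg p - 1 critical points lie over 0. *)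
Lemma nonzero_root_count p zs (z : K) : inO p -> (0 < deg p)%N -> roots_of p^`() zs -> splits p ->
  p.[z] = 0 -> z != 0 -> (2 <= count (fun y => p.[y] != 0%R) zs)%N.
Proof.
move=> op p1 Ez [rs Er] pz z0.
have Er0 : roots_of (p - 0%:P) rs by rewrite polyC0 subr0.
have mem := mem_fibre _ p1 Er0.
have : (3 <= size (undup rs))%N.
  apply: (@uniq_leq_size _ [:: 0; z; - z]).
    have zN : (z == - z) = false by rewrite eq_sym (oppK_eq charK0) (negPf z0).
    by rewrite /= !inE zN negb_or eq_sym z0 eq_sym oppr_eq0 z0.
  move=> y; rewrite !inE mem_undup mem => /or3P[] /eqP ->.
  - by rewrite horner_coef0 inO_coef0.
  - by rewrite pz.
  - by rewrite odd_hornerN // pz oppr0.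
have := fibre_card charK0 p1 Er0 Ez; have := size_crit charK0 p1 Ez.
have := count_predC (fun y => p.[y] == 0) zs.
have -> : count (predC (fun y => p.[y] == 0)) zs = count (fun y => p.[y] != 0) zs by apply: eq_count.
by move: (count _ _) (count _ _) (size _) (size _) => i j k n; lia.
Qed.

End Pell.

(** * The dichotomy for odd coprime swaps *)

Section Dichotomy.
Variable K : fieldType.
Hypothesis charK0 : [pchar K] =i pred0.
Implicit Types (a b c d f p q : {poly K}) (rs zs : seq K).

Local Notation roots_of p rs := (p = lead_coef p *: \prod_(z <- rs) ('X - z%:P)).

Lemma crit_comp_splits p q : (1 < deg p)%N -> (0 < deg q)%N -> critically_split (p \Po q) ->
  [/\ splits p, splits p^`() & splits q^`()].
Proof.
move=> p1 q0 [sf sf' _]; have p0 := ltnW p1.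
have f0 : (0 < deg (p \Po q))%N by rewrite deg_comp muln_gt0 p0.
have f'0 := deriv_neq0 charK0 f0.
split; first exact: splits_comp f0 sf.
  apply: (@splits_comp _ _ q); first by rewrite deg_comp muln_gt0 q0 /deg (lead_coef_deriv charK0 p0).2 -subn1 subn_gt0 p1.
  by apply: dvdp_splits f'0 _ sf'; rewrite deriv_comp dvdp_mulr.
by apply: dvdp_splits f'0 _ sf'; rewrite deriv_comp dvdp_mull.
Qed.

(** If a and c both have a nonzero root, each has at least two critical points
    over nonzero values, and the two inequalities 2 A0 <= C0 and 2 C0 <= A0
    leave only A0 = C0 = 0. Then every critical value of c is one of a with a
    single simple point above it, and conversely: this gives the Pell
    equations of a and c over a common value l. The simple point xi of a over
    l plays the role of l for b, because b ramifies over xi at least as c does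
    over l. *)
Theorem odd_swap_dichotomy a b c d : a \Po b = c \Po d ->
  inO a -> inO b -> inO c -> inO d -> (1 < deg a)%N -> (1 < deg b)%N ->
  deg a = deg d -> deg b = deg c -> coprime (deg a) (deg b) -> critically_split (a \Po b) ->
  [\/ c = lead_coef c *: 'X^(deg c), a = lead_coef a *: 'X^(deg a) |
    exists L Xa Xb Xc, [/\ [/\ L != 0, Xa != 0, Xb != 0 & Xc != 0], pell L Xa a, pell L Xc c & pell Xa Xb b]].
Proof.
move=> E oa ob oc od a1 b1 dad dbc cop crit.
have c1 : (1 < deg c)%N by rewrite -dbc.
have d1 : (1 < deg d)%N by rewrite -dad.
have [a0 b0 c0 d0] : [/\ (0 < deg a)%N, (0 < deg b)%N, (0 < deg c)%N & (0 < deg d)%N].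
  by split; apply: ltnW.
have crit' : critically_split (c \Po d) by rewrite -E.
have cop1 : coprime (deg b) (deg d) by rewrite -dad coprime_sym.
have cop2 : coprime (deg d) (deg b) by rewrite coprime_sym.
have [[ra Era] [za Ea] [zb Eb]] := crit_comp_splits a1 b0 crit.
have [[rc Erc] [zc Ec] [zd Ed]] := crit_comp_splits c1 d0 crit'.
have [nc|[z [cz z0]]] : (forall z, c.[z] = 0 -> z = 0) \/ exists z, c.[z] = 0 /\ z != 0.
- have [|nc] := classic (exists z, c.[z] = 0 /\ z != 0); first by right.
  by left=> z cz; apply/eqP/negPn/negP => z0; apply: nc; exists z.
- by apply: Or31; apply: monomial_of_roots c0 Erc nc.
have [na|[w [aw w0]]] : (forall z, a.[z] = 0 -> z = 0) \/ exists z, a.[z] = 0 /\ z != 0.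
- have [|na] := classic (exists z, a.[z] = 0 /\ z != 0); first by right.
  by left=> x ax; apply/eqP/negPn/negP => x0; apply: na; exists x.
- by apply: Or32; apply: monomial_of_roots a0 Era na.
apply: Or33.
have Nc := nonzero_root_count charK0 oc c0 Ec (ex_intro _ rc Erc) cz z0.
have Na := nonzero_root_count charK0 oa a0 Ea (ex_intro _ ra Era) aw w0.
have R1 := ramification_over_zero charK0 E cop1 dbc a1 c1 d0 crit oa Ea Eb Ec.
have R2 := ramification_over_zero charK0 (esym E) cop2 (esym dad) c1 a1 b0 crit' oc Ec Ed Ea.
have [A0 C0] : count (fun z => a.[z] == 0) za = 0%N /\ count (fun z => c.[z] == 0) zc = 0%N.
  have := leq_trans (leq_mul (leqnn _) Nc) R1; have := leq_trans (leq_mul (leqnn _) Na) R2.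
  by move: (count _ za) (count _ zc) => i j; lia.
have Ua := unramified_over_zero charK0 E cop1 dbc a1 c1 d0 crit oa Ea Eb Ec A0 C0.
have Uc := unramified_over_zero charK0 (esym E) cop2 (esym dad) c1 a1 b0 crit' oc Ec Ed Ea C0 A0.
have szc := size_crit charK0 c0 Ec.
have [y yc] : exists y, y \in zc by case: (zc) szc => [|y s]; [move=> H; rewrite -H in c1 | exists y; rewrite mem_head].
have [half_a inj_a] := Ua y yc.
have c'0 := deriv_neq0 charK0 c0.
have cy : root c^`() y by have := root_splits c'0 Ec y; rewrite yc.
have l0 : c.[y] != 0.
  apply/negP => cy0; have : has (fun z => c.[z] == 0) zc by apply/hasP; exists y.
  by rewrite has_count C0.
have [x xa ax] : exists2 x, x \in za & a.[x] = c.[y].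
  have : has (fun z => a.[z] == c.[y]) za by rewrite has_count; move: half_a a1 => <-; case: (count _ _).
  by case/hasP => x xa /eqP; exists x.
have [] := Uc x xa; rewrite ax => half_c inj_c.
have [[r1 Er1] [r2 Er2] sb] := crit_fibre_splits charK0 E a0 b0 d0 crit cy.
have [xi [axi a'xi] pa] := pell_of_double charK0 oa a0 l0 Ea Er1 half_a inj_a.
have [eta [ceta c'eta] pc] := pell_of_double charK0 oc c0 l0 Ec Er2 half_c inj_c.
have xi0 : xi != 0 by apply: contraNneq l0 => xi0; rewrite -axi xi0 horner_coef0 inO_coef0.
have eta0 : eta != 0 by apply: contraNneq l0 => eta0; rewrite -ceta eta0 horner_coef0 inO_coef0.
have [rb Erb] := sb xi axi.
(* At least half of the critical points of b lie over xi; for an odd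
   polynomial it cannot be more. *)
have rb_lb := simple_point_ramification charK0 E cop1 a0 b0 c0 d0 crit dbc Eb Ec cy axi a'xi.
have half_b : (count (fun z => b.[z] == xi) zb).*2.+1 = deg b.
  have ub := leq_trans (leq_addr _ _) (crit_count_bound charK0 ob b0 Eb xi0).
  have := size_crit charK0 b0 Eb; rewrite dbc -half_c => -[szb].
  by apply/eqP; rewrite eqSS eqn_leq -{1}szb ub leq_double rb_lb.
(* A simple point of b over xi maps under d to the only simple point eta of c
   over l, by the chain rule, and d is injective on this fibre. *)
have inj_b t1 t2 : b.[t1] = xi -> b.[t2] = xi -> b^`().[t1] != 0 -> b^`().[t2] != 0 -> t1 = t2.
  have eta_of t : b.[t] = xi -> b^`().[t] != 0 -> d.[t] = eta.
    move=> bt b't; apply: inj_c => //; first by rewrite -horner_comp -E horner_comp bt.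
    have := congr1 (fun q => q^`().[t]) E; rewrite !deriv_comp !hornerM !horner_comp bt => H.
    have : a^`().[xi] * b^`().[t] != 0 by rewrite mulf_neq0.
    by rewrite H mulf_eq0 negb_or => /andP[].
  move=> e1 e2 n1 n2; apply: (fibre_inj E b0 d0 cop1); first by rewrite e1.
    by rewrite !eta_of.
  by rewrite e1.
have [zeta [bz _] pb] := pell_of_double charK0 ob b0 xi0 Eb Erb half_b inj_b.
have zeta0 : zeta != 0 by apply: contraNneq xi0 => zeta0; rewrite -bz zeta0 horner_coef0 inO_coef0.
exists (c.[y] ^+ 2), (xi ^+ 2), (zeta ^+ 2), (eta ^+ 2).
by split=> //; split; rewrite expf_neq0.
Qed.

End Dichotomy.

(** * Swaps with a power *)

Section Powers.
Variable K : fieldType.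
Hypothesis charK0 : [pchar K] =i pred0.
Implicit Types (a b c d f p q : {poly K}) (rs zs : seq K).

Local Notation roots_of p rs := (p = lead_coef p *: \prod_(z <- rs) ('X - z%:P)).

Lemma dvdn_size (T : eqType) n (s : seq T) :
  (forall x, n %| count_mem x s)%N -> (n %| size s)%N.
Proof.
have [k] := ubnP (size s); elim: k => // k IH in s *.
case: s => [|x s] //= szs H; set s' := x :: s.
rewrite -[(size s).+1]/(size s') -(count_predC (pred1 x) s') dvdn_addr ?H //.
rewrite -size_filter IH // => [|y].
  by rewrite size_filter /= eqxx add0n (leq_ltn_trans (count_size _ _)).
rewrite count_filter; have [->|yx] := eqVneq y x.
  by rewrite (@eq_count _ _ pred0) ?count_pred0 // => z /=; case: eqP.
rewrite (@eq_count _ _ (pred1 y)); first exact: H.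
by move=> z /=; case: eqP => //= ->.
Qed.

Lemma comp_Xn_of_coef p n : (0 < n)%N -> (forall i, ~~ (n %| i)%N -> p`_i = 0) ->
  exists q, p = q \Po 'X^n.
Proof.
move=> n0 H; exists (\poly_(i < size p) p`_(n * i)).
apply/polyP => i; rewrite coef_comp_poly_Xn // coef_poly.
have [/dvdnP[k ->]|/H //] := boolP (n %| i)%N.
rewrite mulnK // mulnC; case: ltnP => // le; rewrite nth_default // (leq_trans le) // leq_pmull //.
Qed.

(** Take the first i, not divisible by n, with p_i nonzero, and truncate p
    before degree i. The truncation is a polynomial in X^n, hence so is its
    k-th power, and in degree i it differs from p^k by k p_0^(k-1) p_i. *)
Lemma coef_power_root p n k : (0 < n)%N -> (0 < k)%N -> p`_0 != 0 ->
  (forall i, ~~ (n %| i)%N -> (p ^+ k)`_i = 0) -> forall i, ~~ (n %| i)%N -> p`_i = 0.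
Proof.
move=> n0 k0 p0 Hk i; elim/ltn_ind: i => i IH ni.
have i0 : (0 < i)%N by case: i ni {IH} => //; rewrite dvdn0.
have [q Eq] : exists q, take_poly i p = q \Po 'X^n.
  apply: comp_Xn_of_coef => // j nj; rewrite coef_take_poly; case: ltnP => // ji.
  exact: IH.
have := congr1 (fun q : {poly K} => q`_i) (subrXX p (take_poly i p) k).
have -> : p - take_poly i p = drop_poly i p * 'X^i by rewrite -{1}(poly_take_drop i p) addrC addKr.
rewrite coefB Hk // Eq -rmorphXn /= coef_comp_poly_Xn // (negPf ni) subrr.
rewrite mulrAC coefMXn ltnn subnn coef0M coef_drop_poly add0n => /esym/eqP.
rewrite mulf_eq0 => /orP[/eqP //|].
rewrite coef_sum (eq_bigr (fun=> p`_0 ^+ k.-1)) => [|j _]; last first.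
  rewrite -Eq coef0M -!horner_coef0 !horner_exp !horner_coef0 coef_take_poly i0.
  by rewrite -exprD subnK // -ltnS prednK // ltn_ord.
by rewrite sumr_const card_ord -mulr_natl mulf_eq0 natrK_eq0 // (gtn_eqF k0) expf_eq0 (negPf p0) andbF.
Qed.

(** Write d = X^t q with q(0) nonzero. The power q^n is a polynomial in X^n,
    hence so is q by [coef_power_root]; it is also even, t being odd. As n is
    odd, q is a polynomial in X^(2n). *)
Lemma power_shape a d (g be : K) n : (0 < n)%N -> odd n -> g != 0 -> be != 0 -> inO d -> d != 0 ->
  a \Po (be *: 'X^n) = g *: d ^+ n ->
  exists t al, [/\ odd t, al.[0] != 0, d = 'X^t * (al \Po 'X^(2 * n)) &
    a \Po (be *: 'X) = g *: ('X^t * (al \Po 'X^2) ^+ n)].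
Proof.
move=> n0 on g0 be0 od d0 E.
have [t [q]] := multiplicity_XsubC d 0; rewrite d0 /= subr0 /root horner_coef0 => q0 Ed.
have dE i : q`_i = d`_(i + t) by rewrite Ed coefMXn ltnNge leq_addl addnK.
have ot : odd t.
  by apply: contraNT q0 => nt; rewrite dE add0n ((inOP d).1 od).
have dn i : ~~ (n %| i)%N -> (d ^+ n)`_i = 0.
  move=> ni; apply: (mulfI g0); rewrite mulr0 -coefZ -E.
  have -> : be *: 'X^n = (be *: 'X) \Po 'X^n :> {poly K} by rewrite comp_polyZ comp_polyX.
  by rewrite comp_polyA coef_comp_poly_Xn // (negPf ni).
have qn i : ~~ (n %| i)%N -> q`_i = 0.
  move: i; apply: (@coef_power_root q n n) => // j nj.
  have -> : (q ^+ n)`_j = (d ^+ n)`_(j + t * n).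
    by rewrite Ed exprMn -exprM coefMXn ltnNge leq_addl addnK.
  by apply: dn; rewrite dvdn_addl // dvdn_mull.
have q2n i : ~~ (2 * n %| i)%N -> q`_i = 0.
  rewrite Gauss_dvd ?coprime2n // negb_and => /orP[|/qn //].
  by rewrite dvdn2 negbK dE => oi; apply: (inOP d).1 => //; rewrite oddD oi ot.
have [al Eal] : exists al, q = al \Po 'X^(2 * n) by apply: comp_Xn_of_coef q2n; rewrite muln_gt0.
exists t, al; split=> //.
- by rewrite horner_coef0; move: q0; rewrite Eal coef_comp_poly_Xn ?muln_gt0 // dvdn0 div0n.
- by rewrite Ed Eal mulrC.
apply: (@compfI _ 'X^n); first by rewrite /deg size_polyXn.
rewrite /=; transitivity (g *: d ^+ n); first by rewrite -E -comp_polyA comp_polyZ comp_polyX.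
rewrite comp_polyZ comp_polyM comp_Xn_poly [(_ ^+ n) \Po _]rmorphXn /= -comp_polyA comp_Xn_poly.
by rewrite Ed Eal exprMn -!exprM mulrC [(t * n)%N]mulnC [(2 * n)%N]mulnC.
Qed.

Lemma irreducible_monomial p (k : K) n : irreducibleO p -> p = k *: 'X^n -> prime n /\ odd n.
Proof.
move=> irr E; have [op p1 _] := irr.
have k0 : k != 0 by apply: contraTneq p1 => k0; rewrite E k0 scale0r /deg size_poly0.
have dn : deg p = n by rewrite E deg_scale // /deg size_polyXn.
split; last by rewrite -dn; apply: inO_odd_deg => //; apply: ltnW.
rewrite dn in p1.
have Ep : p = (k *: 'X^(n %/ pdiv n)) \Po 'X^(pdiv n).
  by rewrite E comp_polyZ comp_Xn_poly -exprM mulnC divnK // pdiv_dvd.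
case: (irreducibleO_deg charK0 irr Ep); rewrite ?deg_scale // /deg size_polyXn /=.
  by move=> n1; rewrite -(divnK (pdiv_dvd n)) n1 mul1n pdiv_prime.
by move=> n1; have := pdiv_prime p1; rewrite n1.
Qed.

(** Since n does not divide deg a, some root x of a has a multiplicity k prime
    to n. Multiplicities in a o b = g d^n are multiples of n, and that of a
    point t over x is k times its multiplicity in b - x. So n divides the
    latter, and b - x is a multiple of (X - t)^n. Finally b' is even, so its
    only root t is 0. *)
Lemma inner_monomial_split a b d (g : K) n : a \Po b = g *: d ^+ n -> inO b ->
  prime n -> (0 < deg a)%N -> deg b = n -> coprime (deg a) n -> splits (a \Po b) ->
  b = lead_coef b *: 'X^n.
Proof.
move=> E ob pn a0 dbn cop sf; have n0 := prime_gt0 pn; have n1 := prime_gt1 pn.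
have b0 : (0 < deg b)%N by rewrite dbn.
have f0 : (0 < deg (a \Po b))%N by rewrite deg_comp muln_gt0 a0.
have fn0 : a \Po b != 0 by apply: contraTneq f0 => ->; rewrite /deg size_poly0.
have an0 : a != 0 by apply: contraTneq a0 => ->; rewrite /deg size_poly0.
have [g0 d0] : g != 0 /\ d != 0.
  move: fn0; rewrite E scale_poly_eq0 negb_or expf_eq0 n0 /=; exact/andP.
have [rs Er] := splits_comp f0 sf.
have [x nx] : exists x, ~~ (n %| count_mem x rs)%N.
  apply: NNPP => none; have : (n %| size rs)%N.
    by apply: dvdn_size => x; apply/negPn/negP => nx; apply: none; exists x.
  rewrite (size_roots a0 Er) => na; move: cop; rewrite coprime_sym prime_coprime //.
  by rewrite na.
have mx : mup x a = count_mem x rs by apply: mup_roots.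
have [k [q]] := multiplicity_XsubC a x; rewrite an0 /= => qx Ea.
have X0 : ('X - x%:P) ^+ k != 0 by rewrite expf_neq0 // polyXsubC_eq0.
have kx : k = count_mem x rs.
  by rewrite -mx Ea mupMr // mup_XsubCX eqxx.
have bx0 : b - x%:P != 0 by apply: subC_neq0.
have Eb : a \Po b = (q \Po b) * (b - x%:P) ^+ k.
  by rewrite {1}Ea comp_polyM rmorphXn /= comp_polyB comp_polyX comp_polyC.
have k0 : (0 < k)%N by rewrite kx; case: (count_mem x rs) nx => //; rewrite dvdn0.
have [rb Erb] : splits (b - x%:P).
  by apply: dvdp_splits fn0 _ sf; rewrite Eb -(prednK k0) exprS mulrCA dvdp_mulr.
have bx1 : (0 < deg (b - x%:P))%N by rewrite deg_subC.
have [t rt] : exists t, root (b - x%:P) t.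
  by apply: splits_root; [exists rb | rewrite -deg_gt0].
have mupX p j : p != 0 -> mup t (p ^+ j) = (j * mup t p)%N.
  move=> p0; elim: j => [|j IH]; first by rewrite expr0 mupNroot // root1.
  by rewrite exprS mupM ?expf_neq0 // IH mulSn.
have bt : b.[t] = x by move: rt; rewrite /root !hornerE subr_eq0 => /eqP.
have nb : (n %| mup t (b - x%:P))%N.
  have : (n %| k * mup t (b - x%:P))%N.
    have : mup t (a \Po b) = (n * mup t d)%N by rewrite E mup_scale // mupX.
    rewrite Eb mupMr ?mupX // => [->|]; first exact: dvdn_mulr.
    by rewrite /root horner_comp bt.
  by rewrite Gauss_dvdr // prime_coprime // kx.
have full_t : (n <= mup t (b - x%:P))%N.
  by apply: dvdn_leq nb; rewrite mup_geq // expr1 dvdp_XsubCl.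
have {nb full_t} Eb' : b - x%:P = lead_coef b *: ('X - t%:P) ^+ n.
  have szt : size (('X - t%:P) ^+ n) = size (b - x%:P).
    by rewrite size_exp_XsubC size_deg // deg_subC // dbn.
  move: full_t; rewrite mup_geq // => /dvdp_size_eqp; rewrite szt eqxx eqp_sym => /esym e.
  rewrite {1}(eqpfP e) (monicP (monic_exp _ (monicXsubC _))) divr1.
  by rewrite lead_coefDl // size_polyN (leq_ltn_trans (size_polyC_leq1 _)) // -deg_gt0.
have lb0 : lead_coef b != 0 by rewrite lead_neq0 // -deg_gt0.
have t0 : t = 0.
  have Ed : b^`() = lead_coef b *: (('X - t%:P) ^+ n.-1 *+ n).
    by rewrite -[LHS]subr0 -(derivC x) -derivB Eb' derivZ deriv_exp derivXsubC mul1r.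
  have := congr1 (fun q : {poly K} => q.[t]) (deriv_comp_opp charK0 ob).
  rewrite horner_comp hornerN hornerX Ed !hornerZ !hornerMn !horner_exp !hornerXsubC subrr.
  have n10 : (n.-1 == 0)%N = false by case: (n) n1 => [|[]].
  rewrite expr0n n10 mul0rn mulr0 => /eqP; rewrite mulf_eq0 (negPf lb0) /= -mulr_natl mulf_eq0.
  rewrite natrK_eq0 // (gtn_eqF n0) expf_eq0 => /andP[_].
  rewrite -opprD oppr_eq0 -mulr2n -mulr_natl mulf_eq0 natrK_eq0 //= => /eqP //.
have x0 : x = 0 by rewrite -bt t0 horner_coef0 inO_coef0.
by rewrite -[LHS]subr0 -polyC0 -{1}x0 Eb' t0 polyC0 subr0.
Qed.

End Powers.

Section PowerOption.
Variable K : fieldType.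
Hypothesis charK0 : [pchar K] =i pred0.
Implicit Types (a b c d f p q : {poly K}).

(** The power case up to units; a constant alpha degenerates to the
    commutation of two monomials. *)
Lemma power_swap (P P' : {poly K} * {poly K}) (g be : K) n : coprime_swap P P' ->
  P'.1 = g *: 'X^n -> P.2 = be *: 'X^n -> power_option P P' \/ monomial_option P P'.
Proof.
case: P P' => a b [c d] /= [[irra irrb irrc irrd] E cop dad dbc] Ec Eb.
rewrite /= in irra irrb irrc irrd E cop dad dbc *.
have [pn on] := irreducible_monomial charK0 irrc Ec.
have n0 := prime_gt0 pn.
have [_ c1 _] := irrc; have [od d1 _] := irrd; have [_ b1 _] := irrb.
have g0 : g != 0 by apply: contraTneq c1 => g0; rewrite Ec g0 scale0r /deg size_poly0.
have be0 : be != 0 by apply: contraTneq b1 => be0; rewrite Eb be0 scale0r /deg size_poly0.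
have d0 : d != 0 by apply: contraTneq d1 => ->; rewrite /deg size_poly0.
have dn : deg b = n by rewrite Eb deg_scale // /deg size_polyXn.
have Es : a \Po (be *: 'X^n) = g *: d ^+ n by rewrite -Eb E Ec comp_polyZ comp_Xn_poly.
have [t [al [ot al0 Ed Ea]]] := power_shape charK0 n0 on g0 be0 od d0 Es.
have {}Ea : a = (g *: 'X) \Po (('X^t * (al \Po 'X^2) ^+ n) \Po (be^-1 *: 'X)).
  rewrite comp_polyZ comp_polyX -comp_polyZ -Ea -comp_polyA scaleXV // comp_polyXr //.
have scX (k : K) p : (k *: 'X) \Po p = k *: p by rewrite comp_polyZ comp_polyX.
have [al1|al1] := ltnP 1 (size al).
  left; exists n, t, al; split=> //.
  exists g, 1, be^-1, 1; split; first by rewrite oner_neq0 invr_eq0.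
  by split; rewrite /= ?scale1r ?invr1 ?comp_polyXr ?invrK ?scX ?scale1r ?comp_polyXr // Ea scX.
right; have [al00 Eal] : al`_0 != 0 /\ al = (al`_0)%:P.
  by split; [rewrite -horner_coef0 | exact: size1_polyC].
rewrite Eal !comp_polyC in Ed Ea; move: (al`_0) al00 Ed Ea => k k0 Ed Ea.
have {}Ed : d = k *: 'X^t by rewrite Ed mulrC mul_polyC.
have {}Ea : a = (g * k ^+ n) *: ('X^t \Po (be^-1 *: 'X)).
  by rewrite Ea scX -polyC_exp mulrC mul_polyC comp_polyZ scalerA.
have [pt _] := irreducible_monomial charK0 irrd Ed.
have dt : deg d = t by rewrite Ed deg_scale // /deg size_polyXn.
have tn : t <> n.
  move=> tn; move: cop; rewrite dad dt dn tn /coprime gcdnn => /eqP n1.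
  by rewrite n1 in pn.
exists t, n; split=> //; exists (g * k ^+ n), 1, be^-1, k^-1; split.
  by rewrite mulf_neq0 ?expf_neq0 // oner_neq0 !invr_eq0.
split; rewrite /= ?scale1r ?invrK ?comp_polyXr ?scX //.
rewrite comp_Xn_poly exprZn scalerA exprVn mulfK ?expf_neq0 //.
Qed.

End PowerOption.

(** * The differential equation of Chebyshev polynomials *)

Section PellEquation.
Variable K : fieldType.
Hypothesis charK0 : [pchar K] =i pred0.
Implicit Types (a b c d f p q : {poly K}).

(** The differential equation of the Chebyshev polynomials, for the variable
    scaled by a square root of X. *)
Definition chebyshev_ode (n : nat) (X : K) p :=
  (n%:R ^+ 2) *: p = 'X * p^`() + ('X^2 - X%:P) * p^`()^`().

(** The derivative of the Pell equation is divisible by 2 p'. *)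
Lemma pell_ode (L X : K) p : (0 < deg p)%N -> pell L X p -> chebyshev_ode (deg p) X p.
Proof.
move=> p1; rewrite /pell /chebyshev_ode => E.
have p'0 := deriv_neq0 charK0 p1.
have := congr1 (fun q => q^`()) E.
rewrite /= !expr2 !(derivZ, derivM, derivB, derivC, derivX) -!mul_polyC => E'.
have two : 2%:R * p^`() != 0.
  by rewrite mulf_neq0 // -polyC_natr polyC_eq0 natrK_eq0.
apply: (mulfI two).
transitivity (((deg p)%:R * (deg p)%:R)%:P * (p^`() * p + p * p^`() - 0)); first by ring.
by rewrite E'; ring.
Qed.

(** Each coefficient is determined by the one two degrees above, except in
    degree n, where the left-hand factor vanishes. *)
Lemma coef_chebyshev_ode n (X : K) p k : chebyshev_ode n X p ->
  (n%:R ^+ 2 - k%:R ^+ 2) * p`_k = - X * (k.+2%:R * k.+1%:R * p`_k.+2).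
Proof.
have c3 j : p^`()^`()`_j = j.+2%:R * j.+1%:R * p`_j.+2.
  by rewrite !coef_deriv -mulrnA -[p`_j.+2 *+ _]mulr_natl natrM.
have c1 : ('X * p^`())`_k = k%:R * p`_k.
  by rewrite coefXM; case: k => [|k] /=; rewrite ?mul0r // coef_deriv -[_ *+ _]mulr_natl.
have c2 : ('X^2 * p^`()^`())`_k = (k%:R ^+ 2 - k%:R) * p`_k.
  rewrite coefXnM; case: k {c1} => [|[|k]] /=; rewrite ?expr0n ?expr1n ?subrr ?mul0r //.
  by rewrite -[k.+2]addn2 addnK c3 addn2 -[k.+2%:R]natr1; ring.
move=> /(congr1 (fun q : {poly K} => q`_k)).
rewrite coefZ coefD c1 mulrBl coefB c2 mul_polyC coefZ c3 => E.
by rewrite mulrBl E; ring.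
Qed.

Lemma chebyshev_ode_eq0 n (X : K) p : chebyshev_ode n X p -> (deg p < n)%N -> p = 0.
Proof.
move=> E lt; apply/eqP/negPn/negP => p0; have := coef_chebyshev_ode (deg p) E.
rewrite [p`_(deg p).+2]nth_default; last by rewrite /deg; case: (size p) => // s; apply: leqW.
rewrite !mulr0 /deg -lead_coefE -/(deg p) => /eqP; rewrite mulf_eq0 lead_coef_eq0 (negPf p0) orbF.
by rewrite subr_eq0 -!natrX -subr_eq0 -natrB ?leq_sqr ?(ltnW lt) // natrK_eq0 // subn_eq0 leqNgt ltn_sqr lt.
Qed.

Lemma chebyshev_odeB n (X : K) p q (k : K) : chebyshev_ode n X p -> chebyshev_ode n X q -> chebyshev_ode n X (p - k *: q).
Proof.
rewrite /chebyshev_ode => Ep Eq; rewrite !(derivB, derivZ); move: Ep Eq; rewrite -!mul_polyC => Ep Eq.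
transitivity ((n%:R ^+ 2)%:P * p - k%:P * ((n%:R ^+ 2)%:P * q)); first by ring.
by rewrite Ep Eq; ring.
Qed.

(** A suitable multiple of q cancels the leading term of p, and the equation
    has no nonzero solution of degree less than n. *)
Lemma chebyshev_ode_uniq n (X : K) p q : (0 < n)%N -> deg p = n -> deg q = n ->
  chebyshev_ode n X p -> chebyshev_ode n X q -> p = (lead_coef p / lead_coef q) *: q.
Proof.
move=> n0 dp dq Ep Eq; apply/eqP; rewrite -subr_eq0; apply/eqP.
apply: (chebyshev_ode_eq0 (chebyshev_odeB _ Ep Eq)).
have lq : lead_coef q != 0 by rewrite lead_neq0 // -deg_gt0 dq.
have lp : lead_coef p != 0 by rewrite lead_neq0 // -deg_gt0 dp.
have k0 : lead_coef p / lead_coef q != 0 by rewrite mulf_neq0 ?invr_eq0.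
have le : (size (p - (lead_coef p / lead_coef q) *: q)%R <= n)%N.
  apply/leq_sizeP => j; rewrite leq_eqVlt coefB coefZ => /orP[/eqP<-|nj].
    by rewrite -{1}dp -dq /deg -!lead_coefE divfK // subrr.
  by rewrite !nth_default ?mulr0 ?subrr // size_deg ?dp ?dq.
by move: le; rewrite /deg; move: (size _) => s; lia.
Qed.

End PellEquation.

(** * Twisted Chebyshev polynomials *)

Section ChebyshevPell.
Variable K : fieldType.
Hypothesis charK0 : [pchar K] =i pred0.
Implicit Types (a b c d f p q : {poly K}).

Local Notation T n := (chebyshev K n).
Local Notation tau := (@chebyshev_twist K).

Lemma chebyshev_recE n : T n.+2 = 2%:R * 'X * T n.+1 - T n.
Proof. by rewrite chebyshevSS -mul_polyC polyC_natr mulrA. Qed.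

Lemma deriv_chebyshev n : ('X^2 - 1) * (T n)^`() = n%:R * (T n.+1 - 'X * T n).
Proof.
suff [] : ('X^2 - 1) * (T n)^`() = n%:R * (T n.+1 - 'X * T n) /\
  ('X^2 - 1) * (T n.+1)^`() = n.+1%:R * (T n.+2 - 'X * T n.+1) by [].
elim: n => [|n [IH1 IH2]].
  rewrite chebyshev_recE /= derivX mulr1 -[1]polyC1 derivC; split; rewrite ?polyC1; ring.
split=> //; rewrite [T n.+3]chebyshev_recE [in LHS]chebyshev_recE.
rewrite derivB !derivM derivX -polyC_natr derivC polyC_natr mul0r add0r mulr1.
rewrite mulrBr mulrDr IH1 [_ * (2%:R * 'X * _)]mulrCA IH2 chebyshev_recE.
by rewrite -[n.+2%:R]natr1 -[n.+1%:R]natr1; ring.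
Qed.

(** The left-hand side is a quadratic form preserved by the recurrence; in
    trigonometric terms it equals the square of sin t. *)
Lemma chebyshev_invariant n : T n.+1 ^+ 2 - 2%:R * 'X * T n * T n.+1 + T n ^+ 2 = 1 - 'X^2.
Proof.
elim: n => [|n IH]; first by rewrite /=; ring.
by rewrite -IH chebyshev_recE; ring.
Qed.

(** The derivative formula and the invariant together, after cancellation of
    X^2 - 1. *)
Lemma chebyshev_pell n : ('X^2 - 1) * (T n)^`() ^+ 2 = n%:R ^+ 2 * (T n ^+ 2 - 1).
Proof.
have X0 : 'X^2 - 1 != 0 :> {poly K} by rewrite -size_poly_gt0 size_XnsubC.
have sq : (T n.+1 - 'X * T n) ^+ 2 = ('X^2 - 1) * (T n ^+ 2 - 1).
  transitivity ((T n.+1 ^+ 2 - 2%:R * 'X * T n * T n.+1 + T n ^+ 2) + ('X^2 - 1) * T n ^+ 2).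
    by ring.
  by rewrite chebyshev_invariant; ring.
apply: (mulfI X0); transitivity ((('X^2 - 1) * (T n)^`()) ^+ 2); first by ring.
by rewrite deriv_chebyshev exprMn sq; ring.
Qed.

Lemma size_chebyshev n : size (T n) = n.+1.
Proof.
suff [] : size (T n) = n.+1 /\ size (T n.+1) = n.+2 by [].
elim: n => [|n [IH1 IH2]]; first by rewrite /= size_poly1 size_polyX.
split=> //; rewrite chebyshev_recE size_polyDl.
  rewrite -mulrA -polyC_natr mul_polyC size_scale ?natrK_eq0 // mulrC size_mulX ?IH2 //.
  by rewrite -size_poly_gt0 IH2.
rewrite size_polyN -mulrA -polyC_natr mul_polyC size_scale ?natrK_eq0 // mulrC size_mulX ?IH2 ?IH1 //.
by rewrite -size_poly_gt0 IH2.
Qed.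

Lemma twist_odd (k : K) n : inO (tau k n).
Proof.
apply/(inON charK0); rewrite /chebyshev_twist comp_polyM comp_polyX -comp_polyA.
by rewrite comp_polyZ comp_Xn_poly sqrrN mulrN.
Qed.

Lemma deg_twist (k : K) n : k != 0 -> odd n -> deg (tau k n) = n.
Proof.
move=> k0 on; have szT := size_chebyshev n.
set o := odd_poly (T n); have To : T n = (o \Po 'X^2) * 'X := chebyshev_oddE K on.
have o0 : o != 0.
  by apply: contraTneq isT => o0; move: szT; rewrite To o0 comp_poly0 mul0r size_poly0.
have szC q : (0 < deg q)%N -> size ((o \Po q) * 'X) = (deg o * deg q).+2.
  move=> q0; have oq0 : o \Po q != 0 by rewrite comp_poly_eq0 // -deg_gt0.
  rewrite size_mulX // -deg_comp /deg prednK // size_poly_gt0 //.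
have dX2 : deg ('X^2 : {poly K}) = 2%N by rewrite /deg size_polyXn.
rewrite /deg /chebyshev_twist szC ?deg_scale ?dX2 //=.
by move: szT; rewrite To szC dX2 // => -[].
Qed.

(** The Pell equation of T_n is one between polynomials in y = X^2, namely (y
    - 1) e(y)^2 = n^2 (y o(y)^2 - 1) with T_n = o(X^2) X and T_n' = e(X^2).
    Now substitute y = k X^2. *)
Lemma twist_pell (k : K) n : k != 0 -> odd n -> pell k^-1 k^-1 (tau k n).
Proof.
move=> k0 on; rewrite /pell deg_twist //.
set o := odd_poly (T n); have To : T n = (o \Po 'X^2) * 'X := chebyshev_oddE K on.
pose e := o + 2%:R * 'X * o^`().
have dX2 : deg ('X^2 : {poly K}) = 2%N by rewrite /deg size_polyXn.
have T' : (T n)^`() = e \Po 'X^2.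
  rewrite To derivM deriv_comp derivX mulr1 derivXn /e comp_polyD !comp_polyM comp_polyX.
  by rewrite -polyC_natr comp_polyC polyC_natr -mulr_natl expr1; ring.
have compL q : (('X - 1) * e ^+ 2) \Po q = (q - 1) * (e \Po q) ^+ 2.
  by rewrite rmorphM rmorphB rmorphXn rmorph1 /= comp_polyX.
have compR q : (n%:R ^+ 2 * ('X * o ^+ 2 - 1)) \Po q = n%:R ^+ 2 * (q * (o \Po q) ^+ 2 - 1).
  rewrite [LHS]comp_polyM [(n%:R ^+ 2) \Po _]rmorphXn /= [n%:R \Po _]rmorph_nat comp_polyB.
  by rewrite [('X * _) \Po _]comp_polyM comp_polyX [(o ^+ 2) \Po _]rmorphXn /= [1 \Po _]rmorph1.
have base : ('X - 1) * e ^+ 2 = n%:R ^+ 2 * ('X * o ^+ 2 - 1).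
  apply: (@compfI _ 'X^2); rewrite ?dX2 //= compL compR -T' chebyshev_pell To.
  by ring.
have t' : (tau k n)^`() = e \Po (k *: 'X^2).
  rewrite /chebyshev_twist derivM deriv_comp derivX mulr1 derivZ derivXn /e comp_polyD !comp_polyM comp_polyX.
  by rewrite -polyC_natr comp_polyC polyC_natr -!mul_polyC -[_ *+ 2]mulr_natl expr1; ring.
have := congr1 (fun q => q \Po (k *: 'X^2)) base.
rewrite /= compL compR -t' /chebyshev_twist -/o; set O := o \Po _; set O' := deriv _ => E.
have kk : k%:P * k^-1%:P = 1 :> {poly K} by rewrite -polyCM mulfV.
have k0' : k%:P != 0 by rewrite polyC_eq0.
apply: (mulfI k0'); rewrite -!mul_polyC in E *.
transitivity ((n%:R ^+ 2)%:P * (k%:P * 'X^2 * O ^+ 2 - k%:P * k^-1%:P)); first by ring.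
rewrite kk polyC_exp polyC_natr -E -[X in (_ - X) * _]kk.
by ring.
Qed.

(** Pell equations compose when the constants match in the middle, by the
    chain rule. *)
Lemma pell_comp (L Y X : K) p q : pell L Y p -> pell Y X q -> pell L X (p \Po q).
Proof.
rewrite /pell => Ep Eq; rewrite deriv_comp deg_comp.
have := congr1 (fun r => r \Po q) Ep.
rewrite /= comp_polyZ comp_polyM !comp_polyB !comp_polyC comp_Xn_poly.
rewrite [(p ^+ 2) \Po _]rmorphXn [(p^`() ^+ 2) \Po _]rmorphXn /= => Ep'.
rewrite natrM exprMn [X in X *: _]mulrC -scalerA Ep' scalerAl Eq.
by ring.
Qed.

Lemma pell_scale (L X k : K) p : k != 0 -> pell L X p -> pell (k ^+ 2 * L) X (k *: p).
Proof.
move=> k0; rewrite /pell deg_scale // derivZ => E.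
have -> : (k *: p) ^+ 2 - (k ^+ 2 * L)%:P = k ^+ 2 *: (p ^+ 2 - L%:P).
  by rewrite exprZn scalerBr polyCM -[_ *: L%:P]mul_polyC.
by rewrite scalerA mulrC -scalerA E exprZn scalerAr.
Qed.

Lemma pell_uniq (L L' X : K) p : (0 < deg p)%N -> pell L X p -> pell L' X p -> L = L'.
Proof.
rewrite /pell => p1 <- E; have n0 : (deg p)%:R ^+ 2 != 0 :> K.
  by rewrite expf_neq0 // natrK_eq0 // -lt0n.
by move/(scalerI n0)/addrI/oppr_inj/polyC_inj: E => ->.
Qed.

Lemma horner_pell (L X x : K) p : pell L X p ->
  (deg p)%:R ^+ 2 * (p.[x] ^+ 2 - L) = (x ^+ 2 - X) * p^`().[x] ^+ 2.
Proof.
move/(congr1 (fun q => q.[x])).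
by rewrite /= !hornerE.
Qed.

(** Both p and the twist for X^-1 solve the same linear differential equation. *)
Lemma pell_twist_eq (L X : K) p : X != 0 -> inO p -> (0 < deg p)%N -> pell L X p ->
  exists u : K, [/\ u != 0, p = u *: tau X^-1 (deg p) & L = u ^+ 2 * X].
Proof.
move=> X0 op p1 pl; have on := inO_odd_deg op p1.
have X0' : X^-1 != 0 by rewrite invr_eq0.
have dt := deg_twist X0' on.
have pt := twist_pell X0' on; rewrite invrK in pt.
have t1 : (0 < deg (tau X^-1 (deg p)))%N by rewrite dt.
have odt := pell_ode charK0 t1 pt; rewrite dt in odt.
have E := chebyshev_ode_uniq charK0 p1 erefl dt (pell_ode charK0 p1 pl) odt.
set u := _ / _ in E.
have u0 : u != 0 by rewrite mulf_neq0 ?invr_eq0 // lead_neq0 // -deg_gt0.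
exists u; split=> //; apply: pell_uniq p1 pl _.
by rewrite E; apply: pell_scale.
Qed.

Lemma twist_scale (k w : K) n : tau k n \Po (w *: 'X) = w *: tau (k * w ^+ 2) n.
Proof.
rewrite /chebyshev_twist comp_polyM comp_polyX -scalerAr -comp_polyA; congr (_ *: ((_ \Po _) * _)).
by rewrite comp_polyZ comp_Xn_poly exprZn scalerA.
Qed.

(** The Pell equation at 0 gives the square of this coefficient as n^2. *)
Lemma twist_linear_coef (k : K) n : k != 0 -> odd n -> (tau k n)^`().[0] != 0.
Proof.
move=> k0 on; have := horner_pell 0 (twist_pell k0 on).
rewrite deg_twist // [(tau k n).[0]]horner_coef0 (inO_coef0 (twist_odd k n)) expr0n /= !sub0r mulrN mulNr.
move/oppr_inj => E; apply: contraTneq isT => t0; move: E; rewrite t0 expr0n mulr0 => /eqP.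
by rewrite mulf_eq0 invr_eq0 (negPf k0) orbF expf_eq0 natrK_eq0 //=; case: n on {t0}.
Qed.

(** The composite solves the Pell equation of the twist of index m n. *)
Lemma twist_comp (k : K) m n : k != 0 -> odd m -> odd n ->
  exists2 e : K, e != 0 & tau k m \Po tau k n = e *: tau k (m * n).
Proof.
move=> k0 om on; have p := pell_comp (twist_pell k0 om) (twist_pell k0 on).
have oc : inO (tau k m \Po tau k n) by apply: inO_comp => //; apply: twist_odd.
have m0 : (0 < m)%N by case: m om {p oc}. have n0 : (0 < n)%N by case: n on {p oc}.
have dc : deg (tau k m \Po tau k n) = (m * n)%N by rewrite deg_comp !deg_twist.
have [||e [e0 E _]] := pell_twist_eq _ oc _ p; first by rewrite invr_eq0.
  by rewrite dc muln_gt0 m0.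
by exists e => //; rewrite E dc invrK.
Qed.

(** Both composites are proportional to the twist of index m n; their linear
    coefficients agree, being the product of those of the factors. *)
Lemma twist_commute (k : K) m n : k != 0 -> odd m -> odd n ->
  tau k m \Po tau k n = tau k n \Po tau k m.
Proof.
move=> k0 om on; have [e e0 E] := twist_comp k0 om on; have [e' e'0 E'] := twist_comp k0 on om.
rewrite mulnC in E'.
have d0 : (tau k m \Po tau k n)^`().[0] = (tau k n \Po tau k m)^`().[0].
  rewrite !deriv_comp !hornerM !horner_comp ![(tau _ _).[0]]horner_coef0.
  by rewrite !(inO_coef0 (twist_odd k _)) mulrC.
rewrite E E'; congr (_ *: _); move: d0; rewrite E E' !derivZ !hornerZ; apply: mulIf.
by apply: twist_linear_coef; rewrite // oddM om.
Qed.

(** Right factors of equal degree are proportional here, and the linear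
    coefficient of the twist forces the factor 1. *)
Lemma twist_cancel (k : K) n p q : k != 0 -> odd n -> inO p -> inO q -> (0 < deg p)%N -> deg p = deg q ->
  tau k n \Po p = tau k n \Po q -> p = q.
Proof.
move=> k0 on op oq p1 dpq E.
have n0 : (0 < n)%N by case: n on {E}.
have f1 : (0 < deg (tau k n \Po p))%N by rewrite deg_comp deg_twist // muln_gt0 n0.
have [e e0 [l Eq]] := same_deg_right_factors charK0 f1 erefl E dpq.
have l0 : l = 0.
  by have := congr1 (fun p : {poly K} => p`_0) Eq; rewrite coefD coefZ coefC !inO_coef0 // mulr0 add0r.
rewrite l0 addr0 in Eq.
have Et : tau k n \Po (e *: 'X) = tau k n.
  by apply: (compfI p1); rewrite /= -comp_polyA comp_polyZ comp_polyX -Eq E.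
have := congr1 (fun q => q^`().[0]) Et.
rewrite /= deriv_comp hornerM horner_comp hornerZ hornerX mulr0 derivZ derivX hornerZ hornerC mulr1.
rewrite -[RHS]mulr1 => /(mulfI (twist_linear_coef k0 on)) e1.
by rewrite Eq e1 scale1r.
Qed.

(** A factorisation of n yields one of the twist of index n. *)
Lemma twist_prime (k : K) n u w p : k != 0 -> u != 0 -> w != 0 -> odd n -> irreducibleO p ->
  p = u *: (tau k n \Po (w *: 'X)) -> prime n.
Proof.
move=> k0 u0 w0 on irr E; have [_ p1 _] := irr.
have dp : deg p = n by rewrite E deg_scale // deg_comp deg_twist // deg_scaleX // muln1.
rewrite dp in p1; have pd := divnK (pdiv_dvd n).
have [o1 o2] : odd (n %/ pdiv n) /\ odd (pdiv n) by apply/andP; rewrite -oddM pd.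
have [e e0 Ec] := twist_comp k0 o1 o2; rewrite pd in Ec.
have Ep : p = ((u / e) *: tau k (n %/ pdiv n)) \Po (tau k (pdiv n) \Po (w *: 'X)).
  by rewrite comp_polyZ comp_polyA Ec comp_polyZ scalerA divfK.
have ue0 : u / e != 0 by rewrite mulf_neq0 ?invr_eq0.
case: (irreducibleO_deg charK0 irr Ep); rewrite ?deg_scale ?deg_comp ?deg_scaleX // deg_twist ?muln1 //.
  by move=> n1; rewrite -pd n1 mul1n pdiv_prime.
by move=> n1; have := pdiv_prime p1; rewrite n1.
Qed.

End ChebyshevPell.

(** * Descent and Ritt's second theorem for odd polynomials *)

Section Descent.
Variables (K L : fieldType) (iota : {rmorphism K -> L}).
Hypothesis charK0 : [pchar K] =i pred0.
Implicit Types (a b c d f p q : {poly K}).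

Local Notation "p ^i" := (map_poly iota p) (at level 2, format "p ^i").

Lemma pchar_extension : [pchar L] =i pred0.
Proof. by move=> x; rewrite (fmorph_pchar iota) charK0. Qed.

Lemma deg_map p : deg p^i = deg p.
Proof. by rewrite /deg size_map_poly. Qed.

Lemma inO_map p : inO p -> inO p^i.
Proof. by rewrite !inOP => op i ni; rewrite coef_map /= op // rmorph0. Qed.

Lemma monomial_descent p n : p^i = lead_coef p^i *: 'X^n -> p = lead_coef p *: 'X^n.
Proof. by move=> E; apply: (map_poly_inj iota); rewrite E map_polyZ map_polyXn lead_coef_map. Qed.

(** Both constants are rational expressions in coefficients of p: x by
    comparison of the coefficients of degree deg p - 2 in the differential
    equation, l by evaluation of the Pell equation at 0. *)
Lemma pell_descent (l x : L) p : (1 < deg p)%N -> pell l x p^i ->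
  exists l0 x0, [/\ iota l0 = l, iota x0 = x & pell l0 x0 p].
Proof.
move=> p2 pl; have p1 := ltnW p2; have charL := pchar_extension.
have p1' : (0 < deg p^i)%N by rewrite deg_map.
have lp : p`_(deg p) != 0 by rewrite /deg -lead_coefE lead_neq0 // -deg_gt0.
have [k Ek] : exists k, deg p = k.+2 by case: (deg p) p2 => [|[|k]] // _; exists k.
pose x0 := - ((k.+2%:R ^+ 2 - k%:R ^+ 2) * p`_k) / (k.+2%:R * k.+1%:R * p`_k.+2).
have nz : k.+2%:R * k.+1%:R * p`_k.+2 != 0 by rewrite !mulf_neq0 ?natrK_eq0 // -Ek.
have Ex : iota x0 = x.
  have := coef_chebyshev_ode k (pell_ode charL p1' pl); rewrite deg_map Ek !coef_map /= => E.
  rewrite /x0 fmorph_div rmorphN !rmorphM rmorphB !rmorphXn !rmorph_nat /= E -mulNr opprK mulfK //.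
  by move: nz; rewrite -(fmorph_eq0 iota) !rmorphM !rmorph_nat.
clearbody x0; have n0 : (deg p)%:R ^+ 2 != 0 :> K by rewrite expf_neq0 // natrK_eq0 // -lt0n.
pose l0 := p.[0] ^+ 2 + x0 * p^`().[0] ^+ 2 / (deg p)%:R ^+ 2.
have El0 : (deg p)%:R ^+ 2 * l0 = (deg p)%:R ^+ 2 * p.[0] ^+ 2 + x0 * p^`().[0] ^+ 2.
  by rewrite /l0 mulrDr; congr (_ + _); rewrite mulrC divfK.
have El : iota l0 = l.
  have := horner_pell (iota 0) pl; rewrite deg_map deriv_map !horner_map /= rmorph0 -Ex => E.
  apply: (mulfI (_ : (deg p)%:R ^+ 2 != 0 :> L)); first by rewrite expf_neq0 // natrK_eq0 // -lt0n.
  have := congr1 iota El0; rewrite !(rmorphM, rmorphD, rmorphXn, rmorph_nat) /= => ->.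
  transitivity ((deg p)%:R ^+ 2 * iota p.[0] ^+ 2 - (deg p)%:R ^+ 2 * (iota p.[0] ^+ 2 - l)).
    by rewrite E; ring.
  by ring.
exists l0, x0; split=> //; rewrite /pell; apply: (map_poly_inj iota).
move: pl; rewrite /pell deg_map -El -Ex deriv_map.
by rewrite map_polyZ !rmorphM !rmorphB !rmorphXn rmorph_nat /= map_polyX !map_polyC.
Qed.

End Descent.

Section Options.
Variable K : fieldType.
Hypothesis charK0 : [pchar K] =i pred0.
Implicit Types (a b c d f p q : {poly K}).

Local Notation tau := (@chebyshev_twist K).

(** The three Pell equations describe a, b and c by twists; the relations
    between the constants bring them to the same k up to units. Then d is the
    only polynomial compatible with the commutation of twists, as twists can
    be cancelled on the left. *)
Lemma chebyshev_swap (P P' : {poly K} * {poly K}) (l xa xb xc : K) : coprime_swap P P' ->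
  l != 0 -> xa != 0 -> xb != 0 -> xc != 0 ->
  pell l xa P.1 -> pell l xc P'.1 -> pell xa xb P.2 -> chebyshev_option P P'.
Proof.
case: P P' => a b [c d] [] /= [irra irrb irrc irrd] E cop dad dbc l0 xa0 xb0 xc0 pa pc pb.
have [oa a1 _] := irra; have [ob b1 _] := irrb; have [oc c1 _] := irrc; have [od d1 _] := irrd.
have [u [u0 Ea El]] := pell_twist_eq charK0 xa0 oa (ltnW a1) pa.
have [v [v0 Ec El']] := pell_twist_eq charK0 xc0 oc (ltnW c1) pc.
have [s [s0 Eb Ex]] := pell_twist_eq charK0 xb0 ob (ltnW b1) pb.
(* The two expressions of l give xa / xc = (v / u)^2, so w turns one twist
   into the other. *)
pose w := v / u; have w0 : w != 0 by rewrite mulf_neq0 ?invr_eq0.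
pose k := xa^-1; have k0 : k != 0 by rewrite invr_eq0.
have kc : xc^-1 = k * w ^+ 2.
  have -> : xc = u ^+ 2 * xa / v ^+ 2 by rewrite -El El' mulrC mulKf // expf_neq0.
  by rewrite /k /w; field; rewrite u0 v0 xa0.
have kb : xb^-1 = k * s ^+ 2 by rewrite /k Ex; field; rewrite s0 xb0.
have {}Ec : c = u *: (tau k (deg c) \Po (w *: 'X)).
  by rewrite {1}Ec twist_scale -kc scalerA /w [u * _]mulrC divfK.
have {}Eb : b = tau k (deg b) \Po (s *: 'X) by rewrite {1}Eb twist_scale -kb.
have [on om] : odd (deg a) /\ odd (deg b).
  by split; apply: inO_odd_deg => //; apply: ltnW.
have {}Ea : a = u *: tau k (deg a) by [].
have Ed : w *: d = tau k (deg a) \Po (s *: 'X).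
  apply: (twist_cancel charK0 k0 om); rewrite ?deg_scale ?deg_comp ?deg_scaleX ?deg_twist ?muln1 //.
  - exact: inO_scale.
  - by apply: inO_comp => //; [apply: twist_odd | apply: inO_scaleX].
  - exact: ltnW.
  have E1 : a \Po b = u *: (tau k (deg b) \Po (tau k (deg a) \Po (s *: 'X))).
    by rewrite {1}Ea {1}Eb comp_polyZ comp_polyA twist_commute // -comp_polyA.
  have E2 : c \Po d = u *: (tau k (deg b) \Po (w *: d)).
    by rewrite Ec comp_polyZ -comp_polyA comp_polyZ comp_polyX dbc.
  by apply: (scalerI u0); rewrite -E1 -E2.
have pa' : prime (deg a).
  apply: (@twist_prime _ charK0 k (deg a) u 1 a) => //; first exact: oner_neq0.
  by rewrite scale1r comp_polyXr.
have pb' : prime (deg b).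
  apply: (@twist_prime _ charK0 k (deg b) 1 s b) => //; first exact: oner_neq0.
  by rewrite scale1r.
exists (deg a), (deg b), k; split=> //.
  by move=> ab; move: cop; rewrite ab /coprime gcdnn => /eqP b1'; rewrite b1' in b1.
exists u, s, 1, w; split; first by rewrite oner_neq0.
have scX (e : K) p : (e *: 'X) \Po p = e *: p by rewrite comp_polyZ comp_polyX.
split; rewrite /= ?invr1 ?scale1r ?comp_polyXr ?scX ?scale1r //.
- by rewrite comp_polyX.
- by rewrite dbc.
- by rewrite -Ed scalerA mulVf // scale1r.
Qed.

Lemma coprime_swap_sym (P P' : {poly K} * {poly K}) : coprime_swap P P' -> coprime_swap P' P.
Proof.
case=> [[i1 i2 i3 i4] E cop d1 d2]; split=> //.
by rewrite -d1 -d2 coprime_sym.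
Qed.

Lemma monomial_option_sym (P P' : {poly K} * {poly K}) : monomial_option P' P -> monomial_option P P'.
Proof.
case=> n [m [pn pm nm [u1 [u2 [w [w' [[u10 u20 w0 w'0] [e1 e2 e3 e4]]]]]]]].
exists m, n; split=> //; first by move=> mn; apply: nm.
by exists u1, u2, w', w.
Qed.

(** The statement on roots is applied over an extension; its conclusion, the
    vanishing of all coefficients but one, descends. *)
Lemma inner_monomial_swap (L : fieldType) (iota : {rmorphism K -> L}) a b c d n :
  coprime_swap (a, b) (c, d) -> c = lead_coef c *: 'X^n -> splits (map_poly iota (a \Po b)) ->
  b = lead_coef b *: 'X^n.
Proof.
case=> /= [[irra irrb irrc irrd] E cop dad dbc] Ec sf.
have [_ a1 _] := irra; have [ob b1 _] := irrb; have [_ c1 _] := irrc.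
have [pn _] := irreducible_monomial charK0 irrc Ec.
have lc0 : lead_coef c != 0 by rewrite lead_neq0 // -deg_gt0 ltnW.
have dc : deg c = n by rewrite {1}Ec deg_scale // /deg size_polyXn.
apply: (monomial_descent (iota := iota)).
apply: (@inner_monomial_split _ (pchar_extension iota charK0) (map_poly iota a) _ (map_poly iota d) (iota (lead_coef c))) => //.
- by rewrite -map_comp_poly E {1}Ec comp_polyZ comp_Xn_poly map_polyZ rmorphXn.
- exact: inO_map.
- by rewrite deg_map ltnW.
- by rewrite deg_map dbc.
- by rewrite deg_map -dc -dbc.
- by rewrite -map_comp_poly.
Qed.

(** The dichotomy is applied over an extension where the fibres are rational,
    and both of its outcomes descend to K. *)
Theorem ritt_second_odd (P P' : {poly K} * {poly K}) : coprime_swap P P' ->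
  [\/ chebyshev_option P P', power_option P P', power_option P' P | monomial_option P P'].
Proof.
move=> sw; have sw' := coprime_swap_sym sw; case: (sw) => [[irra irrb irrc irrd] E cop dad dbc].
case: P P' => a b [c d] in sw sw' irra irrb irrc irrd E cop dad dbc *.
rewrite /= in irra irrb irrc irrd E cop dad dbc.
have [oa a1 _] := irra; have [ob b1 _] := irrb; have [oc c1 _] := irrc; have [od d1 _] := irrd.
have f1 : (0 < deg (a \Po b))%N by rewrite deg_comp muln_gt0 !(ltnW a1, ltnW b1).
have [L [iota crit]] := critically_split_extension f1 (deriv_neq0 charK0 f1).
have charL := pchar_extension iota charK0.
have [sf _ _] := crit.
have EL : map_poly iota a \Po map_poly iota b = map_poly iota c \Po map_poly iota d.
  by rewrite -!map_comp_poly E.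
rewrite map_comp_poly in crit.
have oL p : inO p -> inO (map_poly iota p) by apply: inO_map.
have [|||||Mc|Ma|[l [xa [xb [xc [[l0 xa0 xb0 xc0] pa pc pb]]]]]] :=
  odd_swap_dichotomy charL EL (oL _ oa) (oL _ ob) (oL _ oc) (oL _ od) _ _ _ _ _ crit; rewrite ?deg_map //.
- have {}Mc := monomial_descent Mc; rewrite deg_map in Mc.
  have Mb := inner_monomial_swap sw Mc sf.
  by case: (power_swap charK0 sw Mc Mb) => [?|?]; [apply: Or42 | apply: Or44].
- have {}Ma := monomial_descent Ma; rewrite deg_map in Ma.
  have Md : d = lead_coef d *: 'X^(deg a) by apply: (inner_monomial_swap (iota := iota) sw' Ma); rewrite -E.
  case: (power_swap charK0 sw' Ma Md) => [?|?]; [exact: Or43 | apply: Or44].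
  exact: monomial_option_sym.
have [l1 [xa1 [El1 Exa1 pa1]]] := pell_descent charK0 a1 pa.
have [l2 [xc1 [El2 Exc1 pc1]]] := pell_descent charK0 c1 pc.
have [xa2 [xb1 [Exa2 Exb1 pb1]]] := pell_descent charK0 b1 pb.
have l12 : l2 = l1 by apply: (fmorph_inj iota); rewrite El1 El2.
have x12 : xa2 = xa1 by apply: (fmorph_inj iota); rewrite Exa1 Exa2.
apply: Or41; apply: (chebyshev_swap (l := l1) (xa := xa1) (xb := xb1) (xc := xc1) sw).
- by rewrite -(fmorph_eq0 iota) El1.
- by rewrite -(fmorph_eq0 iota) Exa1.
- by rewrite -(fmorph_eq0 iota) Exb1.
- by rewrite -(fmorph_eq0 iota) Exc1.
- exact: pa1.
- by rewrite -l12.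
- by rewrite -x12.
Qed.

(** A unit has degree 1, and a swap exchanges the two degrees. *)
Lemma linked_deg (ps qs : seq {poly K}) : linked ps qs -> perm_eq (map (@deg K) ps) (map (@deg K) qs).
Proof.
elim=> [x y [[l [r [p [q [k [k0 -> ->]]]]]]|[l [r [P [P' [[_ _ _ d1 d2] -> ->]]]]]] | x | x y z _ IH1 _ IH2].
- rewrite !map_cat /= !deg_comp !deg_scaleX ?invr_eq0 // muln1 mul1n.
  exact: perm_refl.
- rewrite !map_cat /= perm_cat2l d1 d2.
  by apply/seq.permP => h /=; rewrite addnCA.
- exact: perm_refl.
- exact: perm_trans IH1 IH2.
Qed.

Lemma perm_eq_map_perm (T S : eqType) (h : T -> S) (x0 : T) (s t : seq T) :
  perm_eq (map h s) (map h t) ->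
  exists sigma : 'S_(size s), forall i : 'I_(size s), h (nth x0 s i) = h (nth x0 t (sigma i)).
Proof.
move=> st; have sz : size (map h t) == size s.
  by rewrite -(perm_size st) size_map.
have /tuple_permP[sigma E] : perm_eq (map h s) (Tuple sz) by [].
exists sigma => i.
have szt : size t = size s by rewrite -(eqP sz) size_map.
rewrite -(nth_map x0 (h x0)) // E.
rewrite (nth_map i) ?size_enum_ord // nth_ord_enum (tnth_nth (h x0)) /= (nth_map x0) //.
by rewrite szt.
Qed.

End Options.

Theorem corollary1p3 (K : fieldType) (charK0 : [pchar K] =i pred0)
    (a : {poly K}) (a_odd : inO a) (a_deg : (1 < deg a)%N)
    (ps qs : seq {poly K})
    (a_ps : irr_decomposition a ps) (a_qs : irr_decomposition a qs) :
  [/\ size ps = size qs /\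
        (exists sigma : 'S_(size ps),
           forall i : 'I_(size ps), deg (ps`_i) = deg (qs`_(sigma i))),
      ps <> qs -> linked ps qs &
      forall (l r : seq {poly K}) (P P' : {poly K} * {poly K}),
        irr_decomposition a (l ++ P.1 :: P.2 :: r) ->
        coprime_swap P P' ->
        [\/ chebyshev_option P P', power_option P P',
            power_option P' P | monomial_option P P']].
Proof.
have L := ritt_first charK0 a_ps a_qs; have degs := linked_deg L.
split=> [|_ //|l r P P' _]; last exact: ritt_second_odd.
split; last exact: perm_eq_map_perm.
by rewrite -(size_map (@deg K) ps) (perm_size degs) size_map.
Qed.
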